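(* Let $n\ge 2$ and let $f:S^n\to\mathbb{R}^{n+1}$ be a conformal immersion (possibly with branching points of even order in the case $n=2$). Denote by $H:S^n\to\mathbb{R}$ the mean curvature of this immersion. Then, for any conformal vector field $X$ on $S^n$, $$\int_{S^n} (\partial_X H)\, f^*(d\mu)=0,$$ where $d\mu$ is the volume element on $f(S^n)$ induced from the Euclidean metric on $\mathbb{R}^{n+1}$. In particular, $\partial_X H$ changes sign.
   Context: $S^n$ carries its standard conformal structure, represented by the round metric $g_{S^n}$, and $\mathbb{R}^{n+1}$ the Euclidean metric $g_{\mathrm{eucl}}$. A smooth map $f$ is a conformal immersion if it is an immersion and $f^*g_{\mathrm{eucl}}=\lambda^2 g_{S^n}$ for some positive function $\lambda$. For $n=2$, branching points of even order are isolated points $q$ at which the immersion condition fails and around which, in a local holomorphic coordinate $z$ with $z(q)=0$, one has $\frac{\partial f}{\partial z}=A z^{k}+o(|z|^{k})$ as $z\to 0$ with $A\in\mathbb{C}^3\setminus\{0\}$ and $k$ a positive even integer (the order); away from such points $f$ is a conformal immersion. The mean curvature $H$ is the (normalized) trace of the second fundamental form with respect to a continuous choice of unit normal field; it is taken to be a smooth real-valued function on all of $S^n$, including the branching points if there are any. $f^*(d\mu)$ is the volume measure of $f^*g_{\mathrm{eucl}}$ on $S^n$. A vector field $X$ on $S^n$ is conformal if the Lie derivative of $g_{S^n}$ along $X$ is a function times $g_{S^n}$, and $\partial_X H$ is the derivative of $H$ in the direction $X$.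
   Formalization: The closing claim that ∂_X H changes sign is proved when ∂_X H is not identically zero (it then takes both negative and positive values); as written it fails when ∂_X H vanishes identically, e.g. for the round sphere, where H is constant, or for X = 0. *)

(* Defs.v *)
From HB Require Import structures.
From mathcomp Require Import all_boot all_order all_algebra.
From mathcomp Require Import complex.
From mathcomp Require Import all_classical all_reals all_analysis.

Set Implicit Arguments.
Unset Strict Implicit.
Unset Printing Implicit Defensive.

Import Order.TTheory GRing.Theory Num.Theory.
Import numFieldTopology.Exports numFieldNormedType.Exports.

Local Open Scope classical_set_scope.
Local Open Scope ring_scope.

(* R^m is 'rV[R]_m.  Maps on S^n are represented by total functions on
   R^(n+1); every notion below depends only on their values on the sphere. *)

Section Euclidean.
Context {R : realType}.

(* The norm `|x| of 'rV[R]_m is the sup norm, hence the explicit Euclidean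
   inner product and norm. *)
Definition dot m (u v : 'rV[R]_m) : R := \sum_(i < m) u 0 i * v 0 i.

Definition enorm m (u : 'rV[R]_m) : R := Num.sqrt (dot u u).

Definition sphere {n} : set 'rV[R]_n.+1 := [set x | dot x x = 1].

Definition tangent m (x v : 'rV[R]_m) : Prop := dot x v = 0.

End Euclidean.

Section SmoothMaps.
Context {R : realType}.

(* [:: v1; ..; vk] gives D_v1 (.. (D_vk F)). *)
Definition iterD (V W : normedModType R) (vs : seq V) (F : V -> W) : V -> W :=
  foldr (fun v G x => 'D_v G x) F vs.

(* C^infinity on an open set U: all iterated directional derivatives exist and
   are (Frechet) differentiable at the points of U. *)
Definition smooth_on (V W : normedModType R) (U : set V) (F : V -> W) : Prop :=
  forall (vs : seq V) (x : V), U x -> differentiable (iterD vs F) x.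

(* Pullback of a map on S^n along the submersion x |-> x / |x| from
   R^(n+1) \ {0} onto S^n. *)
Definition radial m (T : Type) (f : 'rV[R]_m -> T) : 'rV[R]_m -> T :=
  fun x => f ((enorm x)^-1 *: x).

Definition sphere_smooth n (W : normedModType R) (f : 'rV[R]_n.+1 -> W) :=
  smooth_on [set x | x != 0] (radial f).

(* Differential of a map f on S^n at x, applied to a tangent vector v at x
   (the derivative of x |-> x / |x| at x fixes the tangent vectors). *)
Definition sdiff n (W : normedModType R) (f : 'rV[R]_n.+1 -> W)
    (x v : 'rV[R]_n.+1) : W :=
  'D_v (radial f) x.

End SmoothMaps.

Section ConformalImmersions.
Context {R : realType} {n : nat}.
Implicit Types (f : 'rV[R]_n.+1 -> 'rV[R]_n.+1) (A : set 'rV[R]_n.+1).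

Definition pullback_metric f (x u v : 'rV[R]_n.+1) : R :=
  dot (sdiff f x u) (sdiff f x v).

Definition immersed_at f (x : 'rV[R]_n.+1) : Prop :=
  forall u, tangent x u -> sdiff f x u = 0 -> u = 0.

Definition conformal_immersion_on A f : Prop :=
  (forall x, A x -> immersed_at f x) /\
  exists lambda : 'rV[R]_n.+1 -> R, forall x, A x ->
    0 < lambda x /\
    forall u v, tangent x u -> tangent x v ->
      pullback_metric f x u v = lambda x ^+ 2 * dot u v.

Definition branch_set f : set 'rV[R]_n.+1 :=
  [set q | sphere q /\ ~ immersed_at f q].

Definition regular_set f : set 'rV[R]_n.+1 := sphere `\` branch_set f.

(* psi is the inverse of a local holomorphic coordinate z of S^2 with
   z(q) = 0, defined on the open subset U of the plane: psi is conformal for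
   the round metric.  No orientation of S^2 is fixed; replacing z by its
   conjugate turns df/dz and A into their conjugates in the expansion below. *)
Definition holomorphic_chart (U : set (R * R)) (psi : R * R -> 'rV[R]_n.+1)
    (q : 'rV[R]_n.+1) : Prop :=
  [/\ open U, U (0, 0) /\ psi (0, 0) = q, smooth_on U psi,
      (forall p, U p -> sphere (psi p)) /\ {in U &, injective psi} &
      forall p, U p ->
        let ds := 'D_(1, 0) psi p in let dt := 'D_(0, 1) psi p in
        [/\ 0 < dot ds ds, dot dt dt = dot ds ds & dot ds dt = 0]].

(* d/dz = (d/ds - i d/dt) / 2, where z = s + i t. *)
Definition dz (F : R * R -> 'rV[R]_n.+1) (p : R * R) : 'rV[R[i]]_n.+1 :=
  \row_j Complex ('D_(1, 0) F p 0 j / 2) (- ('D_(0, 1) F p 0 j / 2)).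

Definition even_branching_point f (q : 'rV[R]_n.+1) : Prop :=
  [/\ sphere q, ~ immersed_at f q,
      \forall x \near q^', sphere x -> immersed_at f x &
      exists U psi (a : 'rV[R[i]]_n.+1) (k : nat),
        [/\ holomorphic_chart U psi q, a != 0, (0 < k)%N, ~~ odd k &
          forall e : R, 0 < e -> \forall p \near ((0, 0) : R * R),
            let z := Complex p.1 p.2 in
            forall j, `|dz (f \o psi) p 0 j - a 0 j * z ^+ k|
                      <= e%:C%C * `|z| ^+ k]].

Definition branched_conformal_immersion f : Prop :=
  [/\ sphere_smooth f, conformal_immersion_on (regular_set f) f &
      forall q, branch_set f q -> n = 2 /\ even_branching_point f q].

End ConformalImmersions.

Section MeanCurvature.
Context {R : realType} {n : nat}.
Implicit Types (f N : 'rV[R]_n.+1 -> 'rV[R]_n.+1) (x u v : 'rV[R]_n.+1).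

Definition unit_normal_field f N : Prop :=
  {within regular_set f, continuous N} /\
  forall x, regular_set f x ->
    dot (N x) (N x) = 1 /\
    forall u, tangent x u -> dot (N x) (sdiff f x u) = 0.

(* II(u, v) = <N, D_u (df(V))>, where V is the tangent field
   y |-> v - <y, v> y, which extends the tangent vector v at x: on the sphere,
   df_y(V y) = 'D_v (radial f) y. *)
Definition second_fundamental_form f N x u v : R :=
  dot (N x) ('D_u (fun y => 'D_v (radial f) y) x).

Definition orthonormal_frame f x (e : 'I_n -> 'rV[R]_n.+1) : Prop :=
  (forall i, tangent x (e i)) /\
  forall i j, pullback_metric f x (e i) (e j) = (i == j)%:R.

(* H = trace of II with respect to f^* g_eucl, divided by n: the trace is computed
   in orthonormal frames, which exist at every regular point and all give the
   same value.  At branching points H is pinned down by its continuity. *)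
Definition mean_curvature_of f N (H : 'rV[R]_n.+1 -> R) : Prop :=
  forall x, regular_set f x -> forall e, orthonormal_frame f x e ->
    H x = n%:R^-1 * \sum_i second_fundamental_form f N x (e i) (e i).

End MeanCurvature.

Section ConformalFields.
Context {R : realType} {n : nat}.
Implicit Types (X U V : 'rV[R]_n.+1 -> 'rV[R]_n.+1) (x : 'rV[R]_n.+1).

Definition tangent_field X : Prop :=
  sphere_smooth X /\ forall x, sphere x -> tangent x (X x).

Definition deriv_along X (h : 'rV[R]_n.+1 -> R) x : R := sdiff h x (X x).

Definition lie_bracket X U x : 'rV[R]_n.+1 :=
  sdiff U x (X x) - sdiff X x (U x).

(* (L_X g)(U, V) = X(g(U, V)) - g([X, U], V) - g(U, [X, V]). *)
Definition lie_round_metric X U V x : R :=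
  deriv_along X (fun y => dot (U y) (V y)) x
  - dot (lie_bracket X U x) (V x) - dot (U x) (lie_bracket X V x).

Definition conformal_field X : Prop :=
  tangent_field X /\
  exists phi : 'rV[R]_n.+1 -> R,
    forall U V, tangent_field U -> tangent_field V ->
      forall x, sphere x -> lie_round_metric X U V x = phi x * dot (U x) (V x).

End ConformalFields.

Section LebesgueMeasure.
Context {R : realType}.
Notation RT := (measurableTypeR R).

Definition cons_pair m (p : RT * m.-tuple RT) : m.+1.-tuple RT :=
  [tuple of p.1 :: p.2].

Lemma measurable_cons_pair m : measurable_fun setT (@cons_pair m).
Proof.
apply: measurable_cons; [exact: measurable_fst | exact: measurable_snd].
Qed.

Section step.
Variables (m : nat) (mu : {sigma_finite_measure set (m.-tuple RT) -> \bar R}).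

Definition lebesgue_cons : set (m.+1.-tuple RT) -> \bar R :=
  pushforward (@lebesgue_measure R \x mu)%E (@cons_pair m).

Let lebesgue_cons0 : lebesgue_cons set0 = 0%E.
Proof. by rewrite /lebesgue_cons /pushforward preimage_set0 measure0. Qed.

Let lebesgue_cons_ge0 A : (0 <= lebesgue_cons A)%E.
Proof. by rewrite /lebesgue_cons /pushforward measure_ge0. Qed.

Let lebesgue_cons_sigma_additive : semi_sigma_additive lebesgue_cons.
Proof.
have mcp := @measurable_cons_pair m.
exact: (@measure_semi_sigma_additive _ _ _ (pushforward _ (@cons_pair m))).
Qed.

HB.instance Definition _ := isMeasure.Build _ _ _ lebesgue_cons
  lebesgue_cons0 lebesgue_cons_ge0 lebesgue_cons_sigma_additive.

Lemma sigma_finite_lebesgue_cons : sigma_finite setT lebesgue_cons.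
Proof.
have /sigma_finiteP[F [TF ndF Foo]] := sigma_finiteT (@lebesgue_measure R).
have /sigma_finiteP[G [TG ndG Goo]] := sigma_finiteT mu.
pose g (t : m.+1.-tuple RT) : RT * m.-tuple RT := (thead t, [tuple of behead t]).
have mg : measurable_fun setT g.
  by apply: measurable_fun_pair; [exact: measurable_tnth|exact: measurable_behead].
have gK p : g (cons_pair p) = p.
  by case: p => a b; rewrite /g/= theadE; congr pair; exact/val_inj.
exists (fun i => g @^-1` (F i `*` G i)).
  rewrite -preimage_bigcup (_ : \bigcup_i _ = setT) ?preimage_setT//.
  apply/seteqP; split=> // -[x y] _.
  have [i _ Fx] : (\bigcup_i F i) x by rewrite -TF.
  have [j _ Gy] : (\bigcup_i G i) y by rewrite -TG.
  exists (maxn i j) => //; split => /=.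
  - by move: x Fx; exact/subsetPset/ndF/leq_maxl.
  - by move: y Gy; exact/subsetPset/ndG/leq_maxr.
move=> i; have [mF Fi] := Foo i; have [mG Gi] := Goo i.
split; first by rewrite -[X in measurable X]setTI; apply: mg => //; exact: measurableX.
rewrite /lebesgue_cons /pushforward -comp_preimage.
rewrite (_ : g \o _ = id) ?preimage_id; last by apply/funext => p; exact: gK.
by rewrite product_measure1E// lte_mul_pinfty// ge0_fin_numE.
Qed.

HB.instance Definition _ := Measure_isSigmaFinite.Build _ _ _ lebesgue_cons
  sigma_finite_lebesgue_cons.

End step.

(* Lebesgue measure on R^m, as an iterated product. *)
Fixpoint lebesgue_tuple (m : nat) :
    {sigma_finite_measure set (m.-tuple RT) -> \bar R} :=
  match m with
  | 0 => dirac [tuple]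
  | k.+1 => lebesgue_cons (lebesgue_tuple k)
  end.

End LebesgueMeasure.

Section PullbackVolume.
Context {R : realType} {n : nat}.

Definition row_of_tuple (t : n.-tuple (measurableTypeR R)) : 'rV[R]_n :=
  \row_i (tnth t i : R).

(* Inverse stereographic projection from (1, 0, .., 0): a diffeomorphism from
   R^n onto S^n minus that point. *)
Definition stereo (y : 'rV[R]_n) : 'rV[R]_n.+1 :=
  (1 + dot y y)^-1 *: row_mx (dot y y - 1)%:M (2 *: y).

(* sqrt(det(g_ij)) for g = f^* g_eucl in the coordinates given by stereo. *)
Definition volume_density (f : 'rV[R]_n.+1 -> 'rV[R]_n.+1) (y : 'rV[R]_n) : R :=
  let d i := 'D_(delta_mx 0 i) (f \o stereo) y in
  Num.sqrt (\det (\matrix_(i < n, j < n) dot (d i) (d j))).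

(* Integral over S^n of h against the Riemannian volume measure of f^* g_eucl,
   written in the stereographic chart, whose domain misses one point, a null
   set. *)
Definition integral_pullback_volume (f : 'rV[R]_n.+1 -> 'rV[R]_n.+1)
    (h : 'rV[R]_n.+1 -> R) : \bar R :=
  (\int[@lebesgue_tuple R n]_t
    (h (stereo (row_of_tuple t)) * volume_density f (row_of_tuple t))%:E)%E.

End PullbackVolume.

(* Main.v *)
(* Write F, nu, h for f, N, H read in the stereographic chart sigma, r = rho^2 for
   the conformal factor |d_i F|^2, B_ij = <nu, d_i d_j F> and x_j for the
   components of X in the frame d_j sigma.  Codazzi's equation, tr B = n h r and
   d_i x_j + d_j x_i = t delta_ij show that the field
     W_i = rho^(n-2) (sum_j B_ij x_j - h r x_i)
   has divergence (n-1) rho^n (x . grad h), that is (n-1) times the integrand in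
   the chart.  By compactness of the sphere, W = O((1+|y|^2)^(1-n)) and the
   integrand is O((1+|y|^2)^(-n)).  Branching points are isolated, hence finite in
   number.  One multiplies W by a cutoff vanishing near them (gradient O(1/eps)
   on a set of measure O(eps^n), and n >= 2), applies the divergence theorem on
   the cube [-k,k]^n, and lets eps -> 0 and then k -> oo.

   If d_X H did not change sign, the vanishing of its integral would force it to
   vanish at all regular points of the chart, which are dense. *)

(* The bracket in [W] is the tracefree part of the second fundamental form, contracted with [X]. By
   Codazzi's equation the divergence of that tensor is (n-1) dH, and its pairing with the derivative
   of [X] vanishes, because the symmetrised derivative of a conformal field is a multiple of the
   metric. The factor rho^(n-2) is the volume density rho^n times rho^(-2), which raises an index;
   with it the divergence can be computed in plain coordinates. The obstacle is that the normal and
   the immersion property are lost at branching points and that the chart omits a pole. Both are met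
   by estimates on [W] that never divide by rho: only derivatives of f, a unit vector, H and X
   enter, all bounded on the sphere, and the decay comes from the conformal factor of the
   stereographic chart alone. On the faces of a cube of size k the field is of order k^(2-2n), while
   the faces have measure of order k^(n-1), so the flux tends to 0. *)
From mathcomp Require Import all_boot all_order all_algebra.
From mathcomp Require Import all_classical all_reals all_analysis.
From mathcomp Require Import measurable_realfun ring lra.
Require Import Defs.

Set Implicit Arguments.
Unset Strict Implicit.
Unset Printing Implicit Defensive.

Import Order.TTheory GRing.Theory Num.Theory.
Import numFieldTopology.Exports numFieldNormedType.Exports.

Local Open Scope classical_set_scope.
Local Open Scope ring_scope.

(** * Functions of class C^k *)

Section Ck.
Context {R : realType}.
Implicit Types V W : normedModType R.

(** The difference [g - f] vanishes near [x], so its differential at [x] is zero, and [g] is [f]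
    plus this difference. *)
Lemma near_eq_differentiable V W (f g : V -> W) x :
  {near x, f =1 g} -> differentiable f x -> differentiable g x.
Proof.
move=> fg df; have -> : g = f + (g - f) by rewrite addrC subrK.
apply: differentiableD => //; set e := g - f.
have e0 : \forall y \near x, e y = 0.
  by move: fg; apply: filterS => y; rewrite /e !fctE => ->; rewrite subrr.
have lo : e \o shift x = cst (e x) + (\0 : V -> W) +o_ 0 id.
  apply/eqaddoP => eps eps0.
  have ex0 : e x = 0 by exact: (nbhs_singleton e0).
  rewrite ex0; move: e0; rewrite (near_shift 0 x); apply: filterS => h /=.
  rewrite subr0 => eh; have -> : (e \o shift x - (cst 0 + \0)) h = 0.
    by rewrite !fctE /= addr0 subr0 /= eh.
  by rewrite normr0 mulr_ge0// ltW.
have d0 : 'd e x = \0 :> (V -> W).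
  by apply: diff_unique => //; exact: cst_continuous.
apply/diff_locallyP; rewrite d0; split=> //; exact: cst_continuous.
Qed.

(* [smooth_on U F] is [forall k, Ck k U F]; the index is there to induct on. *)
Fixpoint Ck (k : nat) V W (U : set V) (F : V -> W) : Prop :=
  (forall x, U x -> differentiable F x) /\
  match k with 0 => True | k'.+1 => forall v, Ck k' U ('D_v F) end.

Lemma Ck_diff k V W (U : set V) (F : V -> W) x :
  Ck k U F -> U x -> differentiable F x.
Proof. by case: k => [|k] [dF _] Ux; exact: dF. Qed.

Lemma Ck_derive k V W (U : set V) (F : V -> W) v :
  Ck k.+1 U F -> Ck k U ('D_v F).
Proof. by case=> _; apply. Qed.

Lemma Ck_pred k V W (U : set V) (F : V -> W) : Ck k.+1 U F -> Ck k U F.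
Proof.
elim: k F => [|k IH] F [dF DF]; split=> //= v; apply: IH; exact: DF.
Qed.

Lemma Ck_subset k V W (U U' : set V) (F : V -> W) :
  U `<=` U' -> Ck k U' F -> Ck k U F.
Proof.
move=> UU'; elim: k F => [|k IH] F [dF DF].
  by split=> // x /UU'; exact: dF.
by split=> [x /UU'|v]; [exact: dF|apply: IH; exact: DF].
Qed.

(** ['D_v F] is a function on the whole space, so [Ck] is a condition at each point of the set; [U']
    may be any set containing the point. *)
Lemma Ck_local k V W (U : set V) (F : V -> W) :
  (forall x, U x -> exists2 U', U' x & Ck k U' F) -> Ck k U F.
Proof.
elim: k F => [|k IH] F H;
  (have dF x (Ux : U x) : differentiable F x;
   [by have [U' U'x kF] := H x Ux; exact: Ck_diff kF U'x|split=> // v]).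
by apply: IH => x /H[U' U'x /(@Ck_derive _ _ _ _ _ v) ?]; exists U'.
Qed.

Lemma iterD_rcons V W (F : V -> W) vs v :
  iterD (rcons vs v) F = iterD vs ('D_v F).
Proof. by rewrite /iterD foldr_rcons. Qed.

Lemma smooth_onP V W (U : set V) (F : V -> W) :
  smooth_on U F <-> forall k, Ck k U F.
Proof.
split=> [+ k|].
  elim: k F => [|k IH] F sF.
    by split=> // x Ux; exact: (sF [::]).
  split=> [x Ux|v]; first exact: (sF [::]).
  apply: IH => vs x Ux; have := sF (rcons vs v) x Ux; by rewrite iterD_rcons.
move=> H vs; elim/last_ind: vs F H => [|vs v IH] F H x Ux.
  exact: (Ck_diff (H 0)).
by rewrite iterD_rcons; apply: IH => // k; exact/Ck_derive.
Qed.

(** Openness turns equality on [U] into equality near each of its points, which passes to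
    derivatives, so the induction goes on. *)
Lemma Ck_ext k V W (U : set V) (F G : V -> W) : open U ->
  (forall x, U x -> F x = G x) -> Ck k U F -> Ck k U G.
Proof.
move=> oU; elim: k F G => [|k IH] F G FG [dF DF];
  (have dG x (Ux : U x) : differentiable G x;
   [by apply: near_eq_differentiable (dF _ Ux);
      apply: filterS FG _; exact: open_nbhs_nbhs|split=> // v]).
apply: (IH _ _ _ (DF v)) => x Ux; apply: near_eq_derive.
  by apply: filterS FG _; exact: open_nbhs_nbhs.
Qed.

Lemma derive_ext V W (U : set V) (F G : V -> W) x v : open U -> U x ->
  (forall x, U x -> F x = G x) -> 'D_v F x = 'D_v G x.
Proof.
move=> oU Ux FG; apply: near_eq_derive.
by apply: filterS FG _; exact: open_nbhs_nbhs.
Qed.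

Lemma Ck_continuous k V W (U : set V) (F : V -> W) x :
  Ck k U F -> U x -> {for x, continuous F}.
Proof. by move=> kF Ux; exact/differentiable_continuous/(Ck_diff kF). Qed.

Lemma Ck_derivable k V W (U : set V) (F : V -> W) x v :
  Ck k U F -> U x -> derivable F x v.
Proof. by move=> kF Ux; exact/diff_derivable/(Ck_diff kF). Qed.

Lemma Ck_cst k V W (U : set V) (c : W) : Ck k U (fun=> c).
Proof.
elim: k c => [|k IH] c;
  (have dc x (_ : U x) : differentiable (fun=> c : W) x;
   [by exact: differentiable_cst|split=> // v]).
by under eq_fun do rewrite derive_cst; exact: IH.
Qed.

Lemma derive_add V W (f g : V -> W) x v :
  differentiable f x -> differentiable g x ->
  'D_v (fun y => f y + g y) x = 'D_v f x + 'D_v g x.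
Proof. by move=> df dg; apply: deriveD; exact: diff_derivable. Qed.

Lemma Ck_add k V W (U : set V) (f g : V -> W) : open U ->
  Ck k U f -> Ck k U g -> Ck k U (fun x => f x + g x).
Proof.
move=> oU; elim: k f g => [|k IH] f g [df Df] [dg Dg];
  (have dfg x (Ux : U x) : differentiable (fun y => f y + g y) x;
   [by apply: differentiableD; [exact: df|exact: dg]|split=> // v]).
apply: (Ck_ext oU _ (IH _ _ (Df v) (Dg v))) => x Ux.
by rewrite derive_add//; [exact: df|exact: dg].
Qed.

Lemma derive_mul V (f g : V -> R) x v :
  differentiable f x -> differentiable g x ->
  'D_v (fun y => f y * g y) x = 'D_v f x * g x + f x * 'D_v g x.
Proof.
move=> df dg; have -> : (fun y => f y * g y) = f * g by [].
rewrite deriveM; do ?exact: diff_derivable.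
by rewrite addrC /GRing.scale/= [g x * _]mulrC.
Qed.

Lemma Ck_mul k V (U : set V) (f g : V -> R) : open U ->
  Ck k U f -> Ck k U g -> Ck k U (fun x => f x * g x).
Proof.
move=> oU; elim: k f g => [|k IH] f g kf kg; have [df Df] := kf;
  have [dg Dg] := kg;
  (have dfg x (Ux : U x) : differentiable (fun y => f y * g y) x;
   [by apply: differentiableM; [exact: df|exact: dg]|split=> // v]).
apply: (Ck_ext oU (F := fun x => 'D_v f x * g x + f x * 'D_v g x)).
  by move=> x Ux; rewrite derive_mul//; [exact: df|exact: dg].
by apply: Ck_add => //; apply: IH => //; first [exact: Ck_pred|exact: Ck_derive].
Qed.

Lemma Ck_sum k V W (U : set V) (I : Type) (s : seq I) (P : pred I) (f : I -> V -> W) :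
  open U -> (forall i, P i -> Ck k U (f i)) ->
  Ck k U (fun x => \sum_(i <- s | P i) f i x).
Proof.
move=> oU kf; elim: s => [|i s IH].
  have -> : (fun x => \sum_(j <- [::] | P j) f j x) = fun=> 0.
    by apply/funext => x; rewrite big_nil.
  exact: Ck_cst.
have -> : (fun x => \sum_(j <- i :: s | P j) f j x) =
          (fun x => (if P i then f i x else 0) + \sum_(j <- s | P j) f j x).
  by apply/funext => x; rewrite big_cons; case: ifP => //; rewrite add0r.
by apply: Ck_add => //; case E : (P i); [exact: kf|exact: Ck_cst].
Qed.

Lemma derive_bigsum V W (I : Type) (s : seq I) (P : pred I) (f : I -> V -> W) x v :
  (forall i, P i -> differentiable (f i) x) ->
  'D_v (fun y => \sum_(i <- s | P i) f i y) x = \sum_(i <- s | P i) 'D_v (f i) x.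
Proof.
move=> df; suff [] : differentiable (fun y => \sum_(i <- s | P i) f i y) x /\
  'D_v (fun y => \sum_(i <- s | P i) f i y) x = \sum_(i <- s | P i) 'D_v (f i) x by [].
elim: s => [|i s [dIH IH]].
  rewrite big_nil; have -> : (fun y => \sum_(j <- [::] | P j) f j y) = cst 0.
    by apply/funext => y; rewrite big_nil.
  by split; [exact: differentiable_cst|exact: derive_cst].
rewrite big_cons; case: ifPn => Pi.
  have -> : (fun y => \sum_(j <- i :: s | P j) f j y) =
            (fun y => f i y + \sum_(j <- s | P j) f j y).
    by apply/funext => y; rewrite big_cons Pi.
  by split; [apply: differentiableD|rewrite derive_add// ?IH]; rewrite //; exact: df.
have -> : (fun y => \sum_(j <- i :: s | P j) f j y) =
          (fun y => \sum_(j <- s | P j) f j y).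
  by apply/funext => y; rewrite big_cons (negbTE Pi).
by [].
Qed.

Lemma derive_comp V V' W (g : V -> V') (f : V' -> W) x v :
  differentiable g x -> differentiable f (g x) ->
  'D_v (f \o g) x = 'D_('D_v g x) f (g x).
Proof.
move=> dg df; rewrite !deriveE//; first by rewrite diff_comp.
exact: differentiable_comp.
Qed.

Lemma derive_dirD V W (f : V -> W) x u v : differentiable f x ->
  'D_(u + v) f x = 'D_u f x + 'D_v f x.
Proof. by move=> df; rewrite !deriveE// linearD. Qed.

Lemma derive_dirZ V W (f : V -> W) x (a : R) v : differentiable f x ->
  'D_(a *: v) f x = a *: 'D_v f x.
Proof. by move=> df; rewrite !deriveE// linearZ. Qed.

Lemma derive_dir_sum V W (f : V -> W) x (I : Type) (s : seq I) (u : I -> V) :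
  differentiable f x ->
  'D_(\sum_(i <- s) u i) f x = \sum_(i <- s) 'D_(u i) f x.
Proof.
by move=> df; rewrite deriveE// linear_sum; apply: eq_bigr => i _; rewrite deriveE.
Qed.

Lemma derive_row V m (F : V -> 'rV[R]_m) x v j : derivable F x v ->
  'D_v F x 0 j = 'D_v (fun y => F y 0 j) x.
Proof. by move=> dF; rewrite derive_mx// mxE. Qed.

Lemma differentiable_entry V m (F : V -> 'rV[R]_m) x j :
  differentiable F x -> differentiable (fun y => F y 0 j) x.
Proof.
move=> dF; apply: (@differentiable_comp _ _ _ _ F (fun M : 'rV[R]_m => M 0 j)) => //.
exact: differentiable_coord.
Qed.

Lemma row_sumE V m (F : V -> 'rV[R]_m) :
  F = \sum_j (fun y => F y 0 j *: delta_mx 0 j).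
Proof.
apply/funext => y; rewrite fct_sumE; apply/rowP => j.
rewrite summxE (bigD1 j)//= big1 => [|i ij]; first by rewrite !mxE !eqxx mulr1 addr0.
by rewrite !mxE eqxx eq_sym (negbTE ij) mulr0.
Qed.

Lemma differentiable_rowP V m (F : V -> 'rV[R]_m) x :
  (forall j, differentiable (fun y => F y 0 j) x) -> differentiable F x.
Proof.
move=> dF; rewrite [F]row_sumE; apply: differentiable_sum => j.
exact: differentiableZl.
Qed.

Lemma Ck_rowP k V m (U : set V) (F : V -> 'rV[R]_m) : open U ->
  Ck k U F <-> forall j, Ck k U (fun y => F y 0 j).
Proof.
move=> oU; split.
  elim: k F => [|k IH] F [dF DF] j;
  (have dFj x (Ux : U x) : differentiable (fun y => F y 0 j) x;
   [by exact/differentiable_entry/dF|split=> // v]).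
  apply: (Ck_ext oU _ (IH _ (DF v) j)) => x Ux.
  by rewrite derive_row//; apply/diff_derivable/dF.
elim: k F => [|k IH] F kF;
  (have dF x (Ux : U x) : differentiable F x;
   [by apply: differentiable_rowP => j; exact: Ck_diff (kF j) Ux|split=> // v]).
apply: IH => j; apply: (Ck_ext oU _ (Ck_derive v (kF j))) => x Ux.
rewrite derive_row//; apply/diff_derivable/differentiable_rowP => i.
exact: Ck_diff (kF i) Ux.
Qed.

(** In the chain rule the direction in which [f] is differentiated varies with the point. Expanding
    it in the standard basis of the middle space leaves fixed directions, to which the induction
    hypothesis applies. *)
Lemma Ck_comp k m V (U : set V) (U' : set 'rV[R]_m) (g : V -> 'rV[R]_m)
    (f : 'rV[R]_m -> R) : open U ->
  (forall x, U x -> U' (g x)) -> Ck k U g -> Ck k U' f -> Ck k U (f \o g).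
Proof.
move=> oU gU; elim: k f g gU => [|k IH] f g gU kg kf;
  have [dg Dg] := kg; have [df Df] := kf;
  (have dfg x (Ux : U x) : differentiable (f \o g) x;
   [by apply: differentiable_comp; [exact: dg|exact/df/gU]|split=> // v]).
apply: (Ck_ext oU (F := fun x => \sum_j 'D_v g x 0 j * ('D_(delta_mx 0 j) f \o g) x)).
  move=> x Ux; have dgx := dg _ Ux; have dfx := df _ (gU _ Ux).
  rewrite [RHS]derive_comp// [in RHS](matrix_sum_delta ('D_v g x)) big_ord1 derive_dir_sum//.
  by apply: eq_bigr => j _; rewrite derive_dirZ.
apply: Ck_sum => // j _; apply: Ck_mul => //.
  by move: j; apply/Ck_rowP => //; exact: Dg.
by apply: IH => //; first [exact: Ck_pred|exact: Ck_derive].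
Qed.

Lemma derive_scalar (f : R -> R) x v : differentiable f x ->
  'D_v f x = v * 'D_1 f x.
Proof. by move=> df; rewrite -[v in LHS]mulr1 derive_dirZ. Qed.

Lemma Ck_comp1 k V (U : set V) (U' : set R) (g : V -> R) (f : R -> R) : open U ->
  (forall x, U x -> U' (g x)) -> Ck k U g -> Ck k U' f -> Ck k U (fun x => f (g x)).
Proof.
move=> oU; elim: k f g => [|k IH] f g gU kg kf;
  have [dg Dg] := kg; have [df Df] := kf;
  (have dfg x (Ux : U x) : differentiable (fun y => f (g y)) x;
   [by apply: (@differentiable_comp _ _ _ _ g f); [exact: dg|exact/df/gU]|split=> // v]).
apply: (Ck_ext oU (F := fun x => 'D_v g x * 'D_1 f (g x))).
  move=> x Ux; have dgx := dg _ Ux; have dfx := df _ (gU _ Ux).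
  by rewrite -derive_scalar// -derive_comp.
apply: Ck_mul => //; first exact: Ck_derive.
by apply: (IH ('D_1 f) g) => //; first [exact: Ck_pred|exact: Ck_derive].
Qed.

End Ck.

Section CkR.
Context {R : realType}.
Implicit Types V W : normedModType R.

Lemma Ck_scalec k V W (U : set V) (c : R) (F : V -> W) : open U ->
  Ck k U F -> Ck k U (fun x => c *: F x).
Proof.
move=> oU; elim: k F => [|k IH] F kF;
  (have dF x (Ux : U x) : differentiable (fun x => c *: F x) x;
   [exact/differentiableZ/(Ck_diff kF)|split=> // v]).
apply: (Ck_ext oU _ (IH _ (Ck_derive v kF))) => x Ux.
by rewrite [RHS](@deriveZ _ _ _ F)//; exact: Ck_derivable kF Ux.
Qed.

Lemma Ck_opp k V W (U : set V) (F : V -> W) : open U ->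
  Ck k U F -> Ck k U (fun x => - F x).
Proof. by move=> oU kF; under eq_fun do rewrite -scaleN1r; exact: Ck_scalec. Qed.

Lemma derive_opp V W (F : V -> W) x v : differentiable F x ->
  'D_v (fun y => - F y) x = - 'D_v F x.
Proof. by move=> dF; apply: deriveN; exact: diff_derivable. Qed.

Lemma derive_sub V W (F G : V -> W) x v :
  differentiable F x -> differentiable G x ->
  'D_v (fun y => F y - G y) x = 'D_v F x - 'D_v G x.
Proof. by move=> dF dG; apply: deriveB; exact: diff_derivable. Qed.

Lemma derive_subc V W (F : V -> W) c x v : differentiable F x ->
  'D_v (fun y => F y - c) x = 'D_v F x.
Proof.
move=> dF; rewrite (derive_sub v dF (differentiable_cst c x)).
by rewrite [X in _ - X]derive_cst subr0.
Qed.

Lemma derive_csub V W (F : V -> W) c x v : differentiable F x ->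
  'D_v (fun y => c - F y) x = - 'D_v F x.
Proof.
move=> dF; rewrite (derive_sub v (differentiable_cst c x) dF).
by rewrite [X in X - _]derive_cst sub0r.
Qed.

Lemma derive_scalec V W (c : R) (F : V -> W) x v : differentiable F x ->
  'D_v (fun y => c *: F y) x = c *: 'D_v F x.
Proof. by move=> dF; apply: deriveZ; exact: diff_derivable. Qed.

Lemma Ck_minus k V W (U : set V) (F G : V -> W) : open U ->
  Ck k U F -> Ck k U G -> Ck k U (fun x => F x - G x).
Proof. by move=> oU kF kG; apply: Ck_add => //; exact: Ck_opp. Qed.

Lemma Ck_exp k V (U : set V) (f : V -> R) n : open U ->
  Ck k U f -> Ck k U (fun x => f x ^+ n).
Proof.
move=> oU kf; elim: n => [|n IH]; first exact: (Ck_cst _ _ (1 : R)).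
by under eq_fun do rewrite exprS; exact: Ck_mul.
Qed.

Lemma derive_exp V (f : V -> R) n x v : differentiable f x ->
  'D_v (fun y => f y ^+ n) x = n%:R * f x ^+ n.-1 * 'D_v f x.
Proof.
move=> df; have := @deriveX _ _ f n x v (diff_derivable df).
have -> : f ^+ n = fun y => f y ^+ n.
  by apply/funext => y; elim: n => [|n IH]; rewrite ?expr0// !exprS -IH.
by move=> ->; rewrite /GRing.scale/= mulr_natl.
Qed.

Lemma is_derive_inv (s v : R) : s != 0 ->
  differentiable (fun t : R => t^-1) s /\ 'D_v (fun t : R => t^-1) s = - (s^-1 * s^-1) * v.
Proof.
move=> s0; have ds : differentiable (fun t : R => t^-1) s by exact: differentiable_Rinv.
split=> //; rewrite deriveE// diff_Rinv//.
by rewrite /GRing.scale/= expr2 invfM.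
Qed.

Lemma open_neq0 : open [set s : R | s != 0].
Proof. by have := @open_neq R 0; congr open; apply/seteqP; split=> s. Qed.

Lemma Ck_invR k : Ck k [set s : R | s != 0] (fun s : R => s^-1).
Proof.
have oU := open_neq0; elim: k => [|k IH];
  (have dF (x : R) (Ux : [set s : R | s != 0] x) : differentiable (fun s : R => s^-1) x;
   [exact: (is_derive_inv 1 Ux).1|split=> // v]).
apply: (Ck_ext oU (F := fun s : R => (- v) * (s^-1 * s^-1))).
  by move=> x Ux; rewrite (is_derive_inv v Ux).2; ring.
by apply: Ck_scalec => //; exact: Ck_mul.
Qed.

Lemma Ck_inv k V (U : set V) (f : V -> R) : open U ->
  (forall x, U x -> f x != 0) -> Ck k U f -> Ck k U (fun x => (f x)^-1).
Proof. by move=> oU f0 kf; apply: (Ck_comp1 oU f0 kf); exact: Ck_invR. Qed.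

Lemma derive_inv V (f : V -> R) x v : differentiable f x -> f x != 0 ->
  'D_v (fun y => (f y)^-1) x = - ((f x)^-1 * (f x)^-1) * 'D_v f x.
Proof.
move=> df f0; have [dV DV] := is_derive_inv ('D_v f x) f0.
by rewrite -DV -[RHS]derive_comp.
Qed.

Lemma Ck_sqrtR k : Ck k [set s : R | 0 < s] (@Num.sqrt R).
Proof.
have oU : open [set s : R | 0 < s] by exact: open_gt.
elim: k => [|k IH];
  (have dF (x : R) (Ux : [set s : R | 0 < s] x) : differentiable (@Num.sqrt R) x;
   [by apply/derivable1_diffP; have := is_derive1_sqrt Ux; case|split=> // v]).
apply: (Ck_ext oU (F := fun s : R => v / 2 * (Num.sqrt s)^-1)).
  move=> x Ux; have [_ E] := is_derive1_sqrt Ux.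
  by rewrite [RHS]derive_scalar ?E ?invfM; [ring|exact: dF].
apply: Ck_scalec => //; apply: Ck_inv => // x x0.
by rewrite gt_eqF// sqrtr_gt0.
Qed.

Lemma Ck_sqrt k V (U : set V) (f : V -> R) : open U ->
  (forall x, U x -> 0 < f x) -> Ck k U f -> Ck k U (fun x => Num.sqrt (f x)).
Proof. by move=> oU f0 kf; apply: (Ck_comp1 oU f0 kf); exact: Ck_sqrtR. Qed.

Lemma Ck_coord k m (U : set 'rV[R]_m) j : Ck k U (fun x : 'rV[R]_m => x 0 j).
Proof.
case: k => [|k]; (have dF (x : 'rV[R]_m) (Ux : U x) :
   differentiable (fun x : 'rV[R]_m => x 0 j) x;
   [exact: differentiable_coord|split=> // v]).
have -> : 'D_v (fun x : 'rV[R]_m => x 0 j) = fun=> v 0 j.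
  apply/funext => x; have := @derive_id _ _ x v => {2}<-.
  by rewrite derive_row//; exact: derivable_id.
exact: Ck_cst.
Qed.

Lemma Ck_id k m (U : set 'rV[R]_m) : open U -> Ck k U (fun x : 'rV[R]_m => x).
Proof. by move=> oU; apply/Ck_rowP => // j; exact: Ck_coord. Qed.

Lemma Ck_scale k V m (U : set V) (f : V -> R) (F : V -> 'rV[R]_m) : open U ->
  Ck k U f -> Ck k U F -> Ck k U (fun x => f x *: F x).
Proof.
move=> oU kf /(Ck_rowP _ _ oU) kF; apply/Ck_rowP => // j.
by under eq_fun do rewrite mxE; exact: Ck_mul.
Qed.

Lemma derive_scale V m (f : V -> R) (F : V -> 'rV[R]_m) x v :
  differentiable f x -> differentiable F x ->
  'D_v (fun y => f y *: F y) x = 'D_v f x *: F x + f x *: 'D_v F x.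
Proof.
move=> df dF; have dfF : differentiable (fun y => f y *: F y) x.
  apply: differentiable_rowP => j; under eq_fun do rewrite mxE.
  by apply: differentiableM => //; exact: differentiable_entry.
apply/rowP => j; rewrite derive_row; last exact: diff_derivable.
under eq_fun do rewrite mxE; rewrite derive_mul//; last exact: differentiable_entry.
by rewrite !mxE derive_row//; exact: diff_derivable.
Qed.

Lemma Ck_dot k V m (U : set V) (F G : V -> 'rV[R]_m) : open U ->
  Ck k U F -> Ck k U G -> Ck k U (fun x => dot (F x) (G x)).
Proof.
move=> oU /(Ck_rowP _ _ oU) kF /(Ck_rowP _ _ oU) kG.
by apply: Ck_sum => // j _; exact: Ck_mul.
Qed.

Lemma derive_dot V m (F G : V -> 'rV[R]_m) x v :
  differentiable F x -> differentiable G x ->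
  'D_v (fun y => dot (F y) (G y)) x = dot ('D_v F x) (G x) + dot (F x) ('D_v G x).
Proof.
move=> dF dG; rewrite /dot derive_bigsum => [|j _]; last first.
  by apply: differentiableM; exact: differentiable_entry.
rewrite -big_split/=; apply: eq_bigr => j _.
rewrite derive_mul; try exact: differentiable_entry.
by rewrite !derive_row//; exact: diff_derivable.
Qed.

(** At the kink the difference quotient is [Num.max 0 h ^+ n.+1], which tends to 0; elsewhere the
    function is locally zero or a power. *)
Lemma is_derive_pos_exp (s : R) (n : nat) : is_derive s 1 (fun s : R => Num.max 0 s ^+ n.+2)
    (n.+2%:R * Num.max 0 s ^+ n.+1).
Proof.
have [s0|s0|->] := ltgtP s 0.
- rewrite expr0n/= mulr0.
  apply: (@near_eq_is_derive _ _ _ (cst (0 : R))).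
  near=> t; rewrite max_l ?expr0n//.
  by apply: ltW; near: t; exact: lt_nbhsl.
- apply: (@near_eq_is_derive _ _ _ (fun t : R => t ^+ n.+2)); last first.
    have := @exp_derive R n.+2 s 1 => h.
    apply: DeriveDef; first exact: exprn_derivable.
    by rewrite h /GRing.scale/= mulr1.
  near=> t; rewrite max_r//.
  by apply: ltW; near: t; exact: lt_nbhsr.
- rewrite ?maxxx expr0n/= mulr0.
  have c : (fun h : R => h^-1 *:
    (Num.max 0 (h *: (1 : R) + 0 : R) ^+ n.+2 - Num.max 0 (0 : R) ^+ n.+2)) @ 0^' --> (0 : R).
    apply: (@cvg_trans _ ((fun h : R => Num.max 0 h ^+ n.+1) @ 0^')).
      apply: near_eq_cvg; near=> h.
      have h0 : h != 0 by near: h; exact: nbhs_dnbhs_neq.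
      rewrite maxxx expr0n/= subr0 addr0 /GRing.scale/= mulr1.
      have [hp|hn] := leP 0 h.
        by rewrite [in RHS]exprS mulKf.
      by rewrite !expr0n mulr0.
    have : (fun h : R => Num.max 0 h ^+ n.+1) @ 0 --> (Num.max 0 (0 : R)) ^+ n.+1.
      apply: (@continuous_comp _ _ _ (fun h : R => Num.max 0 h) (fun t => t ^+ n.+1)).
        by apply: continuous_max; [exact: cst_continuous|exact: cvg_id].
      exact: exprn_continuous.
    rewrite maxxx expr0n/=.
    by move=> h0; apply: cvg_trans h0; apply: cvg_app; exact: cvg_within.
  apply: DeriveDef; first by apply/cvg_ex; exists 0.
  exact: cvg_lim.
Unshelve. all: by end_near. Qed.

(** [Ck 1] asks the first derivative to be differentiable. With exponent 2 that derivative, 2 max(0,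
    s), would still have a kink. *)
Lemma Ck_pos_cube : Ck 1 [set: R] (fun s : R => Num.max 0 s ^+ 3).
Proof.
have d (s : R) n : differentiable (fun s : R => Num.max 0 s ^+ n.+2) s.
  by apply/derivable1_diffP; case: (is_derive_pos_exp s n).
split=> [s _|v]; first exact: d.
apply: (Ck_ext openT (F := fun s : R => v * 3 * Num.max 0 s ^+ 2)) => [s _|].
  have [_ E] := is_derive_pos_exp s 1%N.
  by rewrite [RHS]derive_scalar ?E ?mulrA//; exact: d.
apply: Ck_mul; [exact: openT|exact: Ck_cst|split=> // s _; exact: d].
Qed.

Lemma derive_pos_cube (s : R) : 'D_1 (fun s : R => Num.max 0 s ^+ 3) s = 3 * Num.max 0 s ^+ 2.
Proof. by have [_ E] := is_derive_pos_exp s 1%N. Qed.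

End CkR.

(** * Symmetry of second derivatives *)

Section Schwarz.
Context {R : realType} {V : normedModType R}.

Lemma is_derive_line (g : V -> R) (p u : V) (s : R) :
  differentiable g (p + s *: u) ->
  is_derive s 1 (fun t => g (p + t *: u)) ('D_u g (p + s *: u)).
Proof.
move=> dg; pose l (t : R) := p + t *: u.
have dl : differentiable l s.
  by apply: differentiableD; [exact: differentiable_cst|exact: differentiableZl].
have Dl : 'D_1 l s = u.
  rewrite /l derive_add; [|exact: differentiable_cst|exact: differentiableZl].
  rewrite derive_cst add0r deriveE; last exact: differentiableZl.
  by rewrite diffZl// diff_val scale1r.
apply: DeriveDef; first exact/diff_derivable/(@differentiable_comp _ _ _ _ l g).
by rewrite -[RHS]/('D_u g (l s)) -[u in RHS]Dl -derive_comp.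
Qed.

Lemma line_MVT (g : V -> R) (p u : V) (h : R) : 0 < h ->
  (forall s, 0 <= s <= h -> differentiable g (p + s *: u)) ->
  exists2 s, 0 < s < h & g (p + h *: u) - g p = h * 'D_u g (p + s *: u).
Proof.
move=> h0 dg.
have [||s] := @MVT R (fun t => g (p + t *: u)) (fun t => 'D_u g (p + t *: u)) 0 h h0.
- by move=> s; rewrite in_itv/= => /andP[/ltW s0 /ltW sh]; apply: is_derive_line; apply: dg; rewrite s0.
- apply/continuous_in_subspaceT => s; rewrite inE/= in_itv/= => sI.
  have [+ _] := is_derive_line (dg _ sI).
  by move=> /derivable1_diffP /differentiable_continuous.
by rewrite in_itv/= scale0r addr0 subr0 => sI E; exists s => //; rewrite E mulrC.
Qed.

(** The second difference is the increment along [u] of y |-> g (y + h v) - g y. The mean value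
    theorem along [u], then along [v] for ['D_u g], yields one intermediate point. *)
Lemma double_MVT (g : V -> R) (U : set V) (x u v : V) (r h : R) :
  Ck 1 U g -> ball x r `<=` U -> 0 < h -> h * (`|u| + `|v|) < r ->
  exists2 z, ball x r z &
    g (x + h *: u + h *: v) - g (x + h *: u) - g (x + h *: v) + g x =
    h * (h * 'D_v ('D_u g) z).
Proof.
move=> kg rU h0 hr.
have inb s t : 0 <= s <= h -> 0 <= t <= h -> ball x r (x + s *: u + t *: v).
  move=> /andP[s0 sh] /andP[t0 th]; rewrite -ball_normE /ball_/=.
  rewrite -addrA opprD addrA subrr add0r normrN (le_lt_trans (ler_normD _ _))//.
  rewrite !normrZ !ger0_norm// (le_lt_trans _ hr)// mulrDr.
  by apply: lerD; apply: ler_wpM2r.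
have hh : 0 <= h <= h by rewrite lexx ltW.
have zz : (0 : R) <= 0 <= h by rewrite lexx ltW.
have inb0 s : 0 <= s <= h -> ball x r (x + s *: u).
  by move=> /inb/(_ zz); rewrite scale0r addr0.
pose k y := g (y + h *: v) - g y.
have dshift y : ball x r (y + h *: v) -> differentiable (fun y => g (y + h *: v)) y.
  move=> b; apply: (@differentiable_comp _ _ _ _ (fun y => y + h *: v) g).
    by apply: differentiableD => //; exact: differentiable_cst.
  exact/(Ck_diff kg)/rU.
have dk s : 0 <= s <= h -> differentiable k (x + s *: u).
  move=> sI; apply: differentiableB; first exact/dshift/inb.
  exact/(Ck_diff kg)/rU/inb0.
have [s sI E] := line_MVT h0 dk.
have sI' : 0 <= s <= h by case/andP: sI => /ltW -> /ltW ->.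
have dDu t : 0 <= t <= h -> differentiable ('D_u g) (x + s *: u + t *: v).
  by move=> tI; apply: (Ck_diff (Ck_derive u kg)); exact/rU/inb.
have [t tI E2] := line_MVT h0 dDu.
exists (x + s *: u + t *: v).
  by apply: inb => //; case/andP: tI => /ltW -> /ltW ->.
rewrite -E2 -[LHS]/(g (x + h *: u + h *: v) - g (x + h *: u) - g (x + h *: v) + g x).
have -> : 'D_u g (x + s *: u + h *: v) - 'D_u g (x + s *: u) = 'D_u k (x + s *: u).
  have d1 : differentiable (fun y => g (y + h *: v)) (x + s *: u) by exact/dshift/inb.
  have d2 : differentiable g (x + s *: u) by exact/(Ck_diff kg)/rU/inb0.
  rewrite /k derive_add//; last exact: differentiableN.
  rewrite (derive_opp _ d2); congr (_ - _).
  rewrite [RHS](@derive_comp _ _ _ _ (fun y => y + h *: v) g); last 2 first.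
  - by apply: differentiableD => //; exact: differentiable_cst.
  - exact/(Ck_diff kg)/rU/inb.
  have did : differentiable (fun y : V => y) (x + s *: u) by [].
  by rewrite derive_add// derive_id derive_cst addr0.
by rewrite -E /k opprB addrA [RHS]addrAC.
Qed.

(** Suited to mean value arguments, whose intermediate points for [p] and [q] differ: a gap at [x]
    would persist, by continuity, between any two points of a small ball. *)
Lemma eq_of_close_values (U : set V) (p q : V -> R) (x : V) :
  open U -> U x -> {for x, continuous p} -> {for x, continuous q} ->
  (forall r, 0 < r -> ball x r `<=` U ->
    exists z z', [/\ ball x r z, ball x r z' & p z = q z']) -> p x = q x.
Proof.
move=> oU Ux cp cq H; apply/eqP; rewrite eq_sym; apply/negPn/negP => neq.
have e0 : 0 < `|q x - p x| / 2 by rewrite divr_gt0// normr_gt0 subr_eq0.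
have oUx : \forall z \near x, U z by exact: open_nbhs_nbhs.
have /cvgrPdist_lt/(_ _ e0) np := cp; have /cvgrPdist_lt/(_ _ e0) nq := cq.
have [r /= r0 rP] := (nbhs_ballP _ _).1 (filterI oUx (filterI np nq)).
have [|z [z' [/rP[_ [/= pz _]] /rP[_ [_ /= qz]] E]]] := H r r0.
  by move=> z /rP[].
have : `|q x - p x| < `|q x - p x|.
  rewrite [ltRHS]splitr -[q x in ltLHS](subrK (q z')) -addrA.
  by rewrite (le_lt_trans (ler_normD _ _))// ltrD// distrC -E.
by rewrite ltxx.
Qed.

Theorem derive_sym (g : V -> R) (U : set V) (x u v : V) :
  open U -> Ck 2 U g -> U x -> 'D_u ('D_v g) x = 'D_v ('D_u g) x.
Proof.
move=> oU kg Ux.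
apply: (@eq_of_close_values U ('D_u ('D_v g)) ('D_v ('D_u g)) x oU Ux).
- exact: Ck_continuous (Ck_derive u (Ck_derive v kg)) Ux.
- exact: Ck_continuous (Ck_derive v (Ck_derive u kg)) Ux.
(* The second difference is symmetric in [u] and [v], so [double_MVT] in the two orders gives equal
   values. The summand 1 keeps the denominator positive when both vectors are 0. *)
move=> r r0 rU; pose h := r / (2 * (`|u| + `|v| + 1)).
have d0 : 0 < `|u| + `|v| + 1 by rewrite ltr_wpDl.
have h0 : 0 < h by rewrite divr_gt0// mulr_gt0.
have hr : h * (`|u| + `|v|) < r.
  rewrite /h mulrAC ltr_pdivrMr ?mulr_gt0// ltr_pM2l//.
  have : 0 <= `|u| + `|v| by rewrite addr_ge0.
  by lra.
have hr' : h * (`|v| + `|u|) < r by rewrite addrC.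
have [z zb E1] := double_MVT (Ck_pred kg) rU h0 hr.
have [z' z'b E2] := double_MVT (Ck_pred kg) rU h0 hr'.
exists z', z; split; [exact: z'b|exact: zb|].
have key (a1 a2 A B : R) : a1 = h * (h * A) -> a2 = h * (h * B) -> a1 = a2 -> A = B.
  by move=> -> -> /(mulfI (lt0r_neq0 h0)) /(mulfI (lt0r_neq0 h0)).
have xx : x + h *: u + h *: v = x + h *: v + h *: u by rewrite addrAC.
have e (p q r' s' : R) : p - q - r' + s' = p - r' - q + s' by rewrite (addrAC p).
rewrite xx in E1.
exact: (key _ _ _ _ E2 E1 (e _ _ _ _)).
Qed.

End Schwarz.

(** * Linear algebra of frames *)

Section DotAlgebra.
Context {R : realType} {m : nat}.
Implicit Types u v w : 'rV[R]_m.

Lemma dotE u v : dot u v = (u *m v^T) 0 0.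
Proof. by rewrite mxE; apply: eq_bigr => i _; rewrite mxE. Qed.

Lemma dot_sym u v : dot u v = dot v u.
Proof. by apply: eq_bigr => i _; rewrite mulrC. Qed.

Lemma dotDl u v w : dot (u + v) w = dot u w + dot v w.
Proof. by rewrite !dotE mulmxDl mxE. Qed.

Lemma dotDr u v w : dot w (u + v) = dot w u + dot w v.
Proof. by rewrite ![dot w _]dot_sym dotDl. Qed.

Lemma dotZl a u v : dot (a *: u) v = a * dot u v.
Proof. by rewrite !dotE -scalemxAl mxE. Qed.

Lemma dotZr a u v : dot u (a *: v) = a * dot u v.
Proof. by rewrite ![dot u _]dot_sym dotZl. Qed.

Lemma dotNl u v : dot (- u) v = - dot u v.
Proof. by rewrite -scaleN1r dotZl mulN1r. Qed.

Lemma dotNr u v : dot u (- v) = - dot u v.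
Proof. by rewrite dot_sym dotNl dot_sym. Qed.

Lemma dotBl u v w : dot (u - v) w = dot u w - dot v w.
Proof. by rewrite dotDl dotNl. Qed.

Lemma dotBr u v w : dot w (u - v) = dot w u - dot w v.
Proof. by rewrite dotDr dotNr. Qed.

Lemma dot0l u : dot 0 u = 0.
Proof. by rewrite -(scale0r 0) dotZl mul0r. Qed.

Lemma dot_suml (I : Type) (s : seq I) (f : I -> 'rV[R]_m) v :
  dot (\sum_(i <- s) f i) v = \sum_(i <- s) dot (f i) v.
Proof.
elim: s => [|i s IH]; first by rewrite !big_nil dot0l.
by rewrite !big_cons dotDl IH.
Qed.

Lemma dot_sumr (I : Type) (s : seq I) (f : I -> 'rV[R]_m) v :
  dot v (\sum_(i <- s) f i) = \sum_(i <- s) dot v (f i).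
Proof. by rewrite dot_sym dot_suml; apply: eq_bigr => i _; rewrite dot_sym. Qed.

Lemma dot_ge0 u : 0 <= dot u u.
Proof. by apply: sumr_ge0 => i _; rewrite -expr2 sqr_ge0. Qed.

Lemma dot_eq0 u : (dot u u == 0) = (u == 0).
Proof.
apply/eqP/eqP => [|->]; last exact: dot0l.
move=> /eqP; rewrite psumr_eq0 => [/allP H|i _]; last by rewrite -expr2 sqr_ge0.
apply/rowP => i; rewrite mxE; have := H i; rewrite mem_index_enum => /(_ isT).
by rewrite /= mulf_eq0 orbb => /eqP.
Qed.

Lemma entry_le_of_dot u i c : 0 <= c -> dot u u <= c ^+ 2 -> `|u 0 i| <= c.
Proof.
move=> c0 uc; have : u 0 i ^+ 2 <= c ^+ 2.
  rewrite (le_trans _ uc)// /dot (bigD1 i)//= expr2 lerDl.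
  by apply: sumr_ge0 => j _; rewrite -expr2 sqr_ge0.
by move=> h; rewrite -sqrtr_sqr -[leRHS](ger0_norm c0) -[leRHS]sqrtr_sqr ler_wsqrtr.
Qed.

End DotAlgebra.

Section Frame.
Context {R : realType} {n : nat}.

(** The rows of [A] are the frame, those of [A'] its dual, and orthogonality reads [A' *m A^T = 1].
    For square matrices a one-sided inverse is two-sided, and [a = a *m A^T *m A'] is the
    expansion. *)
Lemma frame_expansion (nu : 'rV[R]_n.+1) (e : 'I_n -> 'rV[R]_n.+1) (r : R) a :
  r != 0 -> dot nu nu = 1 -> (forall i, dot nu (e i) = 0) ->
  (forall i j, dot (e i) (e j) = (i == j)%:R * r) ->
  a = dot a nu *: nu + \sum_l (r^-1 * dot a (e l)) *: e l.
Proof.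
move=> r0 nn ne ee.
pose A : 'M[R]_n.+1 := \matrix_(i < n.+1) (if unlift ord0 i is Some j then e j else nu).
pose A' : 'M[R]_n.+1 := \matrix_(i < n.+1)
  (if unlift ord0 i is Some j then r^-1 *: e j else nu).
have A0 : row ord0 A = nu by apply/rowP => k; rewrite !mxE unlift_none.
have Ai i : row (lift ord0 i) A = e i by apply/rowP => k; rewrite !mxE liftK.
have A'0 : row ord0 A' = nu by apply/rowP => k; rewrite !mxE unlift_none.
have A'i i : row (lift ord0 i) A' = r^-1 *: e i by apply/rowP => k; rewrite !mxE liftK !mxE.
have dotrow (M N : 'M[R]_n.+1) i j : (M *m N^T) i j = dot (row i M) (row j N).
  by rewrite mxE; apply: eq_bigr => k _; rewrite !mxE.
have AA : A' *m A^T = 1%:M.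
  apply/matrixP => i j; rewrite dotrow mxE.
  case: (unliftP ord0 i) => [i' ->|->]; case: (unliftP ord0 j) => [j' ->|->].
  - by rewrite A'i Ai dotZl ee (inj_eq lift_inj) mulrCA mulVf ?mulr1.
  - by rewrite A'i A0 dotZl dot_sym ne mulr0.
  - by rewrite A'0 Ai ne.
  - by rewrite A'0 A0 nn eqxx.
have := mulmx1C AA => AA'.
have {1}-> : a = (a *m A^T) *m A' by rewrite -mulmxA AA' mulmx1.
have aA k : (a *m A^T) 0 k = dot a (row k A).
  by rewrite mxE; apply: eq_bigr => l _; rewrite !mxE.
rewrite mulmx_sum_row big_ord_recl aA A0 A'0; congr (_ + _).
by apply: eq_bigr => l _; rewrite aA Ai A'i scalerA mulrC.
Qed.

Lemma frame_dot (nu : 'rV[R]_n.+1) (e : 'I_n -> 'rV[R]_n.+1) (r : R) a b :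
  r != 0 -> dot nu nu = 1 -> (forall i, dot nu (e i) = 0) ->
  (forall i j, dot (e i) (e j) = (i == j)%:R * r) ->
  dot a b = dot a nu * dot nu b + \sum_l r^-1 * dot a (e l) * dot (e l) b.
Proof.
move=> r0 nn ne ee; rewrite {1}(frame_expansion a r0 nn ne ee) dotDl dotZl dot_suml.
by congr (_ + _); apply: eq_bigr => l _; rewrite dotZl.
Qed.

End Frame.

Lemma derive_sym_row (R : realType) (V : normedModType R) p (F : V -> 'rV[R]_p)
    (U : set V) (x u v : V) :
  open U -> Ck 2 U F -> U x -> 'D_u ('D_v F) x = 'D_v ('D_u F) x.
Proof.
move=> oU kF Ux; apply/rowP => j.
have kFj : Ck 2 U (fun y => F y 0 j) by move: j; apply/Ck_rowP.
have E w w' : 'D_w ('D_w' F) x 0 j = 'D_w ('D_w' (fun y => F y 0 j)) x.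
  rewrite derive_row; last exact: (Ck_derivable (Ck_derive w' kF) Ux).
  apply: (derive_ext _ oU Ux) => y Uy.
  by rewrite derive_row//; exact: (Ck_derivable kF Uy).
exact: etrans (E u v) (etrans (derive_sym u v oU kFj Ux) (esym (E v u))).
Qed.

(** * The divergence identity *)

(* Values at one point of the quantities of the chart: [dB k i j] is d_k B_ij,
   [Cc i j k] is <nu, d_i d_j d_k F>, [P] is rho^(n-2), [dx i j] is d_i x_j.  The
   symmetry of [Cc], together with [dBE], is Codazzi's equation. *)
Section DivergenceAlgebra.
Variables (R : realFieldType) (n : nat).
Variables (B : 'I_n -> 'I_n -> R) (dB Cc : 'I_n -> 'I_n -> 'I_n -> R).
Variables (dr dh x dP : 'I_n -> R) (dx : 'I_n -> 'I_n -> R) (r h t P : R).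

Lemma sum_kronecker (f : 'I_n -> R) j : \sum_i (i == j)%:R * f i = f j.
Proof.
rewrite (bigD1 j)//= eqxx mul1r big1 ?addr0// => i ij.
by rewrite (negbTE ij) mul0r.
Qed.

(** The summand has the shape of a Christoffel symbol of a conformal metric contracted with the
    vector [c]; [d] stands for the gradient of the conformal factor. *)
Lemma sum_kronecker2 (c d : 'I_n -> R) i j (a p q w : R) :
  \sum_l a * ((l == j)%:R * (p * c l) + (l == i)%:R * (q * c l) - w * (c l * d l)) =
  a * (p * c j + q * c i - w * \sum_l c l * d l).
Proof. by rewrite -mulr_sumr sumrB big_split/= !sum_kronecker -mulr_sumr. Qed.

Lemma sum_cst_ord (c : R) : \sum_(i < n) c = n%:R * c.
Proof. by rewrite sumr_const card_ord mulr_natl. Qed.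

Hypotheses (r0 : r != 0) (Bsym : forall i j, B i j = B j i)
  (Csym12 : forall i j k, Cc i j k = Cc j i k)
  (Csym23 : forall i j k, Cc i j k = Cc i k j)
  (dBE : forall k i j, dB k i j = Cc k i j - (2 * r)^-1 *
     (dr i * B k j + dr j * B k i - (i == j)%:R * \sum_l B k l * dr l))
  (trB : \sum_i B i i = n%:R * h * r)
  (dtrB : forall j, \sum_i dB j i i = n%:R * (dh j * r + h * dr j))
  (dxE : forall i j, dx i j + dx j i = (i == j)%:R * t)
  (dPE : forall i, dP i = (n%:R - 2) * P * dr i / (2 * r)).

Let S j := \sum_l B j l * dr l.

(** Contracted Codazzi equation: by the symmetries of [Cc], the divergence of [B] and the derivative
    of its trace contain the same sum of third derivatives, which is eliminated between [dBE] and
    [dtrB]. *)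
Lemma divB j : \sum_i dB i i j =
  n%:R * (dh j * r + h * dr j) + (2 * r)^-1 * (2 - n%:R) * S j - n%:R * h * dr j / 2.
Proof.
have -> : n%:R * (dh j * r + h * dr j) = \sum_i Cc i i j - (2 * r)^-1 * (2 - n%:R) * S j.
  rewrite -dtrB; under eq_bigr do rewrite dBE eqxx mul1r.
  rewrite sumrB -mulr_sumr sumrB big_split/= sum_cst_ord -/(S j).
  under [in LHS]eq_bigr do rewrite Csym12 Csym23.
  have -> : \sum_i dr i * B j i = S j by apply: eq_bigr => i _; rewrite mulrC.
  by congr (_ - _); rewrite -mulrA; congr (_ * _); ring.
under eq_bigr do rewrite dBE.
rewrite sumrB -mulr_sumr sumrB big_split/= sum_kronecker -/(S j) -mulr_sumr trB.
have -> : \sum_i dr i * B i j = S j by apply: eq_bigr => i _; rewrite mulrC Bsym.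
by field.
Qed.

Lemma sum_diag_dx : \sum_i dx i i = n%:R * t / 2.
Proof.
have : \sum_i (dx i i + dx i i) = n%:R * t.
  by under eq_bigr do rewrite dxE eqxx mul1r; rewrite sum_cst_ord.
by rewrite big_split/= => <-; field.
Qed.

(** [B] is symmetric, so it only sees the symmetric part of [dx], which is t/2 times the
    identity. *)
Lemma sum_B_dx : \sum_i \sum_j B i j * dx i j = n%:R * h * r * t / 2.
Proof.
set Y := LHS; have Y2 : Y = \sum_i \sum_j B i j * dx j i.
  rewrite /Y exchange_big/=; apply: eq_bigr => i _; apply: eq_bigr => j _.
  by rewrite Bsym.
have : Y + Y = n%:R * h * r * t.
  rewrite {2}Y2 -trB mulr_suml -big_split/=; apply: eq_bigr => i _.
  rewrite -big_split/=; under eq_bigr do rewrite -mulrDr dxE mulrCA eq_sym.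
  by rewrite sum_kronecker.
by move=> <-; field.
Qed.

(** The exponent n - 2 behind [dPE] makes the terms in [SX] cancel, and likewise those in [Q]. The
    terms in [t] cancel because B - h r I has trace 0. Only [Z] survives. *)
Theorem divergence_identity :
  \sum_i (dP i * (\sum_j B i j * x j - h * r * x i) +
    P * (\sum_j (dB i i j * x j + B i j * dx i j) -
         ((dh i * r + h * dr i) * x i + h * r * dx i i))) =
  (n%:R - 1) * (P * r) * \sum_i x i * dh i.
Proof.
set Q := \sum_i dr i * x i; set Z := \sum_i x i * dh i.
set SX := \sum_j S j * x j.
rewrite big_split/= -mulr_sumr.
have -> : \sum_i dP i * (\sum_j B i j * x j - h * r * x i) =
    (n%:R - 2) * P / (2 * r) * (SX - h * r * Q).
  under eq_bigr do rewrite dPE.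
  have -> : SX = \sum_i dr i * \sum_j B i j * x j.
    rewrite /SX; under [RHS]eq_bigr do rewrite mulr_sumr.
    rewrite exchange_big/=; apply: eq_bigr => j _; rewrite mulr_suml.
    by apply: eq_bigr => i _; rewrite Bsym; ring.
  rewrite /Q mulr_sumr -sumrB mulr_sumr; apply: eq_bigr => i _; ring.
have -> : \sum_i (\sum_j (dB i i j * x j + B i j * dx i j) -
       ((dh i * r + h * dr i) * x i + h * r * dx i i)) =
  \sum_j x j * (\sum_i dB i i j) + \sum_i \sum_j B i j * dx i j -
  (r * Z + h * Q + h * r * \sum_i dx i i).
  rewrite sumrB; congr (_ - _).
    under eq_bigr do rewrite big_split/=.
    rewrite big_split/=; congr (_ + _); rewrite exchange_big/=.
    by apply: eq_bigr => j _; rewrite mulr_sumr; apply: eq_bigr => i _; rewrite mulrC.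
  rewrite /Z /Q !mulr_sumr -!big_split/=; apply: eq_bigr => i _; ring.
have -> : \sum_j x j * (\sum_i dB i i j) =
    n%:R * r * Z + n%:R * h * Q / 2 + (2 * r)^-1 * (2 - n%:R) * SX.
  under eq_bigr do rewrite divB.
  rewrite /Z /Q /SX !mulr_sumr mulr_suml -!big_split/=; apply: eq_bigr => j _; field.
  done.
rewrite sum_B_dx sum_diag_dx; field; exact: r0.
Qed.

End DivergenceAlgebra.

(** * Integration over R^m *)

Section Boxes.
Context {R : realType}.
Notation RT := (measurableTypeR R).
Notation leb := (@lebesgue_measure R).

Definition box m (c : 'rV[R]_m) (r : R) : set (m.-tuple RT) :=
  [set t | forall i, `|tnth t i - c 0 i| <= r].

Definition seg (a r : R) : set RT := [set s : R | `|s - a| <= r].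

Lemma segE (a r : R) : seg a r = `[a - r, a + r]%classic.
Proof.
by apply/seteqP; split=> s; rewrite /seg/= in_itv/= ler_distl.
Qed.

Lemma measurable_seg (a r : R) : measurable (seg a r).
Proof. by rewrite segE; exact: measurable_itv. Qed.

Lemma lebesgue_seg (a r : R) : 0 <= r -> leb (seg a r) = (2 * r)%:E.
Proof.
move=> r0; rewrite segE lebesgue_measure_itv/= lte_fin.
case: ifPn => [_|]; first by rewrite -EFinB; congr EFin; lra.
rewrite -leNgt => h; have -> : r = 0 by lra.
by rewrite mulr0.
Qed.

Definition tl m (c : 'rV[R]_m.+1) : 'rV[R]_m := \row_j c 0 (lift ord0 j).

Lemma box_cons m (c : 'rV[R]_m.+1) (r : R) :
  @cons_pair R m @^-1` box c r = seg (c 0 0) r `*` box (tl c) r.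
Proof.
apply/seteqP; split=> -[s t] /=.
  move=> H; split=> [|i]; first by have := H ord0; rewrite tnth0.
  by have := H (lift ord0 i); rewrite tnthS mxE.
move=> [Hs Ht] i; case: (unliftP ord0 i) => [j ->|->].
  by have := Ht j; rewrite tnthS mxE.
by rewrite tnth0.
Qed.

Lemma measurable_box m (c : 'rV[R]_m) (r : R) : measurable (box c r).
Proof.
have -> : box c r = \bigcap_(i in [set: 'I_m]) ((fun t : m.-tuple RT => tnth t i) @^-1` seg (c 0 i) r).
  by apply/seteqP; split=> t /= H i; [move=> _; exact: (H i)|exact: (H i I)].
apply: fin_bigcap_measurable => // i _; rewrite -[X in measurable X]setTI.
by apply: measurable_tnth => //; exact: measurable_seg.
Qed.

Lemma lebesgue_box m (c : 'rV[R]_m) (r : R) : 0 <= r ->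
  lebesgue_tuple m (box c r) = ((2 * r) ^+ m)%:E.
Proof.
move=> r0; elim: m c => [|m IH] c.
  by rewrite /= diracE mem_set// => -[].
rewrite /= /lebesgue_cons /pushforward box_cons product_measure1E.
- rewrite exprS EFinM; congr (_ * _)%E; [exact: lebesgue_seg|exact: IH].
- exact: measurable_seg.
- exact: measurable_box.
Qed.

Definition bounded_on (T : Type) (D : set T) (h : T -> R) :=
  exists M, forall t, D t -> `|h t| <= M.

Lemma box_integrable m (c : 'rV[R]_m) (r : R) (h : m.-tuple RT -> R) :
  0 <= r -> measurable_fun setT h -> bounded_on (box c r) h ->
  (lebesgue_tuple m).-integrable (box c r) (EFin \o h).
Proof.
move=> r0 mh [M hM]; apply: measurable_bounded_integrable.
- exact: measurable_box.
- by rewrite [ltLHS]lebesgue_box// ltry.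
- exact: measurable_funTS.
- by exists M; split; [exact: num_real|move=> x Mx t Bt; exact: le_trans (hM _ Bt) (ltW Mx)].
Qed.

Lemma le_Rint_box m (c : 'rV[R]_m) (r M : R) (h : m.-tuple RT -> R) :
  0 <= r -> measurable_fun setT h -> (forall t, box c r t -> `|h t| <= M) ->
  `|\int[lebesgue_tuple m]_(t in box c r) h t| <= M * (2 * r) ^+ m.
Proof.
move=> r0 mh hM; have mb := measurable_box c r.
have ih : (lebesgue_tuple m).-integrable (box c r) (EFin \o h).
  by apply: box_integrable => //; exists M.
apply: le_trans (le_normr_Rintegral mb ih) _.
have -> : M * (2 * r) ^+ m = \int[lebesgue_tuple m]_(t in box c r) M.
  by rewrite Rintegral_cst// [X in fine X]lebesgue_box.
apply: le_Rintegral => //.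
  apply: box_integrable => //; first exact: measurableT_comp.
  by exists M => t /hM; rewrite normr_id.
apply: box_integrable => //.
by exists `|M|.
Qed.

Section step.
Variables (m : nat) (c : 'rV[R]_m.+1) (r : R) (h : m.+1.-tuple RT -> R).
Hypotheses (r0 : 0 <= r) (mh : measurable_fun setT h)
  (bh : bounded_on (box c r) h).

(** Extension by 0 to the whole product space, where Fubini's theorem is applied in either order. *)
Let f : RT * m.-tuple RT -> \bar R :=
  (EFin \o h \o @cons_pair R m) \_ (seg (c 0 0) r `*` box (tl c) r).

Let mf : measurable_fun setT f.
Proof.
apply/(measurable_restrictT _ _).1.
  by apply: measurableX; [exact: measurable_seg|exact: measurable_box].
apply: measurable_funTS; apply: measurableT_comp; last exact: measurable_cons_pair.
exact/measurable_EFinP.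
Qed.

Let ihc : (leb \x lebesgue_tuple m)%E.-integrable
  (seg (c 0 0) r `*` box (tl c) r) (EFin \o h \o @cons_pair R m).
Proof.
have [M hM] := bh; rewrite -compA; apply: measurable_bounded_integrable.
- by apply: measurableX; [exact: measurable_seg|exact: measurable_box].
- have := lebesgue_box c r0; rewrite /= /lebesgue_cons /pushforward box_cons => ->.
  by rewrite ltry.
- by apply: measurable_funTS; apply: measurableT_comp => //; exact: measurable_cons_pair.
- exists M; split; first exact: num_real.
  move=> x Mx p; rewrite -box_cons => Bp /=; exact: le_trans (hM _ Bp) (ltW Mx).
Qed.

Let jf : (leb \x lebesgue_tuple m)%E.-integrable setT f.
Proof.
apply/integrable_restrict => //.
  by apply: measurableX; [exact: measurable_seg|exact: measurable_box].
by rewrite setTI.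
Qed.

Let push : (\int[lebesgue_tuple m.+1]_(t in box c r) (h t)%:E =
  \int[(leb \x lebesgue_tuple m)%E]_p f p)%E.
Proof.
rewrite [LHS](@integral_pushforward _ _ _ _ _ (@cons_pair R m)
  (@measurable_cons_pair R m) (leb \x lebesgue_tuple m)%E (box c r) (EFin \o h)).
- by rewrite box_cons integral_mkcond.
- exact/measurable_EFinP.
- by rewrite box_cons; exact: ihc.
- exact: measurable_box.
Qed.

Let innerE s : (\int[lebesgue_tuple m]_t f (s, t))%E =
  ((fun s => (\int[lebesgue_tuple m]_(t in box (tl c) r) h (cons_pair (s, t)))%:E)
    \_ (seg (c 0 0) r)) s.
Proof.
rewrite /patch; case: ifPn => [|/negP] Is; last first.
  rewrite integral0_eq// => t _; rewrite /f patchE memNset// => -[/= + _].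
  by move=> /mem_set.
rewrite /Rintegral fineK; last first.
  apply: integrable_fin_num; first exact: measurable_box.
  apply: box_integrable => //.
    apply: measurableT_comp => //; apply: measurableT_comp; first exact: measurable_cons_pair.
    exact: measurable_pair1.
  have [M hM] := bh; exists M => t Bt; apply: hM.
  suff : (cons_pair (R := R) (m:=m) @^-1` box c r) (s, t) by [].
  by rewrite box_cons; split=> //=; rewrite inE in Is.
rewrite [RHS]integral_mkcond; apply: eq_integral => t _.
rewrite /f !patchE; congr (if _ then _ else _).
by apply/idP/idP => /set_mem H; apply/mem_set; [case: H|split=> //=; exact: set_mem Is].
Qed.

(** First coordinate outermost: the order for a derivative along another coordinate, which is
    treated slice by slice. *)
Lemma Rint_box12 : \int[lebesgue_tuple m.+1]_(t in box c r) h t =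
  \int[leb]_(s in seg (c 0 0) r)
    \int[lebesgue_tuple m]_(t in box (tl c) r) h (cons_pair (s, t)).
Proof.
rewrite {1}/Rintegral push -(integral12_prod_meas1 jf) [in RHS]/Rintegral.
congr fine; rewrite [RHS]integral_mkcond; apply: eq_integral => s _.
exact: innerE.
Qed.

Lemma integrable_box_inner : leb.-integrable (seg (c 0 0) r)
  (EFin \o fun s => \int[lebesgue_tuple m]_(t in box (tl c) r) h (cons_pair (s, t))).
Proof.
apply/(integrable_mkcond _ (measurable_seg _ _)).
apply: eq_integrable (integrable_fubini_F jf) => // s _.
exact: innerE.
Qed.

(** First coordinate innermost: the order for a derivative along it, so that the fundamental theorem
    of calculus applies to the inner integral. *)
Lemma Rint_box21 : \int[lebesgue_tuple m.+1]_(t in box c r) h t =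
  \int[lebesgue_tuple m]_(t in box (tl c) r)
    \int[leb]_(s in seg (c 0 0) r) h (cons_pair (s, t)).
Proof.
rewrite {1}/Rintegral push -(integral21_prod_meas1 jf) [in RHS]/Rintegral.
congr fine; rewrite [RHS]integral_mkcond; apply: eq_integral => t _.
rewrite /fubini_G/= /patch; case: ifPn => [|/negP] Bt; last first.
  rewrite integral0_eq// => s _; rewrite /f patchE memNset// => -[/= _].
  by move=> /mem_set.
rewrite /Rintegral fineK; last first.
  apply: integrable_fin_num; first exact: measurable_seg.
  apply: measurable_bounded_integrable.
  - exact: measurable_seg.
  - by rewrite [ltLHS]lebesgue_seg// ltry.
  - apply: measurable_funTS; apply: measurableT_comp => //.
    apply: measurableT_comp; first exact: measurable_cons_pair.
    exact: measurable_pair2.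
  have [M hM] := bh; exists M; split; first exact: num_real.
  move=> x Mx s Is /=; apply: le_trans (ltW Mx); apply: hM.
  suff : (cons_pair (R := R) (m:=m) @^-1` box c r) (s, t) by [].
  by rewrite box_cons; split=> //=; rewrite inE in Bt.
rewrite [RHS]integral_mkcond; apply: eq_integral => s _.
rewrite /f !patchE; congr (if _ then _ else _).
by apply/idP/idP => /set_mem H; apply/mem_set; [case: H|split=> //=; exact: set_mem Bt].
Qed.

End step.
End Boxes.

(** * The divergence theorem on a cube, as an estimate *)

Section BoxDivergence.
Context {R : realType}.
Notation RT := (measurableTypeR R).
Notation leb := (@lebesgue_measure R).

(* An open set is a countable union of boxes with rational centres. *)
Lemma measurable_preimage_open m (O : set 'rV[R]_m) :
  open O -> measurable (@row_of_tuple R m @^-1` O).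
Proof.
move=> oO; pose c (p : m.-tuple rat) : 'rV[R]_m := \row_i ratr (tnth p i).
pose G (p : m.-tuple rat * nat) : set (m.-tuple RT) :=
  if `[< box (c p.1) p.2.+1%:R^-1 `<=` @row_of_tuple R m @^-1` O >]
  then box (c p.1) p.2.+1%:R^-1 else set0.
have -> : @row_of_tuple R m @^-1` O = \bigcup_p G p.
  apply/seteqP; split=> [t Ot|t [p _]]; last first.
    by rewrite /G; case: ifPn => [/asboolP|] // H /H.
  have := open_nbhs_nbhs (conj oO Ot) => /nbhs_ballP[e /= e0 eO].
  (* A rational centre is taken within 1/(k+1) of [t], and its box has that same radius; the two
     lengths together must stay below [e]. *)
  have [k kP] : exists k : nat, k.+1%:R^-1 < e / 2.
    have e2 : 0 < e / 2 by rewrite divr_gt0.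
    exists (Num.truncn (e / 2)^-1); rewrite invf_plt ?posrE// ?ltr0n//.
    exact: truncnS_gt.
  have k0 : 0 < k.+1%:R^-1 :> R by rewrite invr_gt0.
  have qP i : exists q : rat, `|tnth t i - ratr q| < k.+1%:R^-1.
    have lt1 : tnth t i - k.+1%:R^-1 < tnth t i + k.+1%:R^-1 :> R.
      by rewrite ltrD2l (lt_trans _ k0)// oppr_lt0.
    have [q] := rat_in_itvoo lt1.
    by rewrite in_itv/= => H; exists q; rewrite distrC ltr_distl.
  pose q := [tuple sval (cid (qP i)) | i < m].
  have Hq i : `|tnth t i - ratr (tnth q i)| < k.+1%:R^-1.
    by rewrite tnth_mktuple; case: cid.
  have sub : box (c q) k.+1%:R^-1 `<=` @row_of_tuple R m @^-1` O.
    move=> u Bu /=; apply: eO; split=> // i j; rewrite !mxE /ball/=.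
    have := Bu j; rewrite mxE => Bj; have := Hq j => Hj.
    rewrite -(subrKA (ratr (tnth q j))) (le_lt_trans (ler_normD _ _))//.
    by rewrite [ltRHS]splitr; apply: ltrD; [exact: lt_trans Hj _|rewrite distrC; exact: le_lt_trans Bj _].
  exists (q, k) => //; rewrite /G/= asboolT// => i.
  by rewrite mxE ltW.
apply: countable_bigcupT_measurable => [|p]; first exact: countableP.
by rewrite /G; case: ifP => _; [exact: measurable_box|exact: measurable0].
Qed.

(** Links the product sigma-algebra of tuples, where integrals live, to the topology of rows, where
    continuity and derivatives live. *)
Lemma measurable_row m (K : 'rV[R]_m -> R) : continuous K ->
  measurable_fun setT (K \o @row_of_tuple R m).
Proof.
move=> cK; apply: (measurability _ (RGenOpens.measurableE R)).
move=> _ [_ [a [b ->] <-]]; rewrite setTI comp_preimage.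
apply: measurable_preimage_open; apply: open_comp => [x _|]; first exact: cK.
exact: interval_open.
Qed.

Lemma compact_cbox m (c : 'rV[R]_m) (r : R) :
  compact [set v : 'rV[R]_m | forall i, `|v 0 i - c 0 i| <= r].
Proof.
have := @rV_compact R m (fun i => seg (c 0 i) r); apply => i.
by rewrite segE; exact: segment_compact.
Qed.

Lemma bounded_box m (c : 'rV[R]_m) (r : R) (K : 'rV[R]_m -> R) : continuous K ->
  bounded_on (box c r) (K \o @row_of_tuple R m).
Proof.
move=> cK; have := @compact_cbox m c r.
move=> /(continuous_compact (continuous_subspaceT cK)) /compact_bounded[M [_ HM]].
exists (M + 1) => t Bt; apply: HM; first by rewrite ltrDl.
by exists (row_of_tuple t) => // i; rewrite mxE; exact: Bt.
Qed.

(** [cons_pair] transported to row vectors, where slices can be differentiated. *)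
Definition cns m (s : R) (y : 'rV[R]_m) : 'rV[R]_m.+1 :=
  \row_j (if unlift ord0 j is Some k then y 0 k else s).

Lemma cns0 m s (y : 'rV[R]_m) : cns s y 0 ord0 = s.
Proof. by rewrite mxE unlift_none. Qed.

Lemma cnsS m s (y : 'rV[R]_m) j : cns s y 0 (lift ord0 j) = y 0 j.
Proof. by rewrite mxE liftK. Qed.

Lemma row_of_cons m (s : R) (t : m.-tuple RT) :
  row_of_tuple (cons_pair (s, t)) = cns s (row_of_tuple t).
Proof.
apply/rowP => j; rewrite !mxE; case: (unliftP ord0 j) => [k ->|->].
  by rewrite tnthS mxE.
by rewrite tnth0.
Qed.

Lemma cns_line m (y : 'rV[R]_m) s : cns s y = cns 0 y + s *: delta_mx 0 ord0.
Proof.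
apply/rowP => j; rewrite 4!mxE; case: (unliftP ord0 j) => [k ->|->].
  by rewrite mxE/= mulr0 addr0.
by rewrite mxE/= mulr1 add0r.
Qed.

Lemma differentiable_cns m s (y : 'rV[R]_m) : differentiable (cns s) y.
Proof.
apply: differentiable_rowP => j; case: (unliftP ord0 j) => [k ->|->].
  by under eq_fun do rewrite cnsS; exact: differentiable_coord.
by under eq_fun do rewrite cns0; exact: differentiable_cst.
Qed.

(** Since [cns s] is affine, the two difference quotients are equal before any limit is taken. *)
Lemma derive_cns m s (g : 'rV[R]_m.+1 -> R) j (y : 'rV[R]_m) :
  'D_(delta_mx 0 j) (g \o cns s) y = 'D_(delta_mx 0 (lift ord0 j)) g (cns s y).
Proof.
suff E : (fun h : R => h^-1 *: (((g \o cns s) \o shift y) (h *: delta_mx 0 j) - (g \o cns s) y)) =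
  (fun h => h^-1 *: ((g \o shift (cns s y)) (h *: delta_mx 0 (lift ord0 j)) - g (cns s y))).
  by rewrite /derive E.
apply/funext => h /=.
suff -> : cns s (h *: delta_mx 0 j + y) = h *: delta_mx 0 (lift ord0 j) + cns s y by [].
apply/rowP => i; rewrite [RHS]mxE [in RHS]mxE; case: (unliftP ord0 i) => [k ->|->].
  by rewrite !cnsS !mxE/= (inj_eq lift_inj).
by rewrite !cns0 !mxE/= mulr0 add0r.
Qed.

Lemma FTC_cns m (g : 'rV[R]_m.+1 -> R) (a r : R) (y : 'rV[R]_m) : 0 < r ->
  (forall x, differentiable g x) -> continuous ('D_(delta_mx 0 ord0) g) ->
  \int[leb]_(s in seg a r) 'D_(delta_mx 0 ord0) g (cns s y) =
    g (cns (a + r) y) - g (cns (a - r) y).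
Proof.
move=> r0 dg cg.
have dline (s : R) : is_derive s 1 (fun s : R => g (cns s y)) ('D_(delta_mx 0 ord0) g (cns s y)).
  have E : (fun s => g (cns s y)) = fun s => g (cns 0 y + s *: delta_mx 0 ord0).
    by apply/funext => u; rewrite cns_line.
  by rewrite E [cns s y]cns_line; exact/is_derive_line/dg.
have dd (s : R) : differentiable (fun s : R => g (cns s y)) s.
  by apply/derivable1_diffP; case: (dline s).
have dc (s : R) : {for s, continuous (fun s : R => cns s y)}.
  apply: differentiable_continuous; apply: differentiable_rowP => j.
  case: (unliftP ord0 j) => [k ->|->].
    by under eq_fun do rewrite cnsS; exact: differentiable_cst.
  by under eq_fun do rewrite cns0.
have cD : continuous (fun s : R => 'D_(delta_mx 0 ord0) g (cns s y)).
  by move=> s; exact: (@continuous_comp _ _ _ (fun s : R => cns s y) ('D_(delta_mx 0 ord0) g) s (dc s) (cg _)).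
rewrite segE /Rintegral (@continuous_FTC2 _ _ (fun s => g (cns s y))) //.
- lra.
- exact: continuous_subspaceT.
- split=> [s _| |].
  + by case: (dline s).
  + by apply: cvg_at_right_filter; exact/differentiable_continuous.
  + by apply: cvg_at_left_filter; exact/differentiable_continuous.
- by move=> s _; rewrite derive1E; case: (dline s).
Qed.

(** Induction on the dimension. Along a coordinate other than the first, the slices with first
    coordinate fixed are bounded by induction; along the first, the inner integral is a difference
    of values on two opposite faces. The bound is 2 faces times [B] times the measure (2r)^(m-1) of
    a face. *)
Theorem box_divergence m (c : 'rV[R]_m) (r B : R) (g : 'rV[R]_m -> R) i : 0 < r ->
  (forall x, differentiable g x) -> continuous ('D_(delta_mx 0 i) g) ->
  (forall y : 'rV[R]_m, (forall j, `|y 0 j - c 0 j| <= r) -> `|y 0 i - c 0 i| = r -> `|g y| <= B) ->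
  `|\int[lebesgue_tuple m]_(t in box c r) 'D_(delta_mx 0 i) g (row_of_tuple t)|
    <= 2 * B * (2 * r) ^+ m.-1.
Proof.
move=> r0; elim: m c g i => [c g []//|m IH] c g i dg cg gB.
have mg := measurable_row cg; have bg := bounded_box c r cg.
have tlE j : tl c 0 j = c 0 (lift ord0 j) by rewrite mxE.
case: (unliftP ord0 i) => [j ij|i0].
  rewrite ij in cg gB mg bg *; rewrite (Rint_box12 (ltW r0) mg bg).
  have H s : seg (c 0 0) r s ->
    `|\int[lebesgue_tuple m]_(t in box (tl c) r)
      'D_(delta_mx 0 (lift ord0 j)) g (row_of_tuple (cons_pair (s, t)))| <=
    2 * B * (2 * r) ^+ m.-1.
    move=> Is; under eq_Rintegral do rewrite row_of_cons -derive_cns.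
    apply: IH.
    - move=> x; apply: differentiable_comp; first exact: differentiable_cns.
      exact: dg.
    - have -> : 'D_(delta_mx 0 j) (g \o cns s) = 'D_(delta_mx 0 (lift ord0 j)) g \o cns s.
        by apply/funext => y; exact: derive_cns.
      move=> y; apply: continuous_comp; last exact: cg.
      exact/differentiable_continuous/differentiable_cns.
    - move=> y yB yj; apply: gB => [k|]; last by rewrite cnsS -tlE.
      case: (unliftP ord0 k) => [k' ->|->]; first by rewrite cnsS -tlE.
      by rewrite cns0.
  have ii := integrable_box_inner (ltW r0) mg bg.
  apply: le_trans (le_normr_Rintegral (measurable_seg _ _) ii) _.
  (* The index [j] of a coordinate of the slice forces the slice to have positive dimension, which
     makes [m.-1] a true predecessor. *)
  case: m IH c g j i ij {tlE} dg cg gB mg bg H ii => [|m] IH c g j; first by case: j.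
  move=> i ij dg cg gB mg bg H ii /=.
  have -> : 2 * B * (2 * r) ^+ m.+1 = \int[leb]_(s in seg (c 0 0) r) (2 * B * (2 * r) ^+ m).
    rewrite Rintegral_cst ?[X in fine X]lebesgue_seg ?ltW//; last exact: measurable_seg.
    by rewrite exprS/=; ring.
  apply: le_Rintegral => //; first exact: measurable_seg.
  - exact: integrable_norm.
  - apply: measurable_bounded_integrable => //; first exact: measurable_seg.
      by rewrite [ltLHS]lebesgue_seg ?ltW// ltry.
    exact: bounded_cst.
rewrite i0 in cg gB mg bg *; rewrite (Rint_box21 (ltW r0) mg bg) /=.
have E t : \int[leb]_(s in seg (c 0 0) r)
    'D_(delta_mx 0 ord0) g (row_of_tuple (cons_pair (s, t))) =
  g (cns (c 0 0 + r) (row_of_tuple t)) - g (cns (c 0 0 - r) (row_of_tuple t)).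
  by under eq_Rintegral do rewrite row_of_cons; rewrite FTC_cns.
under eq_Rintegral do rewrite E.
apply: le_Rint_box.
- exact: ltW.
- apply: (@measurable_row _ (fun y => g (cns (c 0 0 + r) y) - g (cns (c 0 0 - r) y))).
  have cc s : continuous (fun y => g (cns s y)).
    move=> y; apply: (@continuous_comp _ _ _ (cns s) g y).
      exact/differentiable_continuous/differentiable_cns.
    exact/differentiable_continuous.
  by move=> y; exact: (@continuousB _ _ _ _ _ y (cc _ y) (cc _ y)).
move=> t Bt; have HB e : `|e| = r -> `|g (cns (c 0 0 + e) (row_of_tuple t))| <= B.
  move=> er; apply: gB => [k|]; last by rewrite cns0 addrAC subrr add0r.
  case: (unliftP ord0 k) => [k' ->|->]; first by rewrite cnsS -tlE mxE; exact: Bt.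
  by rewrite cns0 addrAC subrr add0r er.
rewrite (le_trans (ler_normB _ _))// mulr_natl mulr2n.
by rewrite lerD// HB// ?normrN gtr0_norm.
Qed.

End BoxDivergence.

(** * An integrable weight on R^m *)

Section Domination.
Context {R : realType}.
Notation RT := (measurableTypeR R).
Notation leb := (@lebesgue_measure R).

(* Dominates (1 + |y|^2)^(-m), and is integrable by Tonelli. *)
Definition cauchy_weight m (t : m.-tuple RT) : R := \prod_i (oneDsqr (tnth t i : R))^-1.

Lemma cauchy_weight_ge0 m (t : m.-tuple RT) : 0 <= cauchy_weight t.
Proof.
apply: prodr_ge0 => i _; rewrite invr_ge0.
exact: le_trans ler01 (oneDsqr_ge1 _).
Qed.

Lemma measurable_oneDsqrV : measurable_fun [set: RT] (fun s : RT => (oneDsqr (s : R))^-1).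
Proof. by apply: continuous_measurable_fun; exact: continuous_oneDsqrV. Qed.

Lemma measurable_cauchy_weight m : measurable_fun setT (@cauchy_weight m).
Proof.
apply: measurable_prod => i _.
apply: (measurableT_comp measurable_oneDsqrV); exact: measurable_tnth.
Qed.

Lemma cauchy_weight_cons m s (t : m.-tuple RT) :
  cauchy_weight (cons_pair (s, t)) = (oneDsqr (s : R))^-1 * cauchy_weight t.
Proof.
rewrite /cauchy_weight big_ord_recl tnth0; congr (_ * _).
by apply: eq_bigr => i _; rewrite tnthS.
Qed.

Lemma integral_oneDsqrV_lty : (\int[leb]_s ((oneDsqr (s : R))^-1)%:E < +oo)%E.
Proof.
rewrite (@ge0_symfun_integralT R (fun s => (oneDsqr s)^-1)).
- by rewrite -set_itvcy integral0y_oneDsqr -EFinM ltry.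
- by move=> x; rewrite invr_ge0 (le_trans ler01 (oneDsqr_ge1 _)).
- exact: continuous_oneDsqrV.
- by move=> x; rewrite /= /oneDsqr sqrrN.
Qed.

(** The weight is a product over the coordinates, so at each step of the induction Tonelli's theorem
    splits off a factor 1/(1 + s^2) of finite integral. *)
Lemma integral_cauchy_weight_lty m :
  (\int[lebesgue_tuple m]_t (cauchy_weight t)%:E < +oo)%E.
Proof.
elim: m => [|m IH].
  rewrite [X in (X < _)%E](_ : _ = (\int[dirac ([tuple] : 0.-tuple RT)]_t (cauchy_weight t)%:E)%E)//.
  rewrite integral_dirac//; last by apply/measurable_EFinP; exact: (@measurable_cauchy_weight 0).
  by rewrite diracT mul1e ltry.
have mw := @measurable_cauchy_weight m.+1.
rewrite [ltLHS](_ : _ = (\int[pushforward (leb \x lebesgue_tuple m)%E (@cons_pair R m)]_(t in setT)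
  (cauchy_weight t)%:E)%E)//.
rewrite ge0_integral_pushforward//; first last.
- by move=> t _; rewrite lee_fin cauchy_weight_ge0.
- exact/measurable_EFinP.
- exact: measurable_cons_pair.
rewrite preimage_setT fubini_tonelli1; first last.
- by move=> t; rewrite lee_fin cauchy_weight_ge0.
- have H : measurable_fun setT (EFin \o (@cauchy_weight m.+1 \o @cons_pair R m)).
    by apply/measurable_EFinP; apply: measurableT_comp mw _; exact: measurable_cons_pair.
  exact: H.
rewrite /fubini_F.
have E (s : RT) : (\int[lebesgue_tuple m]_t (cauchy_weight (cons_pair (s, t)))%:E =
    ((oneDsqr (s : R))^-1)%:E * \int[lebesgue_tuple m]_t (cauchy_weight t)%:E)%E.
  under eq_integral do rewrite cauchy_weight_cons EFinM.
  rewrite ge0_integralZl//.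
  - by apply/measurable_EFinP; exact: (@measurable_cauchy_weight m).
  - by move=> t _; rewrite lee_fin cauchy_weight_ge0.
under eq_integral do rewrite /= E.
have ge0 (s : RT) : (0 <= ((oneDsqr (s : R))^-1)%:E)%E.
  by rewrite lee_fin invr_ge0 (le_trans ler01 (oneDsqr_ge1 _)).
have I0 : (0 <= \int[lebesgue_tuple m]_t (cauchy_weight t)%:E)%E.
  by apply: integral_ge0 => s _; rewrite lee_fin cauchy_weight_ge0.
have J0 : (0 <= \int[leb]_s ((oneDsqr (s : R))^-1)%:E)%E.
  by apply: integral_ge0 => s _; exact: ge0.
rewrite ge0_integralZr//; last by apply/measurable_EFinP; exact: measurable_oneDsqrV.
apply: lte_mul_pinfty => //.
by rewrite ge0_fin_numE ?integral_oneDsqrV_lty.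
Qed.

Lemma integrable_cauchy_weight m :
  (lebesgue_tuple m).-integrable setT (EFin \o @cauchy_weight m).
Proof.
apply/integrableP; split; first by apply/measurable_EFinP; exact: (@measurable_cauchy_weight m).
under eq_integral do rewrite /= ger0_norm ?cauchy_weight_ge0//.
exact: integral_cauchy_weight_lty.
Qed.

(** Each of the m factors 1 + y_i^2 is at most 1 + |y|^2. *)
Lemma weight_le_cauchy m (t : m.-tuple RT) (y := row_of_tuple t) :
  (1 + dot y y)^-1 ^+ m <= cauchy_weight t.
Proof.
rewrite exprVn -[X in X ^-1 <= _](_ : \prod_(i < m) (1 + dot y y) = _); last first.
  by rewrite prodr_const card_ord.
rewrite -prodfV; apply: ler_prod => i _.
have d0 (j : 'I_m) : 0 <= y 0 j * y 0 j by rewrite -expr2 sqr_ge0.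
have i1 : 1 <= oneDsqr (tnth t i : R) by exact: oneDsqr_ge1.
have le1 : oneDsqr (tnth t i : R) <= 1 + dot y y.
  rewrite /oneDsqr lerD2l /dot (bigD1 i)//= mxE expr2 lerDl.
  exact: sumr_ge0.
rewrite invr_ge0 (le_trans _ (le_trans i1 le1))//= lef_pV2// posrE.
  exact: lt_le_trans ltr01 (le_trans i1 le1).
exact: lt_le_trans ltr01 i1.
Qed.

End Domination.

(** * Cutoffs and the vanishing of the integral of a divergence *)

Section Cutoff.
Context {R : realType} {m : nat}.
Implicit Types (q y : 'rV[R]_m) (s : seq 'rV[R]_m) (e : R).

(* The cube makes [cutoff] of class C^1.  Since [bump e q >= 1 / 8] in a
   neighbourhood of [q], [cutoff e s] vanishes near every point of [s]. *)
Definition pcube (t : R) : R := Num.max 0 t ^+ 3.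
Definition sqdist q y : R := dot (y - q) (y - q).
Definition bump e q y : R := pcube (1 - e^-2 * sqdist q y).
Definition cutoff e s y : R := pcube (1 - 8 * \sum_(q <- s) bump e q y).

Lemma pcube_ge0 t : 0 <= pcube t.
Proof. by rewrite exprn_ge0// le_max lexx. Qed.

Lemma pcube_le1 t : t <= 1 -> pcube t <= 1.
Proof.
by move=> t1; rewrite exprn_ile1// ?le_max ?lexx// ge_max ler01.
Qed.

Lemma pcube_eq0 t : t <= 0 -> pcube t = 0.
Proof. by move=> t0; rewrite /pcube max_l// expr0n. Qed.

Lemma derive_pcube (g : 'rV[R]_m -> R) y v : differentiable g y ->
  'D_v (fun z => pcube (g z)) y = 3 * Num.max 0 (g y) ^+ 2 * 'D_v g y.
Proof.
move=> dg; have dp : differentiable pcube (g y).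
  exact: (Ck_diff (@Ck_pos_cube R)).
have -> : (fun z => pcube (g z)) = pcube \o g by [].
by rewrite derive_comp// derive_scalar// derive_pos_cube mulrC.
Qed.

Lemma derive_pcube_le (a t d : R) : t <= 1 -> `|d| <= a ->
  `|3 * Num.max 0 t ^+ 2 * d| <= 3 * a.
Proof.
move=> t1 da; have p0 : 0 <= Num.max 0 t by rewrite le_max lexx.
have p1 : Num.max 0 t <= 1 by rewrite ge_max ler01.
have pp : 0 <= 3 * Num.max 0 t ^+ 2 by rewrite mulr_ge0// exprn_ge0.
rewrite normrM (ger0_norm pp).
rewrite -mulrA ler_pM2l// -[leRHS]mul1r ler_pM// ?exprn_ge0//.
exact: exprn_ile1.
Qed.

Lemma sqdist_entry_le e q y i : 0 < e -> sqdist q y <= e ^+ 2 -> `|y 0 i - q 0 i| <= e.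
Proof. by move=> /ltW e0 /(entry_le_of_dot i e0); rewrite !mxE. Qed.

Lemma Ck_sqdist k q : Ck k [set: 'rV[R]_m] (sqdist q).
Proof.
have kd : Ck k [set: 'rV[R]_m] (fun y => y - q).
  by apply: Ck_minus; [exact: openT|apply: Ck_id; exact: openT|exact: Ck_cst].
by apply: Ck_dot => //; exact: openT.
Qed.

Lemma dot_deltar (u : 'rV[R]_m) i : dot u (delta_mx 0 i) = u 0 i.
Proof.
rewrite /dot (bigD1 i)//= big1 => [|j ji]; first by rewrite mxE !eqxx mulr1 addr0.
by rewrite mxE eqxx (negbTE ji) mulr0.
Qed.

Lemma derive_sqdist q y i : 'D_(delta_mx 0 i) (sqdist q) y = 2 * (y 0 i - q 0 i).
Proof.
have dy : differentiable (fun y : 'rV[R]_m => y - q) y.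
  by apply: differentiableB => //; exact: differentiable_cst.
rewrite /sqdist derive_dot// derive_subc//.
have -> : 'D_(delta_mx 0 i) (fun y => y) y = delta_mx 0 i by exact: derive_id.
rewrite [dot (delta_mx _ _) _]dot_sym dot_deltar !mxE.
by rewrite mulr_natl mulr2n.
Qed.

Lemma Ck_bump e q : Ck 1 [set: 'rV[R]_m] (bump e q).
Proof.
apply: (Ck_comp1 openT (U' := setT)) (@Ck_pos_cube R) => //.
apply: Ck_minus; [exact: openT|exact: Ck_cst|].
by apply: Ck_scalec; [exact: openT|exact: Ck_sqdist].
Qed.

Lemma Ck_cutoff e s : Ck 1 [set: 'rV[R]_m] (cutoff e s).
Proof.
apply: (Ck_comp1 openT (U' := setT)) (@Ck_pos_cube R) => //.
apply: Ck_minus; [exact: openT|exact: Ck_cst|].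
apply: Ck_scalec; first exact: openT.
by apply: Ck_sum => [|q _]; [exact: openT|exact: Ck_bump].
Qed.

(** The cube contains the support of [bump e q]; cubes are the sets whose measure [lebesgue_box]
    provides. *)
Definition cube_ind e q y : R := ([forall i, `|y 0 i - q 0 i| <= e])%:R.
Definition cube_count e s y : R := \sum_(q <- s) cube_ind e q y.

Lemma cube_count_ge0 e s y : 0 <= cube_count e s y.
Proof. by apply: sumr_ge0 => q _; rewrite ler0n. Qed.

Lemma cube_ind_near e q y : 0 < e -> sqdist q y < e ^+ 2 -> cube_ind e q y = 1.
Proof.
move=> e0 de; rewrite /cube_ind; have -> // : [forall i, `|y 0 i - q 0 i| <= e].
by apply/forallP => i; exact: sqdist_entry_le e0 (ltW de).
Qed.

Lemma bump_arg e q y : 0 < e -> (1 - e^-2 * sqdist q y <= 0) = (e ^+ 2 <= sqdist q y).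
Proof.
move=> e0; rewrite subr_le0 -(ler_pM2l (exprn_gt0 2 e0)).
by rewrite mulr1 mulrA divff ?mul1r// gt_eqF// exprn_gt0.
Qed.

Lemma bump_ge0 e q y : 0 <= bump e q y. Proof. exact: pcube_ge0. Qed.

Lemma bump_arg_le1 e q y : 1 - e^-2 * sqdist q y <= 1.
Proof. by rewrite gerBl mulr_ge0 ?dot_ge0// invr_ge0 sqr_ge0. Qed.

Lemma bump_le_ind e q y : 0 < e -> bump e q y <= cube_ind e q y.
Proof.
move=> e0; have [de|ed] := ltP (sqdist q y) (e ^+ 2).
  by rewrite cube_ind_near// pcube_le1// bump_arg_le1.
by rewrite /bump pcube_eq0 ?bump_arg// ler0n.
Qed.

(** The constant 6 is 3 times 2: the cube contributes 3, the square in [sqdist] contributes 2, and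
    on the support |y_i - q_i| / e^2 is at most 1/e. *)
Lemma derive_bump_le e q y i : 0 < e ->
  `|'D_(delta_mx 0 i) (bump e q) y| <= 6 / e * cube_ind e q y.
Proof.
move=> e0; have ds : differentiable (sqdist q) y by exact: (Ck_diff (@Ck_sqdist 0 q)).
have dg : differentiable (fun y => e^-2 * sqdist q y) y by exact: differentiableZ.
rewrite /bump derive_pcube; last first.
  by apply: differentiableB => //; exact: differentiable_cst.
have [de|ed] := ltP (sqdist q y) (e ^+ 2); last first.
  rewrite max_l ?bump_arg// expr0n/= mulr0 mul0r normr0.
  by rewrite mulr_ge0 ?ler0n// divr_ge0// ltW.
rewrite cube_ind_near// mulr1 (_ : 6 / e = 3 * (2 / e)); last by ring.
apply: derive_pcube_le; first exact: bump_arg_le1.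
rewrite derive_csub//.
have -> : 'D_(delta_mx 0 i) (fun y => e^-2 * sqdist q y) y = e^-2 * (2 * (y 0 i - q 0 i)).
  by rewrite [LHS](derive_scalec (e^-2) _ ds) derive_sqdist.
have le : `|y 0 i - q 0 i| <= e.
  exact: sqdist_entry_le e0 (ltW de).
have ei : 0 < e^-2 by rewrite invr_gt0 exprn_gt0.
rewrite normrN normrM gtr0_norm// normrM gtr0_norm//.
rewrite (_ : 2 / e = e^-2 * (2 * e)); first by rewrite !ler_pM2l.
by rewrite expr2 invfM; field; rewrite gt_eqF.
Qed.

Lemma cutoff_ge0 e s y : 0 <= cutoff e s y. Proof. exact: pcube_ge0. Qed.

Lemma cutoff_arg_le1 e s y : 1 - 8 * \sum_(q <- s) bump e q y <= 1.
Proof. by rewrite gerBl mulr_ge0// sumr_ge0// => q _; exact: bump_ge0. Qed.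

Lemma cutoff_le1 e s y : cutoff e s y <= 1.
Proof. by rewrite pcube_le1// cutoff_arg_le1. Qed.

(** Outside the cubes every bump vanishes and the cutoff is 1; inside one of them the right side is
    at least 1. *)
Lemma onem_cutoff_le e s y : 0 < e -> `|1 - cutoff e s y| <= cube_count e s y.
Proof.
move=> e0; rewrite ger0_norm ?subr_ge0 ?cutoff_le1//.
have [h|h] := boolP (has (fun q => [forall i, `|y 0 i - q 0 i| <= e]) s).
  apply: (@le_trans _ _ 1); first by rewrite gerBl cutoff_ge0.
  have /hasP[q qs qP] := h; rewrite /cube_count (big_rem q)//= /cube_ind qP.
  by rewrite lerDl sumr_ge0// => p _; rewrite ler0n.
rewrite /cutoff big1_seq ?mulr0 ?subr0.
  by rewrite /pcube max_r// expr1n subrr cube_count_ge0.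
move=> q /= qs; apply/eqP; rewrite eq_le bump_ge0 andbT.
rewrite (le_trans (bump_le_ind q y e0))//.
have /negbTE := hasPn h q qs; by rewrite /cube_ind => ->.
Qed.

(** The constant 144 is the product of 3 from the outer cube, 8 from the factor in [cutoff] and 6
    from [derive_bump_le]. *)
Lemma derive_cutoff_le e s y i : 0 < e ->
  `|'D_(delta_mx 0 i) (cutoff e s) y| <= 144 / e * cube_count e s y.
Proof.
move=> e0; have db q : differentiable (bump e q) y by exact: (Ck_diff (Ck_bump e q)).
have dS : differentiable (fun y => \sum_(q <- s) bump e q y) y.
  apply: (Ck_diff (k := 1) (U := setT)) => //.
  by apply: Ck_sum => [|q _]; [exact: openT|exact: Ck_bump].
have dS8 : differentiable (fun y => 8 * \sum_(q <- s) bump e q y) y by exact: differentiableZ.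
rewrite /cutoff derive_pcube; last first.
  by apply: differentiableB => //; exact: differentiable_cst.
rewrite (_ : 144 / e * _ = 3 * (8 * (6 / e * cube_count e s y))); last by ring.
apply: derive_pcube_le; first exact: cutoff_arg_le1.
rewrite derive_csub// normrN.
have -> : 'D_(delta_mx 0 i) (fun y => 8 * \sum_(q <- s) bump e q y) y =
  8 * \sum_(q <- s) 'D_(delta_mx 0 i) (bump e q) y.
  by rewrite [LHS](derive_scalec 8 _ dS) derive_bigsum.
rewrite normrM ger0_norm// ler_pM2l// /cube_count mulr_sumr.
rewrite (le_trans (ler_norm_sum _ _ _))//.
by apply: ler_sum => q _; exact: derive_bump_le.
Qed.

(** Below squared distance e^2 / 2 the argument of the bump is at least 1/2; its cube 1/8 is what
    the factor 8 in [cutoff] compensates. *)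
Lemma cutoff_near0 e s q y : 0 < e -> q \in s -> 2 * sqdist q y < e ^+ 2 ->
  cutoff e s y = 0.
Proof.
move=> e0 qs dq; rewrite /cutoff pcube_eq0// subr_le0.
have b8 : 8^-1 <= bump e q y.
  have e2 : 0 < e ^+ 2 by rewrite exprn_gt0.
  have h : 2^-1 <= 1 - e^-2 * sqdist q y.
    have : e^-2 * sqdist q y <= 2^-1.
      by rewrite mulrC ler_pdivrMr//; lra.
    by lra.
  rewrite /bump /pcube max_r; last lra.
  rewrite (_ : 8^-1 = 2^-1 ^+ 3); last by field.
  by rewrite ler_pXn2r// nnegrE; lra.
have : bump e q y <= \sum_(p <- s) bump e p y.
  by rewrite (big_rem q)//= lerDl sumr_ge0// => p _; exact: bump_ge0.
by lra.
Qed.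

End Cutoff.

(** * Removal of finitely many singular points and exhaustion by cubes *)

Section DivergenceZero.
Context {R : realType}.
Notation RT := (measurableTypeR R).
Notation leb := (@lebesgue_measure R).

Lemma cube_indE m e (q : 'rV[R]_m) :
  (fun t => cube_ind e q (row_of_tuple t)) = \1_(box q e) :> (m.-tuple RT -> R).
Proof.
apply/funext => t; rewrite indicE /cube_ind; congr (nat_of_bool _)%:R.
apply/forallP/idP => [H|/set_mem H i]; last by rewrite mxE; exact: H.
by apply/mem_set => i; have := H i; rewrite mxE.
Qed.

(** The cubes are counted with multiplicity, so overlaps do no harm: each contributes its measure
    (2e)^m, even where it sticks out of the box. *)
Lemma integral_le_count m (c : 'rV[R]_m) (r e M : R) s (E : 'rV[R]_m -> R) :
  0 <= r -> 0 <= e -> 0 <= M -> continuous E ->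
  (forall y, `|E y| <= M * cube_count e s y) ->
  `|\int[lebesgue_tuple m]_(t in box c r) E (row_of_tuple t)| <=
    M * ((size s)%:R * (2 * e) ^+ m).
Proof.
move=> r0 e0 M0 cE EM.
have mE := measurable_row cE.
have ii := box_integrable r0 mE (bounded_box c r cE).
apply: le_trans (le_normr_Rintegral (measurable_box _ _) ii) _.
have fin : (\int[lebesgue_tuple m]_(t in box c r) (`|E (row_of_tuple t)|)%:E)%E \is a fin_num.
  apply: integrable_fin_num; first exact: measurable_box.
  exact: (integrable_norm ii).
rewrite /Rintegral -lee_fin fineK//.
have mI q : measurable_fun setT (fun t : m.-tuple RT => (M * cube_ind e q (row_of_tuple t))%:E).
  apply/measurable_EFinP; apply: measurable_funM; first exact: measurable_cst.
  by rewrite cube_indE; apply: measurable_indic; exact: measurable_box.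
have I0 q (t : m.-tuple RT) : (0 <= (M * cube_ind e q (row_of_tuple t))%:E)%E.
  by rewrite lee_fin mulr_ge0// ler0n.
apply: (@le_trans _ _ (\int[lebesgue_tuple m]_t \sum_(q <- s)
    (M * cube_ind e q (row_of_tuple t))%:E)%E).
  apply: (@le_trans _ _ (\int[lebesgue_tuple m]_t (`|E (row_of_tuple t)|)%:E)%E).
    apply: ge0_subset_integral => //; first exact: measurable_box.
    by apply/measurable_EFinP; apply: measurableT_comp.
  apply: ge0_le_integral => //.
  - by apply/measurable_EFinP; apply: measurableT_comp.
  - exact: emeasurable_sum.
  - by move=> t _; rewrite sumEFin lee_fin -mulr_sumr; exact: EM.
rewrite ge0_integral_sum//.
have IE q : (\int[lebesgue_tuple m]_t (M * cube_ind e q (row_of_tuple t))%:E)%E =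
   (M * (2 * e) ^+ m)%:E.
  under eq_integral do rewrite EFinM.
  rewrite ge0_integralZl//.
  - have -> : (fun t : m.-tuple RT => (cube_ind e q (row_of_tuple t))%:E) =
        (fun t => (\1_(box q e) t)%:E).
      by rewrite -cube_indE.
    rewrite integral_indic//; last exact: measurable_box.
    by rewrite setIT [X in (_ * X)%E]lebesgue_box// EFinM.
  - apply/measurable_EFinP; rewrite cube_indE.
    by apply: measurable_indic; exact: measurable_box.
  - by move=> t _; rewrite lee_fin ler0n.
under eq_bigr do rewrite IE.
rewrite sumEFin lee_fin big_const_seq count_predT iter_addr addr0.
by rewrite [(size s)%:R * _]mulr_natl mulrnAr.
Qed.

Variables (m : nat) (K : 'rV[R]_m -> R) (C : R) (s : seq 'rV[R]_m)
  (W : 'I_m -> 'rV[R]_m -> R) (Om : set 'rV[R]_m).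
Let wt (y : 'rV[R]_m) : R := (1 + dot y y)^-1.
Hypotheses (m2 : (2 <= m)%N) (C0 : 0 <= C) (cK : continuous K) (oOm : open Om)
  (KC : forall y, `|K y| <= C * wt y ^+ m)
  (sOm : forall y, y \notin s -> Om y)
  (kW : forall i, Ck 1 Om (W i))
  (WC : forall i y, Om y -> `|W i y| <= C * wt y ^+ m.-1)
  (divW : forall y, Om y -> \sum_i 'D_(delta_mx 0 i) (W i) y = K y).

Let wt01 y : 0 <= wt y <= 1.
Proof.
have h : 1 <= 1 + dot y y by rewrite lerDl dot_ge0.
rewrite invr_ge0 (le_trans ler01 h)/= invf_le1//.
exact: lt_le_trans ltr01 h.
Qed.

Let wtX y k : wt y ^+ k <= 1.
Proof. by have /andP[a b] := wt01 y; rewrite exprn_ile1. Qed.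

(** Nothing is known of [W i] at points of [s] outside [Om]; the cutoff vanishes near them, so the
    product is [Ck 1] on the whole space. *)
Let G e i y : R := cutoff e s y * W i y.

Let near_s q e : 0 < e -> q \in s ->
  exists2 U, open U /\ U q & forall y, U y -> cutoff e s y = 0.
Proof.
move=> e0 qs; exists [set y | 2 * sqdist q y < e ^+ 2]; last first.
  by move=> y /=; exact: cutoff_near0.
split; last by rewrite /= /sqdist subrr /dot big1 ?mulr0 ?exprn_gt0// => i _; rewrite mxE mulr0.
have -> : [set y | 2 * sqdist q y < e ^+ 2] = (fun y => 2 * sqdist q y) @^-1` [set t | t < e ^+ 2] by [].
apply: open_comp; last exact: open_lt.
move=> y _; apply: (Ck_continuous (k := 0) (U := setT)) => //.
by apply: Ck_scalec; [exact: openT|exact: Ck_sqdist].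
Qed.

Let kG e i : 0 < e -> Ck 1 setT (G e i).
Proof.
move=> e0; apply: Ck_local => y _; have [ys|ys] := boolP (y \in s); last first.
  exists Om; first exact: sOm.
  by apply: Ck_mul => //; exact: Ck_subset (Ck_cutoff e s).
have [U [oU Uy] U0] := near_s e0 ys; exists U => //.
apply: (Ck_ext oU (F := fun=> 0)); last exact: Ck_cst.
by move=> z Uz; rewrite /G U0// mul0r.
Qed.

(** Error made in replacing [K] by the divergence of the cut-off field. Off [s] it is (1 - cutoff) K
    minus the gradient of the cutoff paired with [W]. *)
Let E e y : R := K y - \sum_i 'D_(delta_mx 0 i) (G e i) y.

Let cDG e i : 0 < e -> continuous ('D_(delta_mx 0 i) (G e i)).
Proof. by move=> e0 y; apply: Ck_continuous (Ck_derive (delta_mx 0 i) (kG i e0)) _. Qed.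

Let cSum e (I : seq 'I_m) : 0 < e ->
  continuous (fun y => \sum_(i <- I) 'D_(delta_mx 0 i) (G e i) y).
Proof.
move=> e0 y; apply: (Ck_continuous (k := 0) (U := setT)) => //.
by apply: Ck_sum => [|i _]; [exact: openT|exact: Ck_derive (kG i e0)].
Qed.

Let cE e : 0 < e -> continuous (E e).
Proof.
move=> e0 y; apply: continuousB; first exact: cK.
exact: cSum.
Qed.

(** The summand 1 accounts for the part in [K], where e <= 1 allows the factor 1/e; the summand 144
    m collects the m gradient terms. *)
Let EM e y : 0 < e -> e <= 1 ->
  `|E e y| <= C * (1 + 144 * m%:R) / e * cube_count e s y.
Proof.
move=> e0 e1; have cc0 := cube_count_ge0 e s y.
have ie1 : 1 <= e^-1 by rewrite invf_ge1.
have a0 : 0 <= 144 * m%:R :> R by rewrite mulr_ge0.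
have [ys|ys] := boolP (y \in s).
  have [U [oU Uy] U0] := near_s e0 ys.
  rewrite /E big1 ?subr0 => [|i _]; last first.
    rewrite (derive_ext (G := fun=> 0) _ oU Uy) ?derive_cst//.
    by move=> z Uz; rewrite /G U0// mul0r.
  have c1 : 1 <= cube_count e s y.
    rewrite /cube_count (big_rem y)//= cube_ind_near//.
      by rewrite lerDl sumr_ge0// => p _; rewrite ler0n.
    by rewrite /sqdist subrr /dot big1 ?exprn_gt0// => i _; rewrite mxE mulr0.
  rewrite (le_trans (KC y))// -!mulrA ler_wpM2l//.
  rewrite (le_trans (wtX _ _))// mulrA -[leLHS]mul1r ler_pM// -[leLHS]mul1r ler_pM//.
  by rewrite lerDl.
have Oy := sOm ys.
have EE : E e y = (1 - cutoff e s y) * K y - \sum_i 'D_(delta_mx 0 i) (cutoff e s) y * W i y.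
  rewrite /E; have -> : \sum_i 'D_(delta_mx 0 i) (G e i) y =
      \sum_i 'D_(delta_mx 0 i) (cutoff e s) y * W i y + cutoff e s y * K y.
    rewrite -divW// mulr_sumr -big_split/=; apply: eq_bigr => i _.
    rewrite derive_mul//; first exact: (Ck_diff (Ck_cutoff e s)).
    exact: (Ck_diff (kW i)).
  by ring.
rewrite EE (le_trans (ler_normB _ _))//.
have -> : C * (1 + 144 * m%:R) / e * cube_count e s y =
  C * e^-1 * cube_count e s y + m%:R * (144 / e * cube_count e s y * C) by ring.
apply: lerD.
  rewrite normrM mulrC -mulrA ler_pM//.
    by rewrite (le_trans (KC y))// -[leRHS]mulr1 ler_wpM2l.
  rewrite (le_trans (onem_cutoff_le s y e0))// -[leLHS]mul1r ler_wpM2r//.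
rewrite (le_trans (ler_norm_sum _ _ _))// -[leRHS]sum_cst_ord.
apply: ler_sum => i _; rewrite normrM ler_pM//; first exact: derive_cutoff_le.
by rewrite (le_trans (WC i Oy))// -[leRHS]mulr1 ler_wpM2l.
Qed.

(** Bound on the flux through a pair of opposite faces of the cube, on which |y|^2 is at least
    r^2. *)
Let bdry r := 2 * (C * (1 + r ^+ 2)^-1 ^+ m.-1) * (2 * r) ^+ m.-1.

Let box_cut r e : 0 < r -> 0 < e -> e <= 1 ->
  `|\int[lebesgue_tuple m]_(t in box 0 r) K (row_of_tuple t)| <=
   m%:R * bdry r + C * (1 + 144 * m%:R) * ((size s)%:R * 2 ^+ m) * e.
Proof.
move=> r0 e0 e1.
have iint (F : 'rV[R]_m -> R) : continuous F ->
  (lebesgue_tuple m).-integrable (box 0 r) (EFin \o (F \o @row_of_tuple R m)).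
  by move=> cF; apply: box_integrable (ltW r0) (measurable_row cF) (bounded_box _ _ cF).
have cS : continuous (fun y => \sum_i 'D_(delta_mx 0 i) (G e i) y).
  exact: cSum.
have -> : \int[lebesgue_tuple m]_(t in box 0 r) K (row_of_tuple t) =
  \int[lebesgue_tuple m]_(t in box 0 r) (\sum_i 'D_(delta_mx 0 i) (G e i) (row_of_tuple t)) +
  \int[lebesgue_tuple m]_(t in box 0 r) E e (row_of_tuple t).
  rewrite -RintegralD//; first last.
  - by have := iint _ (cE e0).
  - by have := iint _ cS.
  - exact: measurable_box.
  by apply: eq_Rintegral => t _; rewrite /E addrC subrK.
apply: le_trans (ler_normD _ _) _; apply: lerD.
  have -> : \int[lebesgue_tuple m]_(t in box 0 r) (\sum_i 'D_(delta_mx 0 i) (G e i) (row_of_tuple t)) =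
     \sum_i \int[lebesgue_tuple m]_(t in box 0 r) 'D_(delta_mx 0 i) (G e i) (row_of_tuple t).
    have gen (I : seq 'I_m) :
        \int[lebesgue_tuple m]_(t in box 0 r) (\sum_(i <- I) 'D_(delta_mx 0 i) (G e i) (row_of_tuple t)) =
     \sum_(i <- I) \int[lebesgue_tuple m]_(t in box 0 r) 'D_(delta_mx 0 i) (G e i) (row_of_tuple t).
      elim: I => [|i I IH].
        by rewrite big_nil; under eq_Rintegral do rewrite big_nil;
          rewrite Rintegral_cst ?mul0r//; exact: measurable_box.
      rewrite big_cons -IH -RintegralD//; first last.
      - have cSI : continuous (fun y => \sum_(i <- I) 'D_(delta_mx 0 i) (G e i) y).
          exact: cSum.
        by have := iint _ cSI.
      - by have := iint _ (@cDG e i e0).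
      - exact: measurable_box.
      by apply: eq_Rintegral => t _; rewrite big_cons.
    exact: gen.
  rewrite (le_trans (ler_norm_sum _ _ _))// -[leRHS]sum_cst_ord.
  apply: ler_sum => i _; apply: box_divergence => //.
  - by move=> x; apply: (Ck_diff (kG i e0)).
  - exact: cDG.
  move=> y _; rewrite mxE subr0 => yr.
  have q1 : 1 + r ^+ 2 <= 1 + dot y y.
    rewrite lerD2l /dot (bigD1 i)//= -expr2 -yr real_normK ?num_real// lerDl.
    by apply: sumr_ge0 => j _; rewrite -expr2 sqr_ge0.
  have p1 : 0 < 1 + r ^+ 2 by rewrite ltr_pwDl// sqr_ge0.
  have B0 : 0 <= C * (1 + r ^+ 2)^-1 ^+ m.-1.
    by rewrite mulr_ge0// exprn_ge0// invr_ge0 ltW.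
  have [ys|ys] := boolP (y \in s).
    by have [U [_ Uy] U0] := near_s e0 ys; rewrite /G U0// mul0r normr0.
  rewrite /G normrM -[leRHS]mul1r ler_pM//.
    by rewrite ger0_norm ?cutoff_ge0// cutoff_le1.
  rewrite (le_trans (WC i (sOm ys)))// ler_wpM2l//.
  have w0 : 0 < 1 + dot y y by exact: lt_le_trans q1.
  have wle : wt y <= (1 + r ^+ 2)^-1 by rewrite /wt lef_pV2.
  by apply: lerXn2r => //; rewrite nnegrE ?invr_ge0 ?ltW//; have /andP[] := wt01 y.
have A0 : 0 <= C * (1 + 144 * m%:R) by rewrite mulr_ge0// addr_ge0// mulr_ge0.
have M0 : 0 <= C * (1 + 144 * m%:R) / e by rewrite mulr_ge0// invr_ge0 ltW.
have := integral_le_count 0 (ltW r0) (ltW e0) M0 (cE e0) (fun y => @EM e y e0 e1).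
move=> /le_trans; apply.
have k0 : 0 <= 1 + 144 * m%:R :> R by rewrite addr_ge0// mulr_ge0.
rewrite -!mulrA; apply: ler_wpM2l => //; apply: ler_wpM2l => //.
rewrite mulrCA; apply: ler_wpM2l; rewrite ?ler0n//.
rewrite exprMn mulrCA; apply: ler_wpM2l; first by rewrite exprn_ge0.
(* The product of 1/e and e^m is e^(m-1), at most e because m >= 2 and e <= 1. *)
case: m m2 => [//|[//|k]] _; rewrite exprS mulKf ?gt_eqF//.
rewrite exprS -[leRHS]mulr1; apply: ler_wpM2l; first exact: ltW.
by apply: exprn_ile1 => //; exact: ltW.
Qed.

Let box_bdry r : 0 < r ->
  `|\int[lebesgue_tuple m]_(t in box 0 r) K (row_of_tuple t)| <= m%:R * bdry r.
Proof.
move=> r0; set A := C * (1 + 144 * m%:R) * ((size s)%:R * 2 ^+ m).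
have A0 : 0 <= A by rewrite !mulr_ge0// ?addr_ge0// ?mulr_ge0// exprn_ge0.
apply/ler_addgt0Pr => e e0.
(* The minimum with 1 meets the condition e <= 1 of [box_cut], and [A + 1] stays positive even if
   [A] is 0. *)
have d0 : 0 < Num.min 1 (e / (A + 1)).
  by rewrite lt_min ltr01 divr_gt0// ltr_wpDl.
apply: le_trans (box_cut r0 d0 _) _; first by rewrite ge_min lexx.
rewrite lerD2l -/A; apply: (@le_trans _ _ (A * (e / (A + 1)))).
  by rewrite ler_wpM2l// ge_min lexx orbT.
rewrite mulrCA -[leRHS]mulr1 ler_wpM2l ?ltW//.
by rewrite ltr_pdivrMr ?ltr_wpDl// mul1r ltrDl.
Qed.

(** There are m - 1 >= 1 factors k / (1 + k^2), each at most 1/k and at most 1: one supplies the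
    decay, the others are dropped. *)
Lemma bdry_le k : (0 < k)%N -> bdry k%:R <= 2 * (C * 2 ^+ m.-1) / k%:R.
Proof.
move=> k0; have r0 : 0 < k%:R :> R by rewrite ltr0n.
have r1 : 1 <= k%:R :> R by rewrite ler1n.
rewrite /bdry -!mulrA ler_wpM2l// ler_wpM2l// exprMn mulrCA ler_wpM2l ?exprn_ge0//.
rewrite -exprMn; set z := (1 + _)^-1 * _.
have p : 0 < 1 + k%:R ^+ 2 :> R by rewrite ltr_pwDl// sqr_ge0.
have z0 : 0 <= z by rewrite mulr_ge0// invr_ge0 ltW.
have zk : z <= k%:R^-1.
  rewrite /z mulrC ler_pdivrMr// mulrDr mulr1 expr2 mulrA mulVf ?mul1r ?gt_eqF//.
  by rewrite lerDr invr_ge0.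
have z1 : z <= 1 by rewrite (le_trans zk)// invf_le1.
case: m m2 => [//|[//|l]] _ /=; rewrite exprS.
by rewrite (le_trans _ zk)// -[leRHS]mulr1 ler_wpM2l// exprn_ile1.
Qed.

Theorem integral_divergence0 :
  (\int[lebesgue_tuple m]_t (K (row_of_tuple t))%:E = 0)%E.
Proof.
have mK := measurable_row cK.
pose f (k : nat) : m.-tuple RT -> \bar R :=
  (EFin \o (K \o @row_of_tuple R m)) \_ (box 0 k.+1%:R).
have wi : (lebesgue_tuple m).-integrable setT (fun t => (C * cauchy_weight t)%:E).
  have := integrableZl measurableT C (@integrable_cauchy_weight R m).
  by [].
have dom (t : m.-tuple RT) : `|K (row_of_tuple t)| <= C * cauchy_weight t.
  by rewrite (le_trans (KC _))// ler_wpM2l// weight_le_cauchy.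
have [] := @dominated_convergence _ _ R (lebesgue_tuple m) setT measurableT f
  (EFin \o (K \o @row_of_tuple R m)) (fun t => (C * cauchy_weight t)%:E).
- move=> k; apply/(measurable_restrictT _ _).1; first exact: measurable_box.
  by apply: measurable_funTS; apply/measurable_EFinP.
- exact/measurable_EFinP.
- apply: aeW => t _.
  pose B := \sum_i `|tnth t i : R|.
  (* For fixed [t] the truncations are eventually constant: the cube contains [t] as soon as k + 1
     exceeds the sum [B] of the absolute values of its coordinates. *)
  apply: cvg_near_cst; exists (Num.truncn B) => // k /= kB.
  rewrite /f patchE mem_set// => i; rewrite mxE subr0.
  have tB : `|tnth t i : R| <= B by rewrite /B (bigD1 i)//= lerDl sumr_ge0.
  rewrite (le_trans tB)// (le_trans (ltW (truncnS_gt B)))// ler_nat ltnS.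
  exact: kB.
- exact: wi.
- apply: aeW => t k _; rewrite /f patchE; case: ifP => _.
    by rewrite lee_fin; exact: dom.
  by rewrite abse0 lee_fin (le_trans _ (dom t)).
move=> iK _ cv.
have fk k : (\int[lebesgue_tuple m]_t f k t)%E =
  (\int[lebesgue_tuple m]_(t in box 0 k.+1%:R) K (row_of_tuple t))%:E.
  rewrite /Rintegral fineK; first by rewrite [RHS]integral_mkcond.
  apply: integrable_fin_num; first exact: measurable_box.
  apply: box_integrable => //; exact: bounded_box.
have c0 : (fun k => (\int[lebesgue_tuple m]_t f k t)%E) @ \oo --> 0%E.
  have -> : (fun k => (\int[lebesgue_tuple m]_t f k t)%E) = EFin \o
    (fun k => \int[lebesgue_tuple m]_(t in box 0 k.+1%:R) K (row_of_tuple t)).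
    by apply/funext => k; rewrite fk.
  apply: cvg_EFin; first by apply: nearW => k.
  pose A := m%:R * (2 * (C * 2 ^+ m.-1)).
  apply/cvgr0Pnorm_le => eps eps0.
  have A0 : 0 <= A by rewrite !mulr_ge0// exprn_ge0.
  exists (Num.truncn (A / eps)) => // k /= kA.
  have k0 : 0 < k.+1%:R :> R by rewrite ltr0n.
  rewrite (le_trans (box_bdry k0))//.
  apply: (@le_trans _ _ (A / k.+1%:R)).
    by rewrite /A -mulrA ler_wpM2l// bdry_le.
  rewrite ler_pdivrMr// mulrC -ler_pdivrMr//.
  by rewrite (le_trans (ltW (truncnS_gt _)))// ler_nat ltnS.
exact: cvg_unique cv c0.
Qed.

End DivergenceZero.

Local Opaque derive.

(** * The divergence identity in a conformal chart *)

Section ConformalChristoffel.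
Context {R : realType} {n p : nat}.
Notation e i := (delta_mx 0 i : 'rV[R]_n).
Variables (Om : set 'rV[R]_n) (F : 'rV[R]_n -> 'rV[R]_p) (r : 'rV[R]_n -> R).
Hypotheses (oOm : open Om) (kF : Ck 2 Om F) (kr : Ck 0 Om r)
  (FF : forall y i j, Om y -> dot ('D_(e i) F y) ('D_(e j) F y) = (i == j)%:R * r y).
Variables (y : 'rV[R]_n) (Oy : Om y).

Let G l i j := dot ('D_(e l) F y) ('D_(e i) ('D_(e j) F) y).

Let dF i : differentiable ('D_(e i) F) y.
Proof. exact: Ck_diff (Ck_derive (e i) kF) Oy. Qed.

Let Gsym l i j : G l i j = G l j i.
Proof.
exact: (congr1 (dot ('D_(e l) F y)) (derive_sym_row (e i) (e j) oOm kF Oy)).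
Qed.

Let GE l i j : G l i j + G j i l = (l == j)%:R * 'D_(e i) r y.
Proof.
transitivity ('D_(e i) (fun z => dot ('D_(e l) F z) ('D_(e j) F z)) y).
  by rewrite (derive_dot _ (dF l) (dF j)) /G [in RHS]addrC [X in _ = _ + X]dot_sym.
transitivity ('D_(e i) (fun z => (l == j)%:R * r z) y).
  by apply: (derive_ext _ oOm Oy) => z Oz; exact: FF.
exact: (derive_scalec (l == j)%:R _ (Ck_diff kr Oy)).
Qed.

(** Koszul's argument: differentiating the inner products of coordinate vectors gives three linear
    equations between the symbols [G], symmetric in their last two indices, and these are solved for
    one symbol. It serves both the immersion and the stereographic chart. *)
Lemma conformal_christoffel l i j : dot ('D_(e l) F y) ('D_(e i) ('D_(e j) F) y) =
  ((l == j)%:R * 'D_(e i) r y +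
  (l == i)%:R * 'D_(e j) r y - (i == j)%:R * 'D_(e l) r y) / 2.
Proof.
have alg (a b c d q w : R) : a + b = d -> a + c = q -> b + c = w -> a = (d + q - w) / 2.
  by move=> <- <- <-; field.
have h1 : G l i j + G j l i = (l == j)%:R * 'D_(e i) r y.
  by rewrite -(Gsym j i l); exact: GE.
have h2 : G l i j + G i l j = (l == i)%:R * 'D_(e j) r y.
  by rewrite (Gsym l i j) (Gsym i l j); exact: GE.
have h3 : G j l i + G i l j = (i == j)%:R * 'D_(e l) r y.
  by rewrite eq_sym; exact: GE.
exact: alg h1 h2 h3.
Qed.

End ConformalChristoffel.

Section ChartDivergence.
Context {R : realType} {n : nat}.
Notation V := 'rV[R]_n.
Notation pd i := (derive^~ (delta_mx 0 i)).
Variables (Om : set 'rV[R]_n) (F nu : 'rV[R]_n -> 'rV[R]_n.+1)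
  (r h t : 'rV[R]_n -> R) (x : 'rV[R]_n -> 'rV[R]_n).
Notation e i := (delta_mx 0 i : 'rV[R]_n).

Definition chart_sff (i j : 'I_n) (y : V) : R := dot (nu y) ('D_(e i) ('D_(e j) F) y).

Definition chart_field (i : 'I_n) (y : V) : R :=
  Num.sqrt (r y) ^+ (n - 2) * (\sum_j chart_sff i j y * x y 0 j - h y * r y * x y 0 i).

Hypotheses (n2 : (2 <= n)%N) (oOm : open Om)
  (kF : forall k, Ck k Om F) (knu : forall k, Ck k Om nu) (kr : forall k, Ck k Om r)
  (kh : forall k, Ck k Om h) (kx : forall k, Ck k Om x)
  (nn : forall y, Om y -> dot (nu y) (nu y) = 1)
  (nF : forall y i, Om y -> dot (nu y) ('D_(e i) F y) = 0)
  (FF : forall y i j, Om y -> dot ('D_(e i) F y) ('D_(e j) F y) = (i == j)%:R * r y)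
  (r0 : forall y, Om y -> 0 < r y)
  (trII : forall y, Om y -> \sum_i chart_sff i i y = n%:R * h y * r y)
  (xE : forall y i j, Om y -> 'D_(e i) x y 0 j + 'D_(e j) x y 0 i = (i == j)%:R * t y).

Let kx1 k j : Ck k Om (fun y => x y 0 j).
Proof. by move: j; apply/Ck_rowP. Qed.

Let kDF k i : Ck k Om ('D_(e i) F). Proof. exact: Ck_derive. Qed.
Let kDDF k i j : Ck k Om ('D_(e i) ('D_(e j) F)). Proof. exact: Ck_derive. Qed.

Let kB k i j : Ck k Om (chart_sff i j).
Proof. by apply: Ck_dot => //; exact: kDDF. Qed.

Let rho y := Num.sqrt (r y).
Let krho k : Ck k Om rho.
Proof. exact: Ck_sqrt. Qed.

Let V_ i y := \sum_j chart_sff i j y * x y 0 j - h y * r y * x y 0 i.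
Let kV k i : Ck k Om (V_ i).
Proof.
apply: Ck_minus => //.
  by apply: Ck_sum => // j _; apply: Ck_mul => //; exact: kB.
by apply: Ck_mul => //; apply: Ck_mul.
Qed.

Lemma Ck_chart_field k i : Ck k Om (chart_field i).
Proof. by apply: Ck_mul => //; [exact: Ck_exp|exact: kV]. Qed.

Section AtPoint.
Variables (y : V) (Oy : Om y).

Let dd k (W : normedModType R) (f : V -> W) : Ck k Om f -> differentiable f y.
Proof. by move=> kf; exact: Ck_diff kf Oy. Qed.

Let dF i : differentiable ('D_(e i) F) y. Proof. exact: dd (kDF 0 i). Qed.
Let ddF i j : differentiable ('D_(e i) ('D_(e j) F)) y. Proof. exact: dd (kDDF 0 i j). Qed.
Let dnu : differentiable nu y. Proof. exact: dd (knu 0). Qed.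

Let FFsym z i j : Om z -> 'D_(e i) ('D_(e j) F) z = 'D_(e j) ('D_(e i) F) z.
Proof. by move=> Oz; exact: derive_sym_row oOm (kF 2) Oz. Qed.

Let dnu_nu i : dot ('D_(e i) nu y) (nu y) = 0.
Proof.
have : 'D_(e i) (fun z => dot (nu z) (nu z)) y = 0.
  rewrite (derive_ext (G := fun=> (1 : R)) _ oOm Oy); first exact: derive_cst.
  by move=> z Oz; exact: nn.
rewrite (derive_dot _ dnu dnu) [X in _ + X]dot_sym => H.
have alg (a : R) : a + a = 0 -> a = 0 by lra.
exact: alg H.
Qed.

(** Weingarten's equation, obtained by differentiating <nu, d_l F> = 0. *)
Let dnu_F i l : dot ('D_(e i) nu y) ('D_(e l) F y) = - chart_sff i l y.
Proof.
have : 'D_(e i) (fun z => dot (nu z) ('D_(e l) F z)) y = 0.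
  rewrite (derive_ext (G := fun=> (0 : R)) _ oOm Oy); first exact: derive_cst.
  by move=> z Oz; exact: nF.
by rewrite (derive_dot _ dnu (dF l)) => /eqP; rewrite addr_eq0 => /eqP.
Qed.

Let Cc i j k := dot (nu y) ('D_(e i) ('D_(e j) ('D_(e k) F)) y).

Let Csym12 i j k : Cc i j k = Cc j i k.
Proof.
exact: (congr1 (dot (nu y)) (derive_sym_row (e i) (e j) oOm (kDF 2 k) Oy)).
Qed.

Let Csym23 i j k : Cc i j k = Cc i k j.
Proof.
exact: (congr1 (dot (nu y)) (derive_ext (e i) oOm Oy (fun z Oz => FFsym j k Oz))).
Qed.

(** Differentiating <nu, d_i d_j F> gives [Cc] plus <d_k nu, d_i d_j F>. In the frame of nu and the
    d_l F, the vector d_k nu has normal component 0 and tangential components -B_kl / r, while d_i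
    d_j F contributes the Christoffel symbols. *)
Let dBE k i j : 'D_(e k) (chart_sff i j) y = Cc k i j - (2 * r y)^-1 *
     ('D_(e i) r y * chart_sff k j y + 'D_(e j) r y * chart_sff k i y -
      (i == j)%:R * \sum_l chart_sff k l y * 'D_(e l) r y).
Proof.
have rn0 : r y != 0 by rewrite gt_eqF// r0.
have alg (a b p q w c u v z : R) : a = - c -> b = (p * u + q * v - w * z) / 2 ->
    (r y)^-1 * a * b = - (2 * r y)^-1 * (p * (u * c) + q * (v * c) - w * (c * z)).
  by move=> -> ->; field.
have -> : 'D_(e k) (chart_sff i j) y =
    Cc k i j + dot ('D_(e k) nu y) ('D_(e i) ('D_(e j) F) y).
  exact: etrans (derive_dot (e k) dnu (ddF i j)) (addrC _ _).
have II : dot ('D_(e k) nu y) ('D_(e i) ('D_(e j) F) y) = - (2 * r y)^-1 *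
     ('D_(e i) r y * chart_sff k j y + 'D_(e j) r y * chart_sff k i y -
      (i == j)%:R * \sum_l chart_sff k l y * 'D_(e l) r y).
  apply: etrans (frame_dot _ _ rn0 (nn Oy) (fun i => nF i Oy) (fun i j => FF i j Oy)) _.
  apply: etrans (congr2 +%R (etrans (congr1 (fun z => z * _) (dnu_nu k)) (mul0r _)) erefl) _.
  apply: etrans (add0r _) _.
  apply: etrans (eq_bigr _ (fun l _ => alg _ _ _ _ _ _ _ _ _ (dnu_F k l)
    (conformal_christoffel oOm (kF 2) (kr 0) FF Oy l i j))) _.
  exact: sum_kronecker2.
exact: etrans (congr1 (fun z => Cc k i j + z) II) (congr1 (fun z => Cc k i j + z) (mulNr _ _)).
Qed.

Lemma chart_divergence : \sum_i 'D_(e i) (chart_field i) y =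
  (n%:R - 1) * rho y ^+ n * \sum_i x y 0 i * 'D_(e i) h y.
Proof.
have rp := r0 Oy; have rn0 : r y != 0 by rewrite gt_eqF.
have rho0 : 0 < rho y by rewrite sqrtr_gt0.
have rho2 : rho y ^+ 2 = r y by rewrite sqr_sqrtr// ltW.
have drho : differentiable rho y by exact: dd (krho 0).
have DrhoE i : 'D_(e i) r y = 2 * rho y * 'D_(e i) rho y.
  rewrite -[2 * rho y]/(2%:R * rho y ^+ 2.-1) -derive_exp//.
  by apply: (derive_ext _ oOm Oy) => z Oz; rewrite sqr_sqrtr// ltW// r0.
pose P z := rho z ^+ (n - 2).
have dP : differentiable P y by apply: dd (Ck_exp (n - 2) oOm (krho 0)).
have PE : P y * r y = rho y ^+ n.
  by rewrite -rho2 -exprD subnK.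
have dPE i : 'D_(e i) P y = (n%:R - 2) * P y * 'D_(e i) r y / (2 * r y).
  (* For n = 2 the exponent [k] is 0; the truncated [k.-1] is then harmless because the factor k
     vanishes. *)
  have alg (k : nat) (a d : R) : 0 < a ->
      k%:R * a ^+ k.-1 * d = k%:R * a ^+ k * (2 * a * d) / (2 * a ^+ 2).
    by case: k => [|k] a0; [rewrite !mul0r|rewrite exprS /=; field; rewrite gt_eqF].
  apply: etrans (derive_exp (n - 2) (e i) drho) _.
  by rewrite DrhoE -rho2 -(natrB _ n2); exact: alg.
have dx1 j : differentiable (fun z => x z 0 j) y by exact: dd (kx1 0 j).
have dBij i j : differentiable (chart_sff i j) y by exact: dd (kB 0 i j).
have dh : differentiable h y by exact: dd (kh 0).
have dr : differentiable r y by exact: dd (kr 0).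
have dxE i j : 'D_(e i) (fun z => x z 0 j) y = 'D_(e i) x y 0 j.
  by rewrite derive_row//; exact: Ck_derivable (kx 0) Oy.
have dVE i : 'D_(e i) (V_ i) y = \sum_j ('D_(e i) (chart_sff i j) y * x y 0 j +
    chart_sff i j y * 'D_(e i) x y 0 j) -
  (('D_(e i) h y * r y + h y * 'D_(e i) r y) * x y 0 i + h y * r y * 'D_(e i) x y 0 i).
  have dsum : differentiable (fun z => \sum_j chart_sff i j z * x z 0 j) y.
    by apply: (@dd 0); apply: Ck_sum => // j _; apply: Ck_mul => //; exact: kB.
  have dhr : differentiable (fun z => h z * r z) y by exact: differentiableM.
  have dhrx : differentiable (fun z => h z * r z * x z 0 i) y by exact: differentiableM.
  rewrite /V_ (derive_sub _ dsum dhrx) derive_bigsum => [|j _]; last exact: differentiableM.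
  rewrite (derive_mul _ dhr (dx1 i)) (derive_mul _ dh dr) dxE; congr (_ - _).
  by apply: eq_bigr => j _; rewrite (derive_mul _ (dBij i j) (dx1 j)) dxE.
have -> : \sum_i 'D_(e i) (chart_field i) y = \sum_i ('D_(e i) P y * V_ i y + P y * 'D_(e i) (V_ i) y).
  apply: eq_bigr => i _; exact: (derive_mul _ dP (dd (kV 0 i))).
under eq_bigr do rewrite dVE.
rewrite -PE.
have trD j : \sum_i 'D_(e j) (chart_sff i i) y =
    n%:R * ('D_(e j) h y * r y + h y * 'D_(e j) r y).
  rewrite -derive_bigsum => [|i _]; last exact: dBij.
  rewrite -(derive_mul _ dh dr) -[RHS](derive_scalec n%:R _ (differentiableM dh dr)).
  by apply: (derive_ext _ oOm Oy) => z Oz; rewrite trII// /GRing.scale/= mulrA.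
exact: (@divergence_identity R n (fun i j => chart_sff i j y)
  (fun k i j => 'D_(e k) (chart_sff i j) y) Cc (fun i => 'D_(e i) r y)
  (fun i => 'D_(e i) h y) (fun i => x y 0 i) (fun i => 'D_(e i) P y)
  (fun i j => 'D_(e i) x y 0 j) (r y) (h y) (t y) (P y) rn0
  (fun i j => congr1 (dot (nu y)) (FFsym i j Oy)) Csym12 Csym23 dBE (trII Oy) trD
  (fun i j => xE i j Oy) dPE).
Qed.

End AtPoint.
End ChartDivergence.

Lemma derive_cadd (R : realType) (V W : normedModType R) (F : V -> W) c x v :
  differentiable F x -> 'D_v (fun y => c + F y) x = 'D_v F x.
Proof.
move=> dF; rewrite (derive_add v (differentiable_cst c x) dF).
by rewrite [X in X + _]derive_cst add0r.
Qed.

(** * Stereographic projection and the sphere *)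

Section Stereo.
Context {R : realType} {n : nat}.
Implicit Types u v y : 'rV[R]_n.
Notation e i := (delta_mx 0 i : 'rV[R]_n).
Local Notation sg := (@stereo R n).

(* [cf] is the conformal factor of [stereo]: sigma^* g = cf^2 |dy|^2. *)
Definition qd y : R := 1 + dot y y.
Definition cf y : R := 2 / qd y.

Lemma qd_gt0 y : 0 < qd y.
Proof. by rewrite ltr_pwDl// dot_ge0. Qed.

Lemma cf_gt0 y : 0 < cf y.
Proof. by rewrite divr_gt0// qd_gt0. Qed.

Definition lift_vec (a : R) y : 'rV[R]_n.+1 := row_mx a%:M y.

Lemma lift_vec0 a y : lift_vec a y 0 ord0 = a.
Proof.
rewrite [X in lift_vec _ _ _ X](_ : _ = lshift n (ord0 : 'I_1)); last exact/val_inj.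
by apply: etrans (@row_mxEl _ 1 1 n a%:M y 0 ord0) _; rewrite mxE eqxx mulr1n.
Qed.

Lemma lift_vecS a y j : lift_vec a y 0 (lift ord0 j) = y 0 j.
Proof.
rewrite [X in lift_vec _ _ _ X](_ : _ = rshift 1 j); last exact/val_inj.
exact: (@row_mxEr _ 1 1 n a%:M y 0 j).
Qed.

Lemma dot_lift a b u v : dot (lift_vec a u) (lift_vec b v) = a * b + dot u v.
Proof.
rewrite /dot big_ord_recl !lift_vec0; congr (_ + _).
by apply: eq_bigr => i _; rewrite !lift_vecS.
Qed.

Lemma scale_entry m (a : R) (u : 'rV[R]_m) j : (a *: u) 0 j = a * u 0 j.
Proof. by rewrite mxE. Qed.

Lemma add_entry m (u v : 'rV[R]_m) j : (u + v) 0 j = u 0 j + v 0 j.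
Proof. by rewrite mxE. Qed.

Lemma stereo_lift y : sg y = (qd y)^-1 *: lift_vec (dot y y - 1) (2 *: y).
Proof. by []. Qed.

Lemma stereo0 y : sg y 0 ord0 = 1 - cf y.
Proof.
have q0 : qd y != 0 by rewrite gt_eqF// qd_gt0.
have qE : dot y y - 1 = qd y - 2 by rewrite /qd; ring.
by rewrite stereo_lift scale_entry lift_vec0 qE /cf; field.
Qed.

Lemma stereoS y j : sg y 0 (lift ord0 j) = cf y * y 0 j.
Proof. by rewrite stereo_lift scale_entry lift_vecS scale_entry /cf; ring. Qed.

(** Parametrises the line from the pole (1, 0) through (0, y); the chart point sits at parameter
    [cf y]. Derivatives are easier to take in this form. *)
Lemma stereoE y : sg y = lift_vec 1 0 + cf y *: lift_vec (-1) y.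
Proof.
apply/rowP => j; rewrite [RHS]add_entry [X in _ = _ + X]scale_entry.
case: (unliftP ord0 j) => [k ->|->].
  by rewrite stereoS !lift_vecS mxE add0r.
by rewrite stereo0 !lift_vec0 mulrN1.
Qed.

Lemma sphere_stereo y : sphere (sg y).
Proof.
have q0 : qd y != 0 by rewrite gt_eqF// qd_gt0.
have PP : dot (lift_vec (-1) y) (lift_vec (-1) y) = qd y by rewrite dot_lift mulrNN mul1r.
have eP : dot (lift_vec 1 0) (lift_vec (-1) y) = -1 by rewrite dot_lift dot0l mul1r addr0.
have ee : dot (lift_vec 1 (0 : 'rV[R]_n)) (lift_vec 1 0) = 1 by rewrite dot_lift dot0l mul1r addr0.
rewrite /sphere/= stereoE dotDl !dotDr !dotZl !dotZr PP ee eP dot_sym eP /cf; by field.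
Qed.

Lemma stereo_surj (p : 'rV[R]_n.+1) : sphere p -> p 0 ord0 != 1 -> exists y, sg y = p.
Proof.
move=> sp p1; have d0 : 1 - p 0 ord0 != 0 by rewrite subr_eq0 eq_sym.
pose y : 'rV[R]_n := \row_j ((1 - p 0 ord0)^-1 * p 0 (lift ord0 j)); exists y.
have yy : dot y y = (1 - p 0 ord0)^-1 ^+ 2 * (1 - p 0 ord0 ^+ 2).
  have -> : 1 - p 0 ord0 ^+ 2 = \sum_j p 0 (lift ord0 j) * p 0 (lift ord0 j).
    by have := sp; rewrite /sphere/= /dot big_ord_recl => <-; rewrite expr2 addrAC subrr add0r.
  by rewrite mulr_sumr; apply: eq_bigr => j _; rewrite !mxE; ring.
have qy : qd y = 2 / (1 - p 0 ord0) by rewrite /qd yy; field.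
have cy : cf y = 1 - p 0 ord0 by rewrite /cf qy; field.
apply/rowP => j; case: (unliftP ord0 j) => [k ->|->].
  by rewrite stereoS cy mxE mulrA divff// mul1r.
by rewrite stereo0 cy opprB addrC subrK.
Qed.

Lemma Ck_qd k : Ck k [set: 'rV[R]_n] qd.
Proof.
apply: Ck_add; [exact: openT|exact: Ck_cst|].
by apply: Ck_dot; [exact: openT|apply: Ck_id; exact: openT|apply: Ck_id; exact: openT].
Qed.

Lemma Ck_cf k : Ck k [set: 'rV[R]_n] cf.
Proof.
apply: Ck_mul; [exact: openT|exact: Ck_cst|].
apply: Ck_inv; [exact: openT| |exact: Ck_qd].
by move=> y _; rewrite gt_eqF// qd_gt0.
Qed.

Lemma Ck_lift k a : Ck k [set: 'rV[R]_n] (lift_vec a).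
Proof.
apply/Ck_rowP; first exact: openT.
move=> j; case: (unliftP ord0 j) => [i ->|->].
  by under eq_fun do rewrite lift_vecS; exact: Ck_coord.
by under eq_fun do rewrite lift_vec0; exact: Ck_cst.
Qed.

Lemma Ck_stereo k : Ck k [set: 'rV[R]_n] sg.
Proof.
have -> : sg = fun y => lift_vec 1 0 + cf y *: lift_vec (-1) y.
  by apply/funext => y; exact: stereoE.
apply: Ck_add; [exact: openT|exact: Ck_cst|].
by apply: Ck_scale; [exact: openT|exact: Ck_cf|exact: Ck_lift].
Qed.

Lemma derive_coord (y v : 'rV[R]_n) j : 'D_v (fun y : 'rV[R]_n => y 0 j) y = v 0 j.
Proof.
have dy : derivable (fun y : 'rV[R]_n => y) y v by exact: derivable_id.
have E : 'D_v (fun y : 'rV[R]_n => y) y = v by exact: derive_id.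
by rewrite -(derive_row j dy) E.
Qed.

Lemma derive_lift a v y : 'D_v (lift_vec a) y = lift_vec 0 v.
Proof.
have dl : differentiable (lift_vec a) y by exact: Ck_diff (Ck_lift 0 a) I.
apply/rowP => j; rewrite (derive_row _ (diff_derivable dl)).
case: (unliftP ord0 j) => [i ->|->].
  rewrite lift_vecS -(derive_coord y v i).
  by congr ('D_v _ y); apply/funext => z; rewrite lift_vecS.
rewrite lift_vec0.
have -> : (fun z => lift_vec a z 0 ord0) = fun=> a by apply/funext => z; rewrite lift_vec0.
exact: derive_cst.
Qed.

Lemma derive_cf v y : 'D_v cf y = - (4 * dot y v / qd y ^+ 2).
Proof.
have did : differentiable (fun z : 'rV[R]_n => z) y by [].
have dq : differentiable qd y by exact: Ck_diff (Ck_qd 0) I.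
have q0 : qd y != 0 by rewrite gt_eqF// qd_gt0.
have Dq : 'D_v qd y = 2 * dot y v.
  have dd : differentiable (fun z : 'rV[R]_n => dot z z) y.
    apply: (Ck_diff (k := 0) (U := setT)) => //.
    by apply: Ck_dot; [exact: openT|apply: Ck_id; exact: openT|apply: Ck_id; exact: openT].
  rewrite /qd derive_cadd// derive_dot//.
  have -> : 'D_v (fun z : 'rV[R]_n => z) y = v by exact: derive_id.
  by rewrite [dot v y]dot_sym -mulr2n mulr_natl.
have dqV : differentiable (fun z => (qd z)^-1) y by exact: differentiableV.
have -> : 'D_v cf y = 2 * 'D_v (fun z => (qd z)^-1) y.
  exact: (derive_scalec 2 v dqV).
by rewrite derive_inv// Dq; field.
Qed.

Lemma derive_stereo v y : 'D_v sg y =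
  - (4 * dot y v / qd y ^+ 2) *: lift_vec (-1) y + cf y *: lift_vec 0 v.
Proof.
have dl : differentiable (lift_vec (-1)) y by exact: Ck_diff (Ck_lift 0 (-1)) I.
have dc : differentiable cf y by exact: Ck_diff (Ck_cf 0) I.
have ds : differentiable (fun y => cf y *: lift_vec (-1) y) y.
  by apply: (Ck_diff (k := 0) (U := setT)) => //; apply: Ck_scale; [exact: openT|exact: Ck_cf|exact: Ck_lift].
have -> : sg = fun y => lift_vec 1 0 + cf y *: lift_vec (-1) y.
  by apply/funext => z; exact: stereoE.
by rewrite derive_cadd// derive_scale// derive_cf derive_lift.
Qed.

Lemma dot_derive_stereo u v y : dot ('D_u sg y) ('D_v sg y) = cf y ^+ 2 * dot u v.
Proof.
have q0 : qd y != 0 by rewrite gt_eqF// qd_gt0.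
have PP : dot (lift_vec (-1) y) (lift_vec (-1) y) = qd y by rewrite dot_lift mulrNN mul1r.
have Pl w : dot (lift_vec (-1) y) (lift_vec 0 w) = dot y w by rewrite dot_lift mulr0 add0r.
have lP w : dot (lift_vec 0 w) (lift_vec (-1) y) = dot y w by rewrite dot_sym Pl.
have ll : dot (lift_vec 0 u) (lift_vec 0 v) = dot u v by rewrite dot_lift mulr0 add0r.
rewrite !derive_stereo dotDl !dotDr !dotZl !dotZr PP !Pl !lP ll /cf; by field.
Qed.

Lemma tangent_derive_stereo v y : tangent (sg y) ('D_v sg y).
Proof.
have q0 : qd y != 0 by rewrite gt_eqF// qd_gt0.
have PP : dot (lift_vec (-1) y) (lift_vec (-1) y) = qd y by rewrite dot_lift mulrNN mul1r.
have Pl : dot (lift_vec (-1) y) (lift_vec 0 v) = dot y v by rewrite dot_lift mulr0 add0r.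
have eP : dot (lift_vec 1 0) (lift_vec (-1) y) = -1 by rewrite dot_lift dot0l mul1r addr0.
have el : dot (lift_vec 1 0) (lift_vec 0 v) = 0 by rewrite dot_lift dot0l mulr0 addr0.
rewrite /tangent derive_stereo stereoE dotDl !dotDr !dotZl !dotZr PP Pl eP el /cf; by field.
Qed.

Definition sv i y : 'rV[R]_n.+1 := 'D_(e i) sg y.

Lemma dot_delta (i j : 'I_n) : dot (e i) (e j) = (i == j)%:R.
Proof.
rewrite /dot (bigD1 i)//= big1 ?addr0 => [|k ki]; first by rewrite !mxE !eqxx mul1r.
by rewrite !mxE eqxx (negbTE ki) mul0r.
Qed.

Lemma dot_sv i j y : dot (sv i y) (sv j y) = (i == j)%:R * cf y ^+ 2.
Proof. by rewrite dot_derive_stereo dot_delta mulrC. Qed.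

Lemma tangent_sv i y : tangent (sg y) (sv i y).
Proof. exact: tangent_derive_stereo. Qed.

Lemma cf2_neq0 y : cf y ^+ 2 != 0.
Proof. by rewrite expf_neq0// gt_eqF// cf_gt0. Qed.

(** On the unit sphere the position vector is itself a unit normal. *)
Lemma stereo_frame y a : a = dot a (sg y) *: sg y +
  \sum_l ((cf y ^+ 2)^-1 * dot a (sv l y)) *: sv l y.
Proof.
apply: frame_expansion; first exact: cf2_neq0.
- exact: sphere_stereo.
- by move=> i; exact: tangent_sv.
- by move=> i j; exact: dot_sv.
Qed.

Lemma tangent_stereo_frame y a : tangent (sg y) a ->
  a = \sum_l ((cf y ^+ 2)^-1 * dot a (sv l y)) *: sv l y.
Proof.
move=> ta; rewrite {1}(stereo_frame y a) [dot a (sg y)]dot_sym.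
by rewrite (ta : dot _ _ = 0) scale0r add0r.
Qed.

Lemma Ck_sv k i : Ck k [set: 'rV[R]_n] (sv i).
Proof. exact: (Ck_derive (e i) (Ck_stereo k.+1)). Qed.

End Stereo.

(** * Calculus on the sphere through radial extensions *)

Section Sphere.
Context {R : realType} {n : nat}.
Implicit Types p u v : 'rV[R]_n.+1.
Implicit Types W : normedModType R.
Local Notation sg := (@stereo R n).

Lemma sphere_neq0 p : sphere p -> p != 0.
Proof.
move=> sp; apply/eqP => p0; have := sp; rewrite /sphere/= p0 dot0l => /esym/eqP.
by rewrite oner_eq0.
Qed.

Lemma open_rV_neq0 : open [set p : 'rV[R]_n.+1 | p != 0].
Proof.
have -> : [set p : 'rV[R]_n.+1 | p != 0] = (fun p => dot p p) @^-1` [set s | s != 0].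
  by apply/seteqP; split=> p /=; rewrite dot_eq0.
apply: open_comp; last exact: open_neq0.
move=> p _; apply: (Ck_continuous (k := 0) (U := setT)) => //.
by apply: Ck_dot; [exact: openT|apply: Ck_id; exact: openT|apply: Ck_id; exact: openT].
Qed.

Lemma radial_sphere T (g : 'rV[R]_n.+1 -> T) p : sphere p -> radial g p = g p.
Proof. by move=> sp; rewrite /radial /enorm (sp : dot p p = 1) sqrtr1 invr1 scale1r. Qed.

(** For a [sphere_smooth] map only the radial extension is known to be differentiable on an open
    set, so the chain rule is applied to it. *)
Lemma comp_radial T (g : 'rV[R]_n.+1 -> T) : g \o sg = radial g \o sg.
Proof. by apply/funext => y; rewrite /= radial_sphere//; exact: sphere_stereo. Qed.

Lemma stereo_neq0 y : sg y != 0.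
Proof. exact/sphere_neq0/sphere_stereo. Qed.

Lemma smooth_Ck k W (g : 'rV[R]_n.+1 -> W) : sphere_smooth g ->
  Ck k [set p | p != 0] (radial g).
Proof. by move=> /smooth_onP. Qed.

Lemma smooth_diff W (g : 'rV[R]_n.+1 -> W) p : sphere_smooth g -> sphere p ->
  differentiable (radial g) p.
Proof. by move=> sg sp; apply: Ck_diff (smooth_Ck 0 sg) _; exact: sphere_neq0. Qed.

Lemma Ck_comp_stereo k (G : 'rV[R]_n.+1 -> R) :
  Ck k [set p | p != 0] G -> Ck k [set: 'rV[R]_n] (G \o sg).
Proof.
move=> kG.
have sU (y : 'rV[R]_n) : setT y -> [set p : 'rV[R]_n.+1 | p != 0] (sg y).
  by move=> _; exact: stereo_neq0.
exact: (Ck_comp openT sU (Ck_stereo k) kG).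
Qed.

Lemma Ck_comp_stereo_row k m (G : 'rV[R]_n.+1 -> 'rV[R]_m) :
  Ck k [set p | p != 0] G -> Ck k [set: 'rV[R]_n] (G \o sg).
Proof.
move=> /(Ck_rowP _ _ open_rV_neq0) kG; apply/Ck_rowP; first exact: openT.
by move=> j; exact: Ck_comp_stereo (kG j).
Qed.

Lemma derive_comp_stereo W (g : 'rV[R]_n.+1 -> W) (v y : 'rV[R]_n) : sphere_smooth g ->
  'D_v (g \o sg) y = sdiff g (sg y) ('D_v sg y).
Proof.
move=> sm; rewrite comp_radial; apply: derive_comp.
  exact: Ck_diff (Ck_stereo 0) I.
exact: smooth_diff sm (sphere_stereo y).
Qed.

Lemma radial_scale T (g : 'rV[R]_n.+1 -> T) (a : R) p : 0 < a ->
  radial g (a *: p) = radial g p.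
Proof.
move=> a0; rewrite /radial /enorm dotZl dotZr mulrA -expr2 sqrtrM ?sqr_ge0//.
rewrite sqrtr_sqr gtr0_norm// scalerA invfM mulrAC mulVf ?mul1r//.
by rewrite gt_eqF.
Qed.

Local Transparent derive.
(** [radial g] is constant on rays, and for |h| < 1 the point (1 + h) p lies on the ray of [p]. *)
Lemma sdiff_radial W (g : 'rV[R]_n.+1 -> W) p : sdiff g p p = 0.
Proof.
rewrite /sdiff /derive; apply: cvg_lim => //.
apply: (@cvg_trans _ ((fun h : R => (0 : W)) @ 0^')); last exact: cvg_cst.
apply: near_eq_cvg; near=> h.
have h1 : 0 < h + 1.
  have : `|h| < 1 by near: h; exact: dnbhs0_lt.
  by rewrite ltr_norml => /andP[]; lra.
by rewrite /= -[X in _ *: p + X]scale1r -scalerDl radial_scale// subrr scaler0.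
Unshelve. all: by end_near. Qed.

Local Opaque derive.

Lemma sdiffD W (g : 'rV[R]_n.+1 -> W) p u v : sphere_smooth g -> sphere p ->
  sdiff g p (u + v) = sdiff g p u + sdiff g p v.
Proof. by move=> sm sp; apply: derive_dirD; exact: smooth_diff. Qed.

Lemma sdiffZ W (g : 'rV[R]_n.+1 -> W) p a v : sphere_smooth g -> sphere p ->
  sdiff g p (a *: v) = a *: sdiff g p v.
Proof. by move=> sm sp; apply: derive_dirZ; exact: smooth_diff. Qed.

Lemma sdiff_sum W (g : 'rV[R]_n.+1 -> W) p (I : Type) (s : seq I)
    (a : I -> R) (u : I -> 'rV[R]_n.+1) : sphere_smooth g -> sphere p ->
  sdiff g p (\sum_(i <- s) a i *: u i) = \sum_(i <- s) a i *: sdiff g p (u i).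
Proof.
move=> sm sp; have d := smooth_diff sm sp.
apply: etrans (derive_dir_sum s (fun i => a i *: u i) d) _.
by apply: eq_bigr => i _; exact: derive_dirZ.
Qed.

Lemma sphere_coord p i : sphere p -> `|p 0 i| <= 1.
Proof. by move=> sp; apply: entry_le_of_dot; rewrite // (sp : dot p p = 1) expr1n. Qed.

Lemma compact_sphere : compact (@sphere R n).
Proof.
apply: bounded_closed_compact.
  exists 1; split; first exact: num_real.
  move=> M M1 p sp; rewrite /Num.norm/= mx_normrE; apply: bigmax_le => [|[a i] _].
    exact: ltW (lt_trans ltr01 M1).
  by rewrite /= ord1; exact: le_trans (sphere_coord i sp) (ltW M1).
have -> : @sphere R n = (fun p => dot p p) @^-1` [set 1] by [].
apply: closed_comp; last exact: closed_eq.
move=> p _; apply: (Ck_continuous (k := 0) (U := setT)) => //.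
by apply: Ck_dot; [exact: openT|apply: Ck_id; exact: openT|apply: Ck_id; exact: openT].
Qed.

Lemma sphere_bounded (g : 'rV[R]_n.+1 -> R) :
  (forall p, sphere p -> {for p, continuous g}) ->
  exists2 M, 0 <= M & forall p, sphere p -> `|g p| <= M.
Proof.
move=> cg; have cs : {within sphere, continuous g}.
  by apply: continuous_in_subspaceT => p; rewrite inE; exact: cg.
have /compact_bounded[M [_ HM]] := continuous_compact cs compact_sphere.
exists (`|M| + 1) => [|p sp]; first by rewrite addr_ge0.
apply: HM; last by exists p.
by rewrite (le_lt_trans (ler_norm M))// ltrDl.
Qed.

Lemma sphere_bounded_fam (I : finType) (g : I -> 'rV[R]_n.+1 -> R) :
  (forall i p, sphere p -> {for p, continuous (g i)}) ->
  exists2 M, 0 <= M & forall i p, sphere p -> `|g i p| <= M.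
Proof.
move=> cg; have H i : exists M, 0 <= M /\ forall p, sphere p -> `|g i p| <= M.
  by have [M M0 HM] := sphere_bounded (cg i); exists M.
have [M HM] := choice H; exists (\sum_i M i).
  by apply: sumr_ge0 => i _; have [] := HM i.
move=> i p sp; have [_ /(_ _ sp) h] := HM i.
rewrite (le_trans h)// (bigD1 i)//= lerDl; apply: sumr_ge0 => j _.
by have [] := HM j.
Qed.

End Sphere.

(** * The immersion and the conformal field in the chart *)

Section ConformalImmersionChart.
Context {R : realType} {n : nat}.
Notation e i := (delta_mx 0 i : 'rV[R]_n).
Local Notation sg := (@stereo R n).
Variables (hn : (2 <= n)%N) (f : 'rV[R]_n.+1 -> 'rV[R]_n.+1).
Hypotheses (hf : branched_conformal_immersion f).

Definition chart_map (y : 'rV[R]_n) : 'rV[R]_n.+1 := f (sg y).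
Local Notation F := chart_map.

Definition regular_chart : set 'rV[R]_n := [set y | immersed_at f (sg y)].
Local Notation Om := regular_chart.

Definition gram y : 'M[R]_n := \matrix_(i, j) dot ('D_(e i) F y) ('D_(e j) F y).

Let smf : sphere_smooth f. Proof. by case: hf. Qed.

Lemma regular_chartP y : Om y <-> regular_set f (sg y).
Proof.
split=> [Oy|[_ H]]; first by split; [exact: sphere_stereo|case].
by apply: contrapT => nO; apply: H; split=> //; exact: sphere_stereo.
Qed.

Lemma Ck_chart_map k : Ck k [set: 'rV[R]_n] F.
Proof.
have -> : F = radial f \o sg by exact: comp_radial.
by apply: Ck_comp_stereo_row; exact: smooth_Ck.
Qed.

Lemma derive_chart_map v y : 'D_v F y = sdiff f (sg y) ('D_v sg y).
Proof. exact: derive_comp_stereo. Qed.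

Lemma tangent_zero_of_coords y u : tangent (sg y) u -> (forall l, dot u (sv l y) = 0) -> u = 0.
Proof.
move=> tu H; rewrite (tangent_stereo_frame tu) big1// => l _.
by rewrite H mulr0 scale0r.
Qed.

(** The coordinates, in the frame [sv], of a nonzero tangent vector killed by df form a nonzero
    vector in the kernel of the Gram matrix. *)
Lemma det_gram_sing y : ~ Om y -> \det (gram y) = 0.
Proof.
move=> nO; have [u [tu [su u0]]] : exists u, tangent (sg y) u /\ sdiff f (sg y) u = 0 /\ u <> 0.
  apply: contrapT => H; apply: nO => u tu su; apply: contrapT => u0.
  by apply: H; exists u.
apply/eqP/det0P; pose c := \row_l ((cf y ^+ 2)^-1 * dot u (sv l y)) : 'rV[R]_n; exists c.
  apply/eqP => c0; apply: u0; apply: (tangent_zero_of_coords tu) => l.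
  have := congr1 (fun v : 'rV[R]_n => v 0 l) c0; rewrite !mxE => /eqP.
  by rewrite mulf_eq0 invr_eq0 (negbTE (cf2_neq0 y)) => /eqP.
have E : \sum_l c 0 l *: 'D_(e l) F y = 0.
  apply: etrans su; rewrite [in RHS](tangent_stereo_frame tu).
  rewrite (sdiff_sum _ _ _ smf (sphere_stereo y)).
  by apply: eq_bigr => l _; rewrite mxE derive_chart_map.
apply/rowP => j; transitivity (dot (\sum_l c 0 l *: 'D_(e l) F y) ('D_(e j) F y)).
  rewrite mxE dot_suml; apply: eq_bigr => l _.
  by rewrite dotZl; congr (_ * _); rewrite mxE.
by rewrite E dot0l mxE.
Qed.

Lemma regular_of_det y : \det (gram y) != 0 -> Om y.
Proof. by move=> d0; apply: contrapT => /det_gram_sing /eqP; rewrite (negbTE d0). Qed.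

Let i0 : 'I_n := Ordinal (leq_trans (isT : (0 < 2)%N) hn).
(** No regularity is assumed of [lambda]. The squared length of one coordinate vector is smooth on
    the whole chart and is the conformal factor at every regular point. *)
Definition cfactor y : R := dot ('D_(e i0) F y) ('D_(e i0) F y).
Local Notation r := cfactor.

Lemma chart_conformal y : Om y -> exists2 a : R, 0 < a &
  forall i j, dot ('D_(e i) F y) ('D_(e j) F y) = (i == j)%:R * a.
Proof.
move=> /regular_chartP Oy; have [_ [_ [lam H]] _] := hf.
have [l0 lE] := H _ Oy; exists (lam (sg y) ^+ 2 * cf y ^+ 2).
  by rewrite mulr_gt0// exprn_gt0// cf_gt0.
move=> i j; rewrite !derive_chart_map.
have := lE _ _ (tangent_sv i y) (tangent_sv j y).
by rewrite /pullback_metric dot_sv mulrCA => <-.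
Qed.

Lemma gram_regular y i j : Om y ->
  dot ('D_(e i) F y) ('D_(e j) F y) = (i == j)%:R * r y.
Proof.
move=> /chart_conformal[a a0 H]; apply: etrans (H i j) _.
by rewrite /cfactor (H i0 i0) eqxx mul1r.
Qed.

Lemma cfactor_gt0 y : Om y -> 0 < r y.
Proof. by move=> /chart_conformal[a a0 H]; rewrite /cfactor (H i0 i0) eqxx mul1r. Qed.

Lemma det_gram_regular y : Om y -> \det (gram y) = r y ^+ n.
Proof.
move=> Oy; have -> : gram y = (r y)%:M.
  apply/matrixP => i j; rewrite !mxE gram_regular//.
  by case: eqP => _; rewrite ?mul1r ?mul0r.
exact: det_scalar.
Qed.

Lemma volume_densityE y : volume_density f y = Num.sqrt (\det (gram y)).
Proof. by []. Qed.

Lemma volume_density_regular y : Om y -> volume_density f y = Num.sqrt (r y) ^+ n.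
Proof.
move=> Oy; have r0 := cfactor_gt0 Oy; rewrite volume_densityE det_gram_regular//.
rewrite -[in LHS](sqr_sqrtr (ltW r0)) -exprM mulnC exprM sqrtr_sqr ger0_norm//.
Qed.

Lemma volume_density_sing y : ~ Om y -> volume_density f y = 0.
Proof. by move=> nO; rewrite volume_densityE det_gram_sing// sqrtr0. Qed.

Lemma Ck_dF k i : Ck k [set: 'rV[R]_n] ('D_(e i) F).
Proof. exact: Ck_derive (Ck_chart_map k.+1). Qed.

Lemma Ck_gram k i j : Ck k [set: 'rV[R]_n] (fun y => dot ('D_(e i) F y) ('D_(e j) F y)).
Proof. by apply: Ck_dot; [exact: openT|exact: Ck_dF|exact: Ck_dF]. Qed.

Lemma Ck_prod k (V : normedModType R) (U : set V) (I : Type) (s : seq I) (g : I -> V -> R) :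
  open U -> (forall i, Ck k U (g i)) -> Ck k U (fun x => \prod_(i <- s) g i x).
Proof.
move=> oU kg; elim: s => [|i s IH].
  have -> : (fun x => \prod_(j <- [::]) g j x) = fun=> 1.
    by apply/funext => x; rewrite big_nil.
  exact: Ck_cst.
have -> : (fun x => \prod_(j <- i :: s) g j x) = fun x => g i x * \prod_(j <- s) g j x.
  by apply/funext => x; rewrite big_cons.
by apply: Ck_mul => //; exact: kg.
Qed.

Lemma Ck_det_gram k : Ck k [set: 'rV[R]_n] (fun y => \det (gram y)).
Proof.
rewrite /determinant; apply: Ck_sum => [|s _]; first exact: openT.
apply: Ck_mul; [exact: openT|exact: Ck_cst|].
apply: Ck_prod => [|i]; first exact: openT.
by under eq_fun do rewrite mxE; exact: Ck_gram.
Qed.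

(** Regularity is the nonvanishing of a continuous function, the Gram determinant. *)
Lemma open_regular_chart : open Om.
Proof.
have -> : Om = (fun y => \det (gram y)) @^-1` [set s | s != 0].
  apply/seteqP; split=> y /=; last exact: regular_of_det.
  by move=> Oy; rewrite det_gram_regular// expf_neq0// gt_eqF// cfactor_gt0.
apply: open_comp; last exact: open_neq0.
by move=> y _; exact: Ck_continuous (Ck_det_gram 0) I.
Qed.

Lemma continuous_volume_density : continuous (volume_density f).
Proof.
move=> y; apply: (@continuous_comp _ _ _ (fun y => \det (gram y)) Num.sqrt).
  exact: Ck_continuous (Ck_det_gram 0) I.
exact: sqrt_continuous.
Qed.

Section Normal.
Variable (N : 'rV[R]_n.+1 -> 'rV[R]_n.+1).
Hypothesis hN : unit_normal_field f N.

Definition chart_normal y : 'rV[R]_n.+1 := N (sg y).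
Local Notation nu := chart_normal.

Lemma chart_normal_unit y : Om y -> dot (nu y) (nu y) = 1.
Proof. by move=> /regular_chartP Oy; have [_ /(_ _ Oy)[]] := hN. Qed.

(** The radial part of [w] is killed by [sdiff_radial] and the rest is tangent. This form covers
    second derivatives of the chart, which need not be tangent to the sphere. *)
Lemma chart_normal_perp y w : Om y -> dot (nu y) (sdiff f (sg y) w) = 0.
Proof.
move=> /regular_chartP Oy; have [_ /(_ _ Oy)[_ H]] := hN.
have sp := sphere_stereo y.
rewrite (stereo_frame y w) (sdiffD _ _ smf sp) (sdiffZ _ _ smf sp) sdiff_radial scaler0 add0r.
apply: H; rewrite /tangent dot_sumr big1// => l _.
by rewrite dotZr (tangent_sv l y : dot _ _ = 0) mulr0.
Qed.

Lemma chart_normal_dF y i : Om y -> dot (nu y) ('D_(e i) F y) = 0.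
Proof. by move=> Oy; rewrite derive_chart_map; exact: chart_normal_perp. Qed.

Lemma continuous_chart_normal y : Om y -> {for y, continuous nu}.
Proof.
move=> Oy; have [/subspace_continuousP cN _] := hN.
have /cN := (regular_chartP y).1 Oy => cNy.
move=> U /cNy; rewrite /= nbhs_simpl/= => HU.
have cs : {for y, continuous sg} by exact: Ck_continuous (Ck_stereo 0) I.
have h1 : \forall z \near y, regular_set f (sg z) -> U (N (sg z)) by exact: cs HU.
have h2 : \forall z \near y, Om z by exact: open_nbhs_nbhs (conj open_regular_chart Oy).
by move: h1; apply: filterS2 h2 => z /regular_chartP Oz; apply.
Qed.

(* The normal is only assumed continuous.  Near [y0] it is [w / |w|], where [w] is
   the normal component of the constant vector [nu y0]. *)
Lemma Ck_chart_normal k : Ck k Om nu.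
Proof.
apply: Ck_local => y Oy; have oOm := open_regular_chart.
pose nu0 := nu y.
have cd : {for y, continuous (fun z => dot nu0 (nu z))}.
  apply: (@continuous_comp _ _ _ nu (fun M : 'rV[R]_n.+1 => dot nu0 M)).
    exact: continuous_chart_normal.
  apply: (Ck_continuous (k := 0) (U := setT)) => //.
  by apply: Ck_dot; [exact: openT|exact: Ck_cst|apply: Ck_id; exact: openT].
have d1 : dot nu0 (nu y) = 1 by exact: chart_normal_unit.
have near1 : \forall z \near y, 0 < dot nu0 (nu z).
  by apply: (cvgr_gt _ cd); rewrite d1.
have nearO : \forall z \near y, Om z by exact: open_nbhs_nbhs (conj oOm Oy).
(* Positivity settles the sign: [w z] is <nu0, nu z> nu z, so normalising it returns nu z and not
   its opposite. *)
pose A := [set z | Om z /\ 0 < dot nu0 (nu z)].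
have nA : nbhs y A by exact: filterI nearO near1.
exists (A^°) => //; have oA : open A^° by exact: open_interior.
have AOm : A^° `<=` Om by move=> z /interior_subset[].
have kr : Ck k A^° r by exact: Ck_subset (Ck_gram k i0 i0).
pose w z := nu0 - \sum_i ((r z)^-1 * dot nu0 ('D_(e i) F z)) *: 'D_(e i) F z.
have kw : Ck k A^° w.
  apply: Ck_minus => //; first exact: Ck_cst.
  apply: Ck_sum => // i _; have kd : Ck k A^° ('D_(e i) F) by exact: Ck_subset (Ck_dF k i).
  apply: (Ck_scale oA _ kd); apply: (Ck_mul oA).
    apply: (Ck_inv oA _ kr) => z /AOm Oz.
    by rewrite gt_eqF//; exact: cfactor_gt0.
  exact: (Ck_dot oA (Ck_cst _ _ _) kd).
have wE z : Om z -> w z = dot nu0 (nu z) *: nu z.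
  move=> Oz; rewrite /w {1}(@frame_expansion _ _ (nu z) (fun i => 'D_(e i) F z) (r z) nu0).
  - by rewrite addrK.
  - by rewrite gt_eqF// cfactor_gt0.
  - exact: chart_normal_unit.
  - by move=> i; exact: chart_normal_dF.
  - by move=> i j; exact: gram_regular.
have ww z : Om z -> dot (w z) (w z) = dot nu0 (nu z) ^+ 2.
  by move=> Oz; rewrite wE// dotZl dotZr chart_normal_unit// mulr1 expr2.
have ww0 z : A^° z -> 0 < dot (w z) (w z).
  by move=> /interior_subset[Oz zp]; rewrite ww// exprn_gt0.
apply: (Ck_ext oA (F := fun z => (Num.sqrt (dot (w z) (w z)))^-1 *: w z)).
  move=> z /interior_subset[Oz zp]; rewrite ww// sqrtr_sqr gtr0_norm// wE//.
  by rewrite scalerA mulVf ?scale1r// gt_eqF.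
apply: (Ck_scale oA _ kw); apply: (Ck_inv oA).
  by move=> z Az; rewrite gt_eqF// sqrtr_gt0; exact: ww0.
exact: (Ck_sqrt oA ww0 (Ck_dot oA kw kw)).
Qed.

End Normal.
End ConformalImmersionChart.

(** * The second fundamental form and its trace in the chart *)

Section SecondFundamentalForm.
Context {R : realType} {n : nat}.
Notation e i := (delta_mx 0 i : 'rV[R]_n).
Notation E a := (delta_mx 0 a : 'rV[R]_n.+1).
Local Notation sg := (@stereo R n).
Variables (hn : (2 <= n)%N) (f N : 'rV[R]_n.+1 -> 'rV[R]_n.+1).
Hypotheses (hf : branched_conformal_immersion f) (hN : unit_normal_field f N).
Local Notation F := (chart_map f).
Local Notation Om := (regular_chart f).
Local Notation nu := (chart_normal N).

Let smf : sphere_smooth f. Proof. by case: hf. Qed.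

Lemma rV_delta_sum m (v : 'rV[R]_m) : v = \sum_a v 0 a *: (delta_mx 0 a : 'rV[R]_m).
Proof. by rewrite {1}(matrix_sum_delta v) big_ord1. Qed.

Lemma derive_delta_sum m (W : normedModType R) (G : 'rV[R]_m -> W) p (v : 'rV[R]_m) :
  differentiable G p -> 'D_v G p = \sum_a v 0 a *: 'D_(delta_mx 0 a) G p.
Proof.
move=> dG; rewrite {1}(rV_delta_sum v).
apply: etrans (derive_dir_sum _ _ dG) _.
by apply: eq_bigr => a _; exact: derive_dirZ.
Qed.

Let Df a := 'D_(E a) (radial f).

Let kDf k a : Ck k [set p | p != 0] (Df a).
Proof. exact: Ck_derive (smooth_Ck k.+1 smf). Qed.

Let dDf a p : sphere p -> differentiable (Df a) p.
Proof. by move=> sp; exact: Ck_diff (kDf 0 a) (sphere_neq0 sp). Qed.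

(** Expanding [v] in the standard basis leaves second derivatives along fixed directions, from which
    bilinearity and bounds follow. *)
Lemma second_fundamental_formE p u v : sphere p ->
  second_fundamental_form f N p u v = \sum_a v 0 a * dot (N p) ('D_u (Df a) p).
Proof.
move=> sp.
have H z : [set p | p != 0] z -> 'D_v (radial f) z = \sum_a v 0 a *: Df a z.
  by move=> z0; exact: derive_delta_sum (Ck_diff (smooth_Ck 0 smf) z0).
apply: etrans (congr1 (dot (N p)) (derive_ext u (@open_rV_neq0 R n) (sphere_neq0 sp) H)) _.
rewrite derive_bigsum => [|a _]; last exact: differentiableZ (dDf a sp).
rewrite dot_sumr; apply: eq_bigr => a _.
by rewrite -dotZr; congr (dot _ _); exact: derive_scalec (dDf a sp).
Qed.

Lemma second_fundamental_formE2 p u v : sphere p ->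
  second_fundamental_form f N p u v =
  \sum_a \sum_b v 0 a * u 0 b * dot (N p) ('D_(E b) (Df a) p).
Proof.
move=> sp; apply: etrans (second_fundamental_formE u v sp) _; apply: eq_bigr => a _.
have -> : 'D_u (Df a) p = \sum_b u 0 b *: 'D_(E b) (Df a) p.
  exact: derive_delta_sum (dDf a sp).
rewrite dot_sumr mulr_sumr; apply: eq_bigr => b _.
by rewrite dotZr mulrA.
Qed.

Lemma second_fundamental_formZ p c u v : sphere p ->
  second_fundamental_form f N p (c *: u) (c *: v) =
  c ^+ 2 * second_fundamental_form f N p u v.
Proof.
move=> sp; apply: etrans (second_fundamental_formE2 _ _ sp) _.
rewrite (second_fundamental_formE2 u v sp) mulr_sumr; apply: eq_bigr => a _.
rewrite mulr_sumr; apply: eq_bigr => b _.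
by rewrite !scale_entry; ring.
Qed.

(** By the product rule d_i d_j F is a second derivative of f along [sv i] and [sv j] plus the first
    derivative of f along d_i [sv j]. The latter is orthogonal to the normal by
    [chart_normal_perp]. *)
Lemma chart_sffE i j y : Om y ->
  chart_sff F nu i j y = second_fundamental_form f N (sg y) (sv i y) (sv j y).
Proof.
move=> Oy; have sp := sphere_stereo y.
have dsv k : differentiable (sv k) y by exact: Ck_diff (Ck_sv 0 k) I.
have dsva k a : differentiable (fun z => sv k z 0 a) y by exact: differentiable_entry.
have dsg : differentiable sg y by exact: Ck_diff (Ck_stereo 0) I.
have dDfs a : differentiable (Df a \o sg) y.
  by exact: Ck_diff (Ck_comp_stereo_row (kDf 0 a)) I.
have FE : 'D_(e j) F = fun z => \sum_a sv j z 0 a *: (Df a \o sg) z.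
  apply/funext => z; apply: etrans (derive_chart_map hf _ _) _.
  exact: derive_delta_sum (smooth_diff smf (sphere_stereo z)).
have DE : 'D_(e i) ('D_(e j) F) y =
  \sum_a 'D_(e i) (fun z => sv j z 0 a) y *: Df a (sg y) +
  \sum_a sv j y 0 a *: 'D_(sv i y) (Df a) (sg y).
  rewrite FE derive_bigsum => [|a _]; last first.
    have ks := (Ck_rowP _ _ openT).1 (@Ck_sv R n 0 j) a.
    have kd := Ck_comp_stereo_row (kDf 0 a).
    have k2 := Ck_scale openT ks kd.
    exact: Ck_diff k2 I.
  rewrite -big_split; apply: eq_bigr => a _.
  apply: etrans (derive_scale (e i) (dsva j a) (dDfs a)) _.
  exact: (congr1 (fun w => _ + sv j y 0 a *: w) (derive_comp (e i) dsg (dDf a sp))).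
have N0 : dot (nu y) (\sum_a 'D_(e i) (fun z => sv j z 0 a) y *: Df a (sg y)) = 0.
  have -> : \sum_a 'D_(e i) (fun z => sv j z 0 a) y *: Df a (sg y) =
      sdiff f (sg y) ('D_(e i) (sv j) y).
    rewrite /sdiff (derive_delta_sum _ (smooth_diff smf sp)).
    apply: eq_bigr => a _; congr (_ *: _).
    by apply: esym; apply: derive_row; exact: diff_derivable (dsv j).
  exact: chart_normal_perp.
rewrite (second_fundamental_formE _ _ sp) /chart_sff.
apply: etrans (congr1 (dot (nu y)) DE) _.
rewrite dotDr; apply: etrans (congr1 (fun z => z + _) N0) _.
rewrite add0r dot_sumr; apply: eq_bigr => a _.
exact: dotZr.
Qed.

Variable (H : 'rV[R]_n.+1 -> R).
Hypothesis hH : mean_curvature_of f N H.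
Local Notation r := (cfactor hn f).

(** Dividing the coordinate vectors by the square root of r makes them orthonormal for the
    pulled-back metric. Both arguments of the form are rescaled, whence a factor 1/r. *)
Lemma trace_chart_sff y : Om y ->
  \sum_i chart_sff F nu i i y = n%:R * H (sg y) * r y.
Proof.
move=> Oy; have r0 := cfactor_gt0 hn hf Oy; have sp := sphere_stereo y.
pose c := (Num.sqrt (r y))^-1.
have c2 : c ^+ 2 = (r y)^-1 by rewrite exprVn sqr_sqrtr// ltW.
have on : orthonormal_frame f (sg y) (fun i => c *: sv i y).
  split=> [i|i j]; first by rewrite /tangent dotZr (tangent_sv i y : dot _ _ = 0) mulr0.
  have G : dot (sdiff f (sg y) (sv i y)) (sdiff f (sg y) (sv j y)) = (i == j)%:R * r y.
    exact: etrans (congr2 (@dot R n.+1) (esym (derive_chart_map hf (e i) y))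
      (esym (derive_chart_map hf (e j) y))) (gram_regular hn hf i j Oy).
  apply: etrans (congr2 (@dot R n.+1) (sdiffZ c (sv i y) smf sp) (sdiffZ c (sv j y) smf sp)) _.
  apply: etrans (dotZl _ _ _) _; apply: etrans (congr1 (fun w => c * w) (dotZr _ _ _)) _.
  apply: etrans (congr1 (fun w => c * (c * w)) G) _.
  have -> : c * (c * ((i == j)%:R * r y)) = c ^+ 2 * r y * (i == j)%:R by ring.
  by rewrite c2 mulVf ?mul1r// gt_eqF.
have HE := hH ((regular_chartP f y).1 Oy) on.
have S : \sum_i second_fundamental_form f N (sg y) (c *: sv i y) (c *: sv i y) =
    (r y)^-1 * \sum_i chart_sff F nu i i y.
  rewrite mulr_sumr; apply: eq_bigr => i _.
  by rewrite (chart_sffE i i Oy) -c2; exact: second_fundamental_formZ.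
have alg (k r' h S' T : R) : k != 0 -> r' != 0 -> h = k^-1 * S' -> S' = r'^-1 * T -> T = k * h * r'.
  by move=> k0 r'0 -> ->; rewrite mulVKf// mulrAC mulVf// mul1r.
apply: alg HE S; last by rewrite gt_eqF.
by rewrite pnatr_eq0 -lt0n (ltn_trans _ hn).
Qed.

End SecondFundamentalForm.

(** * The conformal field in the chart *)

Section ConformalFieldChart.
Context {R : realType} {n : nat}.
Notation e i := (delta_mx 0 i : 'rV[R]_n).
Local Notation sg := (@stereo R n).
Variables (X : 'rV[R]_n.+1 -> 'rV[R]_n.+1).
Hypothesis hX : conformal_field X.

Let smX : sphere_smooth X. Proof. by case: hX => -[]. Qed.
Let tX p : sphere p -> tangent p (X p). Proof. by case: hX => -[_ H] _; exact: H. Qed.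

(* A tangent field with value [a] at every point to which [a] is tangent. *)
Definition tangent_ext (a z : 'rV[R]_n.+1) : 'rV[R]_n.+1 := a - dot a z *: z.

Lemma tangent_field_ext a : tangent_field (tangent_ext a).
Proof.
split; last first.
  move=> p sp; rewrite /tangent /tangent_ext dotBr dotZr (sp : dot p p = 1) mulr1.
  by rewrite dot_sym subrr.
apply/smooth_onP => k; have oU := @open_rV_neq0 R n.
(* At z / |z| the two normalisations combine into 1 / |z|^2, so the radial extension is rational and
   smooth off the origin. *)
apply: (Ck_ext oU (F := fun z => a - ((dot z z)^-1 * dot a z) *: z)).
  move=> z z0; have zz : 0 < dot z z by rewrite lt_def dot_eq0 z0 dot_ge0.
  rewrite /radial /tangent_ext dotZr scalerA; congr (_ - _ *: _).
  rewrite mulrAC -expr2 /enorm exprVn sqr_sqrtr ?ltW//.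
have kid : Ck k [set p : 'rV[R]_n.+1 | p != 0] (fun z => z) by exact: Ck_id.
apply: (Ck_minus oU (Ck_cst _ _ _)); apply: (Ck_scale oU _ kid); apply: (Ck_mul oU).
  apply: (Ck_inv oU _ (Ck_dot oU kid kid)) => z z0.
  by rewrite dot_eq0.
exact: (Ck_dot oU (Ck_cst _ _ _) kid).
Qed.

Lemma tangent_extE p a : tangent p a -> tangent_ext a p = a.
Proof. by move=> ta; rewrite /tangent_ext dot_sym (ta : dot _ _ = 0) scale0r subr0. Qed.

(** Testing on the extensions of [a] and [b] makes the condition pointwise: their derivatives along
    [X] cancel between the derivative of the inner product and the brackets, and only derivatives of
    [X] remain. *)
Lemma conformal_field_sym : exists phi : 'rV[R]_n.+1 -> R,
  forall p a b, sphere p -> tangent p a -> tangent p b ->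
  dot (sdiff X p a) b + dot a (sdiff X p b) = phi p * dot a b.
Proof.
have [_ [phi H]] := hX; exists phi => p a b sp ta tb.
have Ua := tangent_field_ext a; have Ub := tangent_field_ext b.
have := H _ _ Ua Ub p sp; rewrite /lie_round_metric /lie_bracket.
rewrite !(tangent_extE ta) !(tangent_extE tb) => <-.
have da := smooth_diff Ua.1 sp; have db := smooth_diff Ub.1 sp.
have -> : deriv_along X (fun y => dot (tangent_ext a y) (tangent_ext b y)) p =
    dot (sdiff (tangent_ext a) p (X p)) b + dot a (sdiff (tangent_ext b) p (X p)).
  apply: etrans (derive_dot (X p) da db) _.
  by rewrite !radial_sphere// !(tangent_extE ta) !(tangent_extE tb).
have alg (a1 a2 b1 b2 : R) : a1 + b1 = a2 + b2 - (a2 - a1) - (b2 - b1) by ring.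
rewrite dotBl dotBr; exact: alg.
Qed.

Definition chart_vec y : 'rV[R]_n := \row_j ((cf y ^+ 2)^-1 * dot (X (sg y)) (sv j y)).
Local Notation x := chart_vec.

Lemma chart_vecE y : X (sg y) = \sum_j x y 0 j *: sv j y.
Proof.
rewrite {1}(tangent_stereo_frame (tX (sphere_stereo y))).
by apply: eq_bigr => j _; rewrite mxE.
Qed.

Lemma cf_chart_vec y j : cf y ^+ 2 * x y 0 j = dot (X (sg y)) (sv j y).
Proof. by rewrite mxE mulrA divff ?mul1r// cf2_neq0. Qed.

Let Y (y : 'rV[R]_n) := X (sg y).

Let kY k : Ck k [set: 'rV[R]_n] Y.
Proof.
have -> : Y = radial X \o sg by exact: comp_radial.
by apply: Ck_comp_stereo_row; exact: smooth_Ck.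
Qed.

Lemma Ck_chart_vec k : Ck k [set: 'rV[R]_n] x.
Proof.
apply/(Ck_rowP _ _ openT) => j; under eq_fun do rewrite mxE.
apply: (Ck_mul openT); last exact: (Ck_dot openT (kY k) (Ck_sv k j)).
apply: (Ck_inv openT) => [y _|]; first exact: cf2_neq0.
by apply: Ck_exp; [exact: openT|exact: Ck_cf].
Qed.

(** The round metric is m |dy|^2 in the chart. Differentiating m x_j = <X, d_j sigma> and inserting
    the Christoffel symbols of m turns the conformal equation of that metric into the one of the
    flat metric, with [t] equal to phi minus the derivative of log m along x. *)
Lemma chart_vec_conformal : exists t : 'rV[R]_n -> R, forall y i j,
  'D_(e i) x y 0 j + 'D_(e j) x y 0 i = (i == j)%:R * t y.
Proof.
have [phi HX] := conformal_field_sym.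
pose m (y : 'rV[R]_n) : R := cf y ^+ 2.
exists (fun y => phi (sg y) - (m y)^-1 * \sum_l x y 0 l * 'D_(e l) m y) => y i j.
have sp := sphere_stereo y.
have km k : Ck k [set: 'rV[R]_n] m by apply: Ck_exp; [exact: openT|exact: Ck_cf].
have dm : differentiable m y by exact: Ck_diff (km 0) I.
have dY : differentiable Y y by exact: Ck_diff (kY 0) I.
have dsv k : differentiable (sv k) y by exact: Ck_diff (Ck_sv 0 k) I.
have dx : differentiable x y by exact: Ck_diff (Ck_chart_vec 0) I.
have dxj k : differentiable (fun z => x z 0 k) y by exact: differentiable_entry.
have DY k : 'D_(e k) Y y = sdiff X (sg y) (sv k y) by exact: derive_comp_stereo.
have key k l : 'D_(e k) m y * x y 0 l + m y * 'D_(e k) x y 0 l =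
    dot (sdiff X (sg y) (sv k y)) (sv l y) + dot (Y y) ('D_(e k) (sv l) y).
  have -> : 'D_(e k) x y 0 l = 'D_(e k) (fun z => x z 0 l) y.
    by apply: derive_row; exact: diff_derivable.
  rewrite -DY; apply: etrans (esym (derive_mul (e k) dm (dxj l))) _.
  apply: etrans _ (derive_dot (e k) dY (dsv l)).
  by congr ('D_(e k) _ y); apply/funext => z; exact: cf_chart_vec.
have chr l a b : dot (sv l y) ('D_(e a) (sv b) y) =
    ((l == b)%:R * 'D_(e a) m y + (l == a)%:R * 'D_(e b) m y - (a == b)%:R * 'D_(e l) m y) / 2.
  exact: (conformal_christoffel openT (Ck_stereo 2) (km 0) (fun z a b _ => dot_sv a b z) (y := y) I l a b).
have sumc a b : dot (Y y) ('D_(e a) (sv b) y) =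
    (x y 0 b * 'D_(e a) m y + x y 0 a * 'D_(e b) m y -
     (a == b)%:R * \sum_l x y 0 l * 'D_(e l) m y) / 2.
  rewrite /Y chart_vecE dot_suml.
  have alg (l : 'I_n) (s A B C X' : R) : s = ((l == b)%:R * A + (l == a)%:R * B - (a == b)%:R * C) / 2 ->
     X' * s = 2^-1 * ((l == b)%:R * (A * X') + (l == a)%:R * (B * X') - (a == b)%:R * (X' * C)).
    by move=> ->; field.
  apply: etrans (eq_bigr _ (fun l _ => etrans (dotZl _ _ _) (alg l _ _ _ _ _ (chr l a b)))) _.
  apply: etrans (sum_kronecker2 _ _ _ _ _ _ _ _) _.
  have alg2 (A B C D S : R) : 2^-1 * (A * B + C * D - S) = (B * A + D * C - S) / 2 by ring.
  exact: alg2.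
have conf := HX (sg y) _ _ sp (tangent_sv i y) (tangent_sv j y).
rewrite dot_sv in conf.
have m0 : m y != 0 by exact: cf2_neq0.
have alg (a b c d mi mj xi xj S P t1 t2 dl : R) :
  mi * xj + m y * a = t1 + c -> mj * xi + m y * b = t2 + d ->
  c = (xj * mi + xi * mj - dl * S) / 2 -> d = (xi * mj + xj * mi - dl * S) / 2 ->
  t1 + t2 = P * (dl * m y) -> a + b = dl * (P - (m y)^-1 * S).
  move=> h1 h2 hc hd h3; rewrite hc in h1; rewrite hd in h2; apply: (mulfI m0).
  have -> : m y * (dl * (P - (m y)^-1 * S)) = P * (dl * m y) - dl * S by field.
  by rewrite -h3 mulrDr; lra.
have sj := sumc j i; rewrite [j == i]eq_sym in sj.
rewrite [dot (sv i y) _]dot_sym in conf.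
exact: alg (key i j) (key j i) (sumc i j) sj conf.
Qed.

Lemma deriv_along_stereo (H : 'rV[R]_n.+1 -> R) y : sphere_smooth H ->
  deriv_along X H (sg y) = \sum_i x y 0 i * 'D_(e i) (H \o sg) y.
Proof.
move=> smH; rewrite /deriv_along chart_vecE (sdiff_sum _ _ _ smH (sphere_stereo y)).
apply: eq_bigr => i _; congr (_ * _); apply: esym; exact: derive_comp_stereo.
Qed.

End ConformalFieldChart.

(** * Decay in the chart from bounds on the compact sphere *)

Section Bounds.
Context {R : realType} {n : nat}.
Notation e i := (delta_mx 0 i : 'rV[R]_n).
Notation E a := (delta_mx 0 a : 'rV[R]_n.+1).
Local Notation sg := (@stereo R n).

Lemma norm_sum_le (I : finType) (g : I -> R) c : (forall i, `|g i| <= c) ->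
  `|\sum_i g i| <= #|I|%:R * c.
Proof.
move=> gc; rewrite (le_trans (ler_norm_sum _ _ _))//.
by rewrite mulr_natl -sumr_const; apply: ler_sum => i _.
Qed.

Lemma norm_dot_le m (u v : 'rV[R]_m) a b : 0 <= a -> (forall i, `|u 0 i| <= a) ->
  (forall i, `|v 0 i| <= b) -> `|dot u v| <= m%:R * (a * b).
Proof.
move=> a0 ua vb; rewrite /dot -[m in m%:R]card_ord; apply: norm_sum_le => i.
by rewrite normrM ler_pM.
Qed.

(** The coordinate vectors have length [cf y], so each direction of differentiation in the chart
    contributes one factor [cf]. *)
Lemma sv_entry_le (i : 'I_n) (y : 'rV[R]_n) a : `|sv i y 0 a| <= cf y.
Proof.
apply: entry_le_of_dot; first exact/ltW/cf_gt0.
by rewrite dot_sv eqxx mul1r.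
Qed.

Lemma smooth_bound (W : 'rV[R]_n.+1 -> R) : Ck 0 [set p | p != 0] W ->
  forall p, sphere p -> {for p, continuous W}.
Proof. by move=> kW p sp; exact: Ck_continuous kW (sphere_neq0 sp). Qed.

Lemma vector_bound (X : 'rV[R]_n.+1 -> 'rV[R]_n.+1) : sphere_smooth X ->
  exists2 M, 0 <= M & forall p a, sphere p -> `|X p 0 a| <= M.
Proof.
move=> sX; have [M M0 HM] := @sphere_bounded_fam R n 'I_n.+1 (fun a p => radial X p 0 a)
  (fun a => smooth_bound ((Ck_rowP _ _ open_rV_neq0).1 (smooth_Ck 0 sX) a)).
by exists M => // p a sp; rewrite -(radial_sphere X sp); exact: HM.
Qed.

Lemma derive_bound (X : 'rV[R]_n.+1 -> 'rV[R]_n.+1) : sphere_smooth X ->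
  exists2 M, 0 <= M & forall p a b, sphere p -> `|'D_(E a) (radial X) p 0 b| <= M.
Proof.
move=> sX; have [M M0 HM] := @sphere_bounded_fam R n ('I_n.+1 * 'I_n.+1)%type
  (fun ab p => 'D_(E ab.1) (radial X) p 0 ab.2)
  (fun ab => smooth_bound ((Ck_rowP _ _ open_rV_neq0).1 (Ck_derive (E ab.1) (smooth_Ck 1 sX)) ab.2)).
by exists M => // p a b sp; exact: (HM (a, b)).
Qed.

Lemma derive2_bound (X : 'rV[R]_n.+1 -> 'rV[R]_n.+1) : sphere_smooth X ->
  exists2 M, 0 <= M & forall p a b c, sphere p ->
    `|'D_(E b) ('D_(E a) (radial X)) p 0 c| <= M.
Proof.
move=> sX; have [M M0 HM] := @sphere_bounded_fam R n ('I_n.+1 * 'I_n.+1 * 'I_n.+1)%type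
  (fun t p => 'D_(E t.1.2) ('D_(E t.1.1) (radial X)) p 0 t.2)
  (fun t => smooth_bound ((Ck_rowP _ _ open_rV_neq0).1
    (Ck_derive (E t.1.2) (Ck_derive (E t.1.1) (smooth_Ck 2 sX))) t.2)).
by exists M => // p a b c sp; exact: (HM (a, b, c)).
Qed.

Lemma scalar_bound (H : 'rV[R]_n.+1 -> R) : sphere_smooth H ->
  exists2 M, 0 <= M & forall p, sphere p -> `|H p| <= M.
Proof.
move=> sH; have [M M0 HM] := sphere_bounded (smooth_bound (smooth_Ck 0 sH)).
by exists M => // p sp; rewrite -(radial_sphere H sp); exact: HM.
Qed.

Lemma scalar_derive_bound (H : 'rV[R]_n.+1 -> R) : sphere_smooth H ->
  exists2 M, 0 <= M & forall p a, sphere p -> `|'D_(E a) (radial H) p| <= M.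
Proof.
move=> sH; have [M M0 HM] := @sphere_bounded_fam R n 'I_n.+1
  (fun a p => 'D_(E a) (radial H) p)
  (fun a => smooth_bound (Ck_derive (E a) (smooth_Ck 1 sH))).
by exists M => // p a sp; exact: HM.
Qed.

Lemma deriv_along_bound (X : 'rV[R]_n.+1 -> 'rV[R]_n.+1) (H : 'rV[R]_n.+1 -> R) :
  sphere_smooth X -> sphere_smooth H ->
  exists2 M, 0 <= M & forall p, sphere p -> `|deriv_along X H p| <= M.
Proof.
move=> sX sH; have [M1 M10 H1] := vector_bound sX.
have [M2 M20 H2] := scalar_derive_bound sH.
exists (#|'I_n.+1|%:R * (M1 * M2)) => [|p sp]; first by rewrite !mulr_ge0.
rewrite /deriv_along /sdiff (derive_delta_sum _ (smooth_diff sH sp)).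
apply: norm_sum_le => a; rewrite normrM; apply: ler_pM => //; first exact: H1.
exact: H2.
Qed.

Variables (hn : (2 <= n)%N) (f N : 'rV[R]_n.+1 -> 'rV[R]_n.+1).
Hypotheses (hf : branched_conformal_immersion f) (hN : unit_normal_field f N).
Local Notation F := (chart_map f).
Local Notation Om := (regular_chart f).
Local Notation nu := (chart_normal N).
Local Notation r := (cfactor hn f).

Let smf : sphere_smooth f. Proof. by case: hf. Qed.

(** One factor [cf] for each of the two directions. The bound is uniform up to the branching points,
    since it uses only second derivatives of f and the unit length of the normal. *)
Lemma chart_sff_bound : exists2 C, 0 <= C &
  forall y i j, Om y -> `|chart_sff F nu i j y| <= C * cf y ^+ 2.
Proof.
have [M M0 HM] := derive2_bound smf; pose k : R := #|'I_n.+1|%:R.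
have k0 : 0 <= k by rewrite ler0n.
exists (k * (k * (n.+1%:R * (1 * M)))) => [|y i j Oy].
  by rewrite !mulr_ge0// ?ler0n.
have sp := sphere_stereo y; have c0 : 0 <= cf y by exact/ltW/cf_gt0.
rewrite (chart_sffE hf hN i j Oy).
rewrite (second_fundamental_formE2 N hf _ _ sp).
rewrite -mulrA; apply: norm_sum_le => a; rewrite -mulrA; apply: norm_sum_le => b.
rewrite normrM [leRHS]mulrC; apply: ler_pM => //.
  by rewrite normrM expr2; apply: ler_pM => //; exact: sv_entry_le.
apply: norm_dot_le => [//|c|c]; last exact: HM.
by apply: sphere_coord; exact: (chart_normal_unit hN Oy).
Qed.

Lemma cfactor_bound : exists2 C, 0 <= C & forall y, r y <= (C * cf y) ^+ 2.
Proof.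
have [M M0 HM] := derive_bound smf; pose k : R := #|'I_n.+1|%:R.
have k0 : 0 <= k by rewrite ler0n.
have n0 : 0 <= n.+1%:R :> R by rewrite ler0n.
exists (n.+1%:R * (k * M)) => [|y]; first by rewrite !mulr_ge0.
have sp := sphere_stereo y; have c0 : 0 <= cf y by exact/ltW/cf_gt0.
rewrite /cfactor; set i := Ordinal _.
have EE a : `|'D_(e i) F y 0 a| <= cf y * (k * M).
  rewrite (derive_chart_map hf) /sdiff (derive_delta_sum _ (smooth_diff smf sp)).
  rewrite summxE [leRHS]mulrCA; apply: norm_sum_le => b; rewrite mxE normrM.
  by apply: ler_pM => //; [exact: sv_entry_le|exact: HM].
have d0 : 0 <= cf y * (k * M) by exact: mulr_ge0 c0 (mulr_ge0 k0 M0).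
have := norm_dot_le d0 EE EE; rewrite (ger0_norm (dot_ge0 _)) => h.
apply: le_trans h _; set A := cf y * (k * M).
have -> : n.+1%:R * (A * A) = 1 * (n.+1%:R * A ^+ 2) by ring.
have -> : (n.+1%:R * (k * M) * cf y) ^+ 2 = n.+1%:R * (n.+1%:R * A ^+ 2) by rewrite /A; ring.
by apply: ler_wpM2r; [rewrite mulr_ge0// sqr_ge0|rewrite ler1n].
Qed.

End Bounds.

(** * Finiteness of the branching set *)

Lemma finite_of_isolated (T : ptopologicalType) (K Z : set T) :
  compact K -> (forall p, K p -> \forall q \near p, Z q -> q = p) ->
  exists s : seq T, forall q, K q -> Z q -> q \in s.
Proof.
rewrite compact_cover => cK iso.
(* Each set of the cover meets [Z] at most in its centre, so the centres of a finite subcover list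
   all points of [Z] in [K]. *)
have [||D _ KD] := cK T K (fun p => [set q | Z q -> q = p]^°).
- by move=> p _; exact: open_interior.
- by move=> p Kp; exists p => //; exact: iso.
exists (finmap.enum_fset D) => q Kq Zq.
by have [p pD /interior_subset /(_ Zq) ->] := KD q Kq.
Qed.

Section FiniteBranching.
Context {R : realType} {n : nat}.
Notation E a := (delta_mx 0 a : 'rV[R]_n.+1).
Local Notation sg := (@stereo R n).
Variables (f : 'rV[R]_n.+1 -> 'rV[R]_n.+1).
Hypotheses (hf : branched_conformal_immersion f).

Let smf : sphere_smooth f. Proof. by case: hf. Qed.
Let Df a := 'D_(E a) (radial f).

(* The form |df_p u|^2 + <p, u>^2 is nondegenerate exactly where f is immersed. *)
Let ext_gram (p : 'rV[R]_n.+1) : 'M[R]_n.+1 :=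
  \matrix_(a, b) (dot (Df a p) (Df b p) + p 0 a * p 0 b).

Let mul_ext_gram p u b : sphere p ->
  (u *m ext_gram p) 0 b = dot (sdiff f p u) (Df b p) + dot u p * p 0 b.
Proof.
move=> sp; rewrite mxE /sdiff (derive_delta_sum u (smooth_diff smf sp)) dot_suml.
rewrite {2}/dot mulr_suml -big_split/=; apply: eq_bigr => a _.
by rewrite mxE mulrDr mulrA dotZl.
Qed.

Let immersed_det p : sphere p -> (immersed_at f p <-> \det (ext_gram p) != 0).
Proof.
move=> sp; split=> [imm|d0 u tu su].
  apply/negP => /det0P[u u0 uG]; move/eqP: u0; apply.
  have q0 : dot (sdiff f p u) (sdiff f p u) + dot u p ^+ 2 = 0.
    have -> : dot (sdiff f p u) (sdiff f p u) + dot u p ^+ 2 =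
        \sum_b u 0 b * (dot (sdiff f p u) (Df b p) + dot u p * p 0 b).
      rewrite {2}/sdiff (derive_delta_sum u (smooth_diff smf sp)) dot_sumr.
      rewrite expr2 {3}/dot mulr_sumr -big_split/=; apply: eq_bigr => b _.
      by rewrite dotZr mulrDr; congr (_ + _); ring.
    rewrite big1// => b _.
    by rewrite -(mul_ext_gram u b sp) uG mxE mulr0.
  have a0 := dot_ge0 (sdiff f p u); have b0 := sqr_ge0 (dot u p).
  have u1 : dot (sdiff f p u) (sdiff f p u) == 0.
    by rewrite eq_le a0 andbT; lra.
  have u2 : dot u p == 0.
    by rewrite -sqrf_eq0 eq_le b0 andbT; lra.
  apply: imm; first by rewrite /tangent dot_sym; exact/eqP.
  by apply/eqP; rewrite -dot_eq0.
apply/eqP; apply/negPn/negP => u0; move/negP: d0; apply; apply/det0P; exists u => //.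
apply/rowP => b; apply: etrans (mul_ext_gram u b sp) _.
rewrite su dot0l dot_sym (tu : dot _ _ = 0) mul0r addr0.
by rewrite mxE.
Qed.

Let Ck_det_ext_gram k : Ck k [set p | p != 0] (fun p => \det (ext_gram p)).
Proof.
have oU := @open_rV_neq0 R n.
have kD a : Ck k [set p | p != 0] (Df a) by exact: Ck_derive (smooth_Ck k.+1 smf).
have kE a b : Ck k [set p | p != 0] (fun p => ext_gram p a b).
  have -> : (fun p => ext_gram p a b) = fun p => dot (Df a p) (Df b p) + p 0 a * p 0 b.
    by apply/funext => p; rewrite mxE.
  apply: (Ck_add oU (Ck_dot oU (kD _) (kD _))).
  by apply: (Ck_mul oU); exact: Ck_coord.
rewrite /determinant; apply: Ck_sum => [|s _]; first exact: oU.
apply: (Ck_mul oU (Ck_cst _ _ _)); apply: (Ck_prod _ oU) => i.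
exact: kE.
Qed.

Lemma immersed_near p : sphere p -> immersed_at f p ->
  \forall q \near p, sphere q -> immersed_at f q.
Proof.
move=> sp /(immersed_det sp) d0.
have c : {for p, continuous (fun p => \det (ext_gram p))}.
  exact: Ck_continuous (Ck_det_ext_gram 0) (sphere_neq0 sp).
have : \forall q \near p, \det (ext_gram q) != 0.
  by apply: (c [set s | s != 0]); apply: open_nbhs_nbhs; split; [exact: open_neq0|exact: d0].
by apply: filterS => q dq sq; exact/(immersed_det sq).
Qed.

(** Near an immersed point there is no branching point, and near a branching point there is no
    other, so compactness applies. *)
Lemma finite_branch_set : exists s : seq 'rV[R]_n.+1,
  forall q, sphere q -> q \notin s -> immersed_at f q.
Proof.
have [||s Hs] := @finite_of_isolated 'rV[R]_n.+1 (@sphere R n) [set q | sphere q /\ ~ immersed_at f q].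
- exact: compact_sphere.
- move=> p sp; have [imm|nimm] := pselect (immersed_at f p).
    by have := immersed_near sp imm; apply: filterS => q iq [sq] /(_ (iq sq)).
  have [_ _ /(_ p (conj sp nimm))[_ [_ _ H _]]] := hf.
  have Hn : nbhs p (fun q => q != p -> sphere q -> immersed_at f q) by exact: H.
  apply: filterS Hn => q Hq [sq nq].
  by apply: contrapT => /eqP qp; apply: nq; exact: Hq.
exists s => q sq qs; apply: contrapT => nq.
by move/negP: qs; apply; exact: Hs.
Qed.

Definition unstereo (p : 'rV[R]_n.+1) : 'rV[R]_n :=
  \row_j ((1 - p 0 ord0)^-1 * p 0 (lift ord0 j)).

Lemma stereoK : cancel sg unstereo.
Proof.
move=> y; apply/rowP => j; rewrite mxE stereo0 stereoS opprB addrC subrK mulrA mulVf ?mul1r//.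
by rewrite gt_eqF// cf_gt0.
Qed.

Lemma finite_singular_chart : exists s : seq 'rV[R]_n,
  forall y, y \notin s -> regular_chart f y.
Proof.
(* At the pole [unstereo] inverts 0 and returns 0, which at most adds a point to the list. *)
have [s Hs] := finite_branch_set; exists (map unstereo s) => y ys.
apply: Hs; first exact: sphere_stereo.
by apply: contra ys => ys; apply/mapP; exists (sg y) => //; rewrite stereoK.
Qed.

End FiniteBranching.

(** * The integral identity and the change of sign *)

Section IntegralIdentity.
Context {R : realType} {n : nat}.
Notation e i := (delta_mx 0 i : 'rV[R]_n).
Local Notation sg := (@stereo R n).
Variables (hn : (2 <= n)%N) (f N : 'rV[R]_n.+1 -> 'rV[R]_n.+1) (H : 'rV[R]_n.+1 -> R)
  (X : 'rV[R]_n.+1 -> 'rV[R]_n.+1).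
Hypotheses (hf : branched_conformal_immersion f) (hN : unit_normal_field f N)
  (smH : sphere_smooth H) (hH : mean_curvature_of f N H) (hX : conformal_field X).
Local Notation Om := (regular_chart f).
Local Notation nu := (chart_normal N).
Local Notation r := (cfactor hn f).
Local Notation x := (chart_vec X).
Local Notation h := (H \o sg).

Let smX : sphere_smooth X. Proof. by case: hX => -[]. Qed.

Definition chart_integrand y : R := deriv_along X H (sg y) * volume_density f y.
Local Notation K := chart_integrand.

Lemma continuous_deriv_along_chart : continuous (fun y => deriv_along X H (sg y)).
Proof.
have -> : (fun y => deriv_along X H (sg y)) = fun y => \sum_i x y 0 i * 'D_(e i) h y.
  by apply/funext => y; exact: deriv_along_stereo.
have kh k : Ck k [set: 'rV[R]_n] h.
  by rewrite (comp_radial H); exact: Ck_comp_stereo (smooth_Ck k smH).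
move=> y; apply: (Ck_continuous (k := 0) (U := setT)) => //.
apply: Ck_sum => [|i _]; first exact: openT.
apply: (Ck_mul openT ((Ck_rowP _ _ openT).1 (Ck_chart_vec hX 0) i)).
exact: Ck_derive (kh 1).
Qed.

Lemma continuous_chart_integrand : continuous K.
Proof.
move=> y.
have vol := continuous_volume_density hf.
have h1 := @continuous_deriv_along_chart y.
have h := cvgM h1 (vol y).
exact: h.
Qed.

Let fld := chart_field (chart_map f) nu r h x.

Let kF k : Ck k Om (chart_map f).
Proof. by apply: Ck_subset (Ck_chart_map hf k). Qed.
Let kr k : Ck k Om r.
Proof. by apply: Ck_subset (Ck_gram hf k _ _). Qed.
Let kh k : Ck k Om h.
Proof.
apply: (@Ck_subset _ _ _ _ _ setT) => //.
by rewrite (comp_radial H); exact: Ck_comp_stereo (smooth_Ck k smH).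
Qed.
Let kx k : Ck k Om x.
Proof. by apply: Ck_subset (Ck_chart_vec hX k). Qed.
Let oOm := open_regular_chart hn hf.

Let kfld k i : Ck k Om (fld i).
Proof.
apply: Ck_chart_field => //.
- by move=> l; exact: (Ck_chart_normal hn hf hN).
- by move=> y; exact: (cfactor_gt0 hn hf).
Qed.

Let div_fld y : Om y -> \sum_i 'D_(e i) (fld i) y = (n%:R - 1) * K y.
Proof.
move=> Oy; have [t tE] := chart_vec_conformal hX.
have := @chart_divergence R n Om (chart_map f) nu r h t x hn oOm kF
  (fun k => Ck_chart_normal hn hf hN k) kr kh kx
  (fun y Oy => chart_normal_unit hN Oy) (fun y i Oy => chart_normal_dF hf hN i Oy)
  (fun y i j Oy => gram_regular hn hf i j Oy) (fun y Oy => cfactor_gt0 hn hf Oy)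
  (fun y Oy => trace_chart_sff hn hf hN hH Oy) (fun y i j _ => tE y i j) y Oy.
move=> E; apply: etrans E _.
rewrite /chart_integrand (volume_density_regular hn hf Oy) (deriv_along_stereo hX y smH).
by rewrite -mulrA; congr (_ * _); exact: mulrC.
Qed.

Let c0 (y : 'rV[R]_n) : 0 < cf y. Proof. exact: cf_gt0. Qed.

Let cf_wt (y : 'rV[R]_n) : cf y = 2 * (1 + dot y y)^-1. Proof. by []. Qed.

Let sqrt_r_bound : exists2 C : R, 0 <= C & forall y, Num.sqrt (r y) <= C * cf y.
Proof.
have [C C0 HC] := cfactor_bound hn hf; exists C => // y.
have d0 : 0 <= C * cf y by rewrite mulr_ge0// ltW.
by rewrite -[leRHS](ger0_norm d0) -sqrtr_sqr; exact: ler_wsqrtr.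
Qed.

Let K_bound : exists2 C : R, 0 <= C & forall y, `|K y| <= C * (1 + dot y y)^-1 ^+ n.
Proof.
have [C C0 HC] := sqrt_r_bound; have [D D0 HD] := deriv_along_bound smX smH.
exists (D * (C * 2) ^+ n) => [|y].
  by rewrite mulr_ge0// exprn_ge0// mulr_ge0.
rewrite /chart_integrand normrM -mulrA -exprMn.
apply: ler_pM; [exact: normr_ge0|exact: normr_ge0|exact/HD/sphere_stereo|].
have w0 : 0 <= C * 2 * (1 + dot y y)^-1.
  by rewrite -mulrA -cf_wt mulr_ge0// ltW.
have [Oy|nOy] := pselect (Om y); last first.
  by rewrite (volume_density_sing hf nOy) normr0 exprn_ge0.
rewrite (volume_density_regular hn hf Oy) ger0_norm ?exprn_ge0 ?sqrtr_ge0//.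
apply: lerXn2r; rewrite ?nnegrE ?sqrtr_ge0//.
by rewrite -mulrA -cf_wt; exact: HC.
Qed.

(** [X] is bounded while the coordinate vectors have length [cf y], so its components may grow like
    the inverse of [cf]. *)
Let x_bound : exists2 C : R, 0 <= C & forall y j, `|x y 0 j| <= C / cf y.
Proof.
have [M M0 HM] := vector_bound smX.
exists (n.+1%:R * M) => [|y j]; first by rewrite mulr_ge0.
rewrite mxE normrM gtr0_norm ?invr_gt0 ?exprn_gt0//.
have := norm_dot_le M0 (fun a => HM (sg y) a (sphere_stereo y)) (sv_entry_le j y).
move=> hd; apply: le_trans (ler_wpM2l _ hd) _.
  by rewrite invr_ge0 exprn_ge0// ltW.
have cn0 : cf y != 0 by rewrite gt_eqF.
have -> : (cf y ^+ 2)^-1 * (n.+1%:R * (M * cf y)) = n.+1%:R * M / cf y.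
  by field.
exact: lexx.
Qed.

(** Powers of [cf]: n - 2 from rho^(n-2), 2 from the second fundamental form or from r, and -1 from
    the components of [X], in total n - 1. *)
Let fld_bound : exists2 C : R, 0 <= C & forall i y, Om y ->
  `|fld i y| <= C * (1 + dot y y)^-1 ^+ n.-1.
Proof.
have [C C0 HC] := sqrt_r_bound; have [B B0 HB] := chart_sff_bound hf hN.
have [D D0 HD] := x_bound; have [M M0 HM] := scalar_bound smH.
have kn : 0 <= #|'I_n|%:R :> R by rewrite ler0n.
exists (C ^+ (n - 2) * (#|'I_n|%:R * (B * D) + M * C ^+ 2 * D) * 2 ^+ n.-1) => [|i y Oy].
  by repeat first [exact: kn | exact: ler0n | assumption | apply: exprn_ge0
    | apply: mulr_ge0 | apply: addr_ge0].
have cn0 : cf y != 0 by rewrite gt_eqF.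
have r0 := cfactor_gt0 hn hf Oy.
have Cc0 : 0 <= C * cf y by rewrite mulr_ge0// ltW.
have le_exp m : Num.sqrt (r y) ^+ m <= (C * cf y) ^+ m.
  by apply: lerXn2r; rewrite ?nnegrE ?sqrtr_ge0//; exact: HC.
rewrite -mulrA -exprMn -cf_wt.
have -> : C ^+ (n - 2) * (#|'I_n|%:R * (B * D) + M * C ^+ 2 * D) * cf y ^+ n.-1 =
  (C * cf y) ^+ (n - 2) * (#|'I_n|%:R * (B * cf y ^+ 2 * (D / cf y)) +
    M * (C * cf y) ^+ 2 * (D / cf y)).
  have -> : n.-1 = (n - 2).+1 by case: (n) hn => [|[|m]]//= _; rewrite subn2.
  move: (n - 2)%N => m; rewrite (exprS (cf y) m) (exprMn m C).
  move: (C ^+ m) (cf y ^+ m) (cf y) cn0 (#|'I_n|%:R : R) => a b w w0 k.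
  by field.
rewrite /fld /chart_field normrM; apply: ler_pM; [exact: normr_ge0|exact: normr_ge0| |].
  by rewrite ger0_norm ?exprn_ge0 ?sqrtr_ge0//; exact: le_exp.
apply: le_trans (ler_normB _ _) _; apply: lerD.
  apply: norm_sum_le => j; rewrite normrM.
  by apply: ler_pM; [exact: normr_ge0|exact: normr_ge0|exact: HB|exact: HD].
rewrite normrM; apply: ler_pM; [exact: normr_ge0|exact: normr_ge0| |exact: HD].
rewrite normrM; apply: ler_pM; [exact: normr_ge0|exact: normr_ge0| |].
  exact/HM/sphere_stereo.
have rE : `|r y| = Num.sqrt (r y) ^+ 2 by rewrite sqr_sqrtr ?ltW// gtr0_norm.
by rewrite rE; exact: le_exp.
Qed.

(** The factor [c] serves the sign argument, for c = 1 and c = -1. The field is scaled by c / (n -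
    1) to have divergence c K, and the constant uses [C1 + C2] to dominate both the integrand and
    the field. *)
Lemma integral_chart_integrand (c : R) :
  (\int[lebesgue_tuple n]_t (c * K (row_of_tuple t))%:E = 0)%E.
Proof.
have [C1 C10 HK] := K_bound; have [C2 C20 HW] := fld_bound.
have [s Hs] := finite_singular_chart hf.
have n1 : 1 <= n%:R - 1 :> R.
  by rewrite lerBrDr -(natrD _ 1 1) ler_nat.
have n10 : n%:R - 1 != 0 :> R by rewrite gt_eqF// (lt_le_trans ltr01).
pose d := c / (n%:R - 1).
have dc : `|d| <= `|c|.
  rewrite normrM -[leRHS]mulr1 ler_wpM2l// normfV.
  have n0 : 0 < n%:R - 1 :> R by exact: lt_le_trans ltr01 n1.
  by rewrite (gtr0_norm n0) invf_le1.
pose C := `|c| * (C1 + C2).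
have w0 (y : 'rV[R]_n) k : 0 <= (1 + dot y y)^-1 ^+ k.
  by rewrite exprn_ge0// invr_ge0 addr_ge0// dot_ge0.
have C0 : 0 <= C by rewrite mulr_ge0// addr_ge0.
have cK : continuous (fun y => c * K y).
  move=> y; have kK := @continuous_chart_integrand y.
  have h := cvgM (cvg_cst c) kK.
  exact: h.
apply: (@integral_divergence0 R n (fun y => c * K y) C s (fun i y => d * fld i y) Om hn C0 cK oOm).
- move=> y; rewrite normrM /C -mulrA ler_wpM2l//.
  by rewrite (le_trans (HK y))// ler_wpM2r// lerDl.
- by move=> y /Hs.
- by move=> i; apply: (Ck_scalec d oOm); exact: kfld.
- move=> i y Oy; rewrite normrM /C -mulrA; apply: ler_pM => //.
  by rewrite (le_trans (HW i y Oy))// ler_wpM2r// lerDr.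
- move=> y Oy; transitivity (\sum_i d * 'D_(e i) (fld i) y).
    apply: eq_bigr => i _; apply: (derive_scalec d).
    exact: Ck_diff (kfld 0 i) Oy.
  rewrite -mulr_sumr (div_fld Oy) /d; by field.
Qed.

End IntegralIdentity.

(** Around a point where [K] is positive, it exceeds half its value there on a cube of positive
    measure. *)
Lemma integral_ge0_eq0 (R : realType) m (K : 'rV[R]_m -> R) : continuous K ->
  (forall y, 0 <= K y) ->
  (\int[lebesgue_tuple m]_t (K (row_of_tuple t))%:E = 0)%E -> forall y, K y = 0.
Proof.
move=> cK K0 iK y; apply/eqP; rewrite -[_ == _]negbK; apply/negP => Ky0.
have Ky : 0 < K y by rewrite lt_neqAle eq_sym Ky0 K0.
have Ky2 : 0 < K y / 2 by rewrite divr_gt0.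
have : \forall z \near y, K y / 2 < K z.
  have lt1 : K y / 2 < K y by rewrite ltr_pdivrMr// mulr2n mulrDr mulr1 ltrDl.
  have := cK y _ (lt_nbhsr lt1).
  by apply.
move=> /nbhs_ballP[d /= d0 Hd]; have d2 : 0 < d / 2 by rewrite divr_gt0.
have HB t : box y (d / 2) t -> K y / 2 <= K (row_of_tuple t).
  move=> bt; apply/ltW/Hd; split=> // i j; rewrite ord1 /ball/= mxE distrC.
  by rewrite (le_lt_trans (bt j))// ltr_pdivrMr// mulr2n mulrDr mulr1 ltrDl.
have mK := measurable_row cK; have mb := measurable_box y (d / 2).
suff : (0 < \int[lebesgue_tuple m]_t (K (row_of_tuple t))%:E)%E by rewrite iK ltxx.
have h1 : (\int[lebesgue_tuple m]_(t in box y (d / 2)) (K y / 2)%:E <=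
  \int[lebesgue_tuple m]_(t in box y (d / 2)) (K (row_of_tuple t))%:E)%E.
  apply: ge0_le_integral => //.
  - by move=> t _; rewrite lee_fin ltW.
  - by apply/measurable_EFinP; apply: measurable_funTS; exact: mK.
have h2 : (\int[lebesgue_tuple m]_(t in box y (d / 2)) (K (row_of_tuple t))%:E <=
  \int[lebesgue_tuple m]_t (K (row_of_tuple t))%:E)%E.
  apply: ge0_subset_integral => //.
  - by apply/measurable_EFinP; exact: mK.
  - by move=> t _; rewrite lee_fin.
apply: lt_le_trans (le_trans h1 h2).
rewrite integral_cst// [X in (_ * X)%E]lebesgue_box ?ltW// -EFinM lte_fin.
by rewrite mulr_gt0// exprn_gt0// mulr_gt0.
Qed.

(** Pigeonhole: the distinct values at d / (k + 2), for k up to the size of [s], cannot all lie in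
    [s]. The shift by 2 keeps the parameter strictly below d. *)
Lemma avoid_seq (R : realType) (T : eqType) (s : seq T) (c : R -> T) (d : R) : 0 < d ->
  {in [pred t | 0 < t] &, injective c} -> exists2 t, 0 < t < d & c t \notin s.
Proof.
move=> d0 cI; pose t (k : nat) : R := d / k.+2%:R.
have t0 k : 0 < t k by rewrite divr_gt0.
have td k : t k < d by rewrite ltr_pdivrMr// ltr_pMr// ltr1n.
have [sub|/existsNP[k nk]] := pselect (forall k, c (t k) \in s); last first.
  by exists (t k); [rewrite t0 td|exact/negP].
have : uniq [seq c (t k) | k <- iota 0 (size s).+1].
  rewrite map_inj_uniq ?iota_uniq// => i j /cI; rewrite !inE => /(_ (t0 i) (t0 j)).
  move=> /(mulfI (lt0r_neq0 d0)) /invr_inj /eqP.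
  by rewrite eqr_nat => /eqP[].
move=> /(uniq_leq_size) h; suff : {subset [seq c (t k) | k <- iota 0 (size s).+1] <= s}.
  by move=> /h; rewrite size_map size_iota ltnn.
by move=> _ /mapP[k _ ->].
Qed.

(** * Density of the regular chart points, the pole included *)

Section Density.
Context {R : realType} {n : nat}.
Local Notation sg := (@stereo R n).
Local Notation E0 := (delta_mx 0 ord0 : 'rV[R]_n.+1).
Notation e i := (delta_mx 0 i : 'rV[R]_n).

(* [flip \o stereo] is [stereo] after the inversion y |-> y / |y|^2, and maps 0 to
   the pole missed by [stereo]. *)
Definition flip (p : 'rV[R]_n.+1) : 'rV[R]_n.+1 := p - p 0 ord0 *: (2 *: E0).

Lemma flip0 p : flip p 0 ord0 = - p 0 ord0.
Proof. rewrite !mxE eqxx /=; lra. Qed.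

Lemma flipS p j : flip p 0 (lift ord0 j) = p 0 (lift ord0 j).
Proof. by rewrite !mxE /= !mulr0 subr0. Qed.

Lemma stereo_inv_line (i : 'I_n) (t : R) : t != 0 ->
  sg (t^-1 *: e i) = flip (sg (t *: e i)).
Proof.
move=> t0; have dd u : dot (u *: e i) (u *: e i) = u ^+ 2.
  by rewrite dotZl dotZr dot_deltar mxE !eqxx /= mulr1.
have cfE u : cf (u *: e i) = 2 / (1 + u ^+ 2) by rewrite /cf /qd dd.
have p0 : 1 + t ^+ 2 != 0 by rewrite gt_eqF// ltr_pwDl// sqr_ge0.
have q0 : 1 + t^-1 ^+ 2 != 0 by rewrite gt_eqF// ltr_pwDl// sqr_ge0.
apply/rowP => j; case: (unliftP ord0 j) => [k ->|->].
  rewrite flipS !stereoS !cfE !mxE /=; case: (k == i); last by rewrite !mulr0.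
  by rewrite !mulr1; field; rewrite p0 t0.
rewrite flip0 !stereo0 !cfE; field.
by rewrite p0 t0.
Qed.

Lemma near_line (y v : 'rV[R]_n) (P : set 'rV[R]_n) : (\forall z \near y, P z) ->
  exists2 d : R, 0 < d & forall t, 0 < t < d -> P (y + t *: v).
Proof.
move=> nP; have ct : {for 0 : R, continuous (fun t : R => y + t *: v)}.
  by apply: cvgD; [exact: cvg_cst|apply: cvgZr_tmp; exact: cvg_id].
have : \forall t \near (0 : R), P (y + t *: v).
  by apply: ct; rewrite scale0r addr0.
move=> /nbhs_ballP[d /= d0 Hd]; exists d => // t /andP[t0 td]; apply: Hd.
by rewrite /ball/= sub0r normrN gtr0_norm.
Qed.

Lemma sphere_pole (p : 'rV[R]_n.+1) : sphere p -> p 0 ord0 = 1 -> flip (sg 0) = p.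
Proof.
move=> sp p1; have p0 j : p 0 (lift ord0 j) = 0.
  have := sp; rewrite /sphere/= /dot big_ord_recl p1 mulr1 => /eqP.
  rewrite -subr_eq0 addrAC subrr add0r psumr_eq0 => [/allP h|i _]; last first.
    by rewrite -expr2 sqr_ge0.
  have := h j (mem_index_enum _).
  by rewrite mulf_eq0 orbb => /eqP.
apply/rowP => j; case: (unliftP ord0 j) => [k ->|->].
  by rewrite flipS stereoS p0 mxE mulr0.
by rewrite flip0 stereo0 p1 /cf /qd dot0l addr0; lra.
Qed.

(** Away from the pole, one moves from the chart preimage of [p] along a coordinate line, by a small
    amount that avoids [s]. For the pole, the points t^-1 e_i with t small are used; [flip] turns
    them into a line through 0, where continuity is available. *)
Lemma near_sphere_chart (i : 'I_n) (s : seq 'rV[R]_n) (p : 'rV[R]_n.+1)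
  (P : set 'rV[R]_n.+1) : sphere p -> (\forall q \near p, P q) ->
  exists2 y, y \notin s & P (sg y).
Proof.
move=> sp nP.
have csg y : {for y, continuous sg} by exact: Ck_continuous (Ck_stereo 0) I.
have ei0 : e i != 0.
  by apply/eqP => /matrixP/(_ 0 i); rewrite !mxE !eqxx => /eqP; rewrite oner_eq0.
have eI (a b : R) : a *: e i = b *: e i -> a = b.
  by move=> /rowP/(_ i); rewrite !mxE !eqxx !mulr1.
have [p1|p1] := eqVneq (p 0 ord0) 1; last first.
  have [y yp] := stereo_surj sp p1.
  have nPs : \forall z \near y, P (sg z) by apply: csg; rewrite yp.
  have [d d0 Hd] := near_line (e i) nPs.
  have [|t td ts] := @avoid_seq R _ s (fun t => y + t *: e i) d d0.
    by move=> a b _ _ /addrI /eI.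
  by exists (y + t *: e i) => //; exact: Hd.
have nPs : \forall z \near (0 : 'rV[R]_n), P (flip (sg z)).
  apply: (csg 0 (P \o flip)).
  have cflip : {for sg 0, continuous flip}.
    have h1 : x @[x --> nbhs (sg 0)] --> sg 0 by exact: cvg_id.
    have h2 := @coord_continuous R 1 n.+1 0 ord0 (sg 0).
    have h := cvgB h1 (cvgZr_tmp (a := 2 *: E0) h2).
    exact: h.
  by apply: cflip; rewrite (sphere_pole sp p1).
have [d d0 Hd] := near_line (e i) nPs.
have [|t td ts] := @avoid_seq R _ s (fun t => t^-1 *: e i) d d0.
  by move=> a b _ _ /eI /invr_inj.
have t0 : t != 0 by case/andP: td => /lt0r_neq0.
exists (t^-1 *: e i) => //; rewrite stereo_inv_line//.
by rewrite -[t *: _]add0r; exact: Hd.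
Qed.

End Density.

Section Sign.
Context {R : realType} {n : nat}.
Variables (hn : (2 <= n)%N) (f N : 'rV[R]_n.+1 -> 'rV[R]_n.+1) (H : 'rV[R]_n.+1 -> R)
  (X : 'rV[R]_n.+1 -> 'rV[R]_n.+1).
Hypotheses (hf : branched_conformal_immersion f) (hN : unit_normal_field f N)
  (smH : sphere_smooth H) (hH : mean_curvature_of f N H) (hX : conformal_field X).
Local Notation sg := (@stereo R n).
Notation E a := (delta_mx 0 a : 'rV[R]_n.+1).

Lemma near_deriv_along (c : R) (p : 'rV[R]_n.+1) : sphere p -> 0 < c * deriv_along X H p ->
  \forall q \near p, sphere q -> 0 < c * deriv_along X H q.
Proof.
move=> sp; have smX : sphere_smooth X by case: hX => -[].
(* A continuous extension of the derivative to the punctured space, so that positivity at [p]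
   spreads to a neighbourhood. *)
pose D q := c * \sum_a radial X q 0 a * 'D_(E a) (radial H) q.
have DE q : sphere q -> c * deriv_along X H q = D q.
  move=> sq; rewrite /D /deriv_along {1}(rV_delta_sum (X q)) (sdiff_sum _ _ _ smH sq).
  congr (_ * _); apply: eq_bigr => a _.
  by rewrite radial_sphere.
rewrite (DE p sp) => Dp.
have kD : Ck 0 [set q | q != 0] D.
  apply: Ck_scalec; first exact: open_rV_neq0.
  apply: Ck_sum => [|a _]; first exact: open_rV_neq0.
  apply: (Ck_mul open_rV_neq0); first exact: (Ck_rowP _ _ open_rV_neq0).1 (smooth_Ck 0 smX) a.
  exact: Ck_derive (smooth_Ck 1 smH).
have cD : {for p, continuous D} by exact: Ck_continuous kD (sphere_neq0 sp).
have : \forall q \near p, 0 < D q.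
  by have := cD _ (lt_nbhsr Dp); apply.
by apply: filterS => q Dq sq; rewrite DE.
Qed.

(** Without a negative value, c times the integrand is continuous and nonnegative with integral 0,
    hence identically 0. But near [p] lies a regular chart point, where both the volume density and
    c times the derivative are positive. *)
Lemma deriv_along_changes_sign (c : R) p : sphere p -> 0 < c * deriv_along X H p ->
  exists q, sphere q /\ c * deriv_along X H q < 0.
Proof.
move=> sp cp; apply: contrapT => no.
have ge0 q : sphere q -> 0 <= c * deriv_along X H q.
  by move=> sq; rewrite leNgt; apply/negP => lt0; apply: no; exists q.
have [s Hs] := finite_singular_chart hf.
have [y /Hs Oy Hy] := near_sphere_chart (Ordinal (ltnW hn)) s sp (near_deriv_along sp cp).
have := Hy (sphere_stereo y); apply/negP; rewrite -leNgt.
have cK : continuous (fun z => c * chart_integrand f H X z).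
  move=> z; have kK := @continuous_chart_integrand R n f H X hf smH hX z.
  have h := cvgM (cvg_cst c) kK.
  exact: h.
have := @integral_ge0_eq0 R n _ cK _ (integral_chart_integrand hn hf hN smH hH hX c) y.
rewrite /chart_integrand (volume_density_regular hn hf Oy) mulrA => /(_ _)/eqP.
have w0 : 0 < Num.sqrt (cfactor hn f y) ^+ n by rewrite exprn_gt0// sqrtr_gt0 (cfactor_gt0 hn hf).
rewrite mulf_eq0 (gt_eqF w0) orbF => h; rewrite (eqP (h _))// => z.
by rewrite mulrA mulr_ge0//; [exact/ge0/sphere_stereo|rewrite sqrtr_ge0].
Qed.

End Sign.

Theorem corollary4 (R : realType) (n : nat) (hn : (2 <= n)%N)
  (f N : 'rV[R]_n.+1 -> 'rV[R]_n.+1) (H : 'rV[R]_n.+1 -> R)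
  (hf : branched_conformal_immersion f)
  (hN : unit_normal_field f N)
  (H_smooth : sphere_smooth H)
  (hH : mean_curvature_of f N H)
  (X : 'rV[R]_n.+1 -> 'rV[R]_n.+1) (hX : conformal_field X) :
  integral_pullback_volume f (deriv_along X H) = 0%E /\
  ((exists x, sphere x /\ deriv_along X H x <> 0) ->
   (exists x, sphere x /\ deriv_along X H x < 0) /\
   (exists x, sphere x /\ 0 < deriv_along X H x)).
Proof.
have sign := deriv_along_changes_sign hn hf hN H_smooth hH hX.
split.
  rewrite -[RHS](integral_chart_integrand hn hf hN H_smooth hH hX 1).
  by apply: eq_integral => t _; rewrite mul1r.
case=> x [sx /eqP]; rewrite neq_lt => /orP[] Dx.
  split; first by exists x.
  have [|q [sq]] := sign (-1) x sx; first by rewrite mulN1r oppr_gt0.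
  by rewrite mulN1r oppr_lt0; exists q.
split; last by exists x.
have [|q [sq]] := sign 1 x sx; first by rewrite mul1r.
by rewrite mul1r; exists q.
Qed.
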